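(* Let $r\geq 2$, let $\Lambda$ be a row finite rank-$r$ graph with finite set of objects and no sources, satisfying the Kumjian–Pask aperiodicity condition, and let $O_\Lambda$ be its rank-$r$ graph $C^*$-algebra. Let $\alpha$ be the action of $\mathbb{Z}_+^r$ on $O_\Lambda$ by the canonical shift maps, $\alpha^p=\Phi^p$ for $p\in\mathbb{Z}_+^r$. Then the topological entropy of the action is $\mathrm{ht}(\alpha)=0$.
   Context: Orders on $\mathbb{Z}_+^r$ ($\mathbb{Z}_+=\{0,1,2,\ldots\}$) are coordinatewise; $\bar n=(n,\ldots,n)\in\mathbb{Z}_+^r$ for $n\in\mathbb{N}$. Rank-$r$ graphs. A rank-$r$ graph $\Lambda$ is a small category with set of objects $\Lambda^0$ (identified with the morphisms of shape $0$), with origin and terminal maps $o,t:\Lambda\to\Lambda^0$ on morphisms (''words''), the product $uv$ being defined when $t(u)=o(v)$ (with $o(uv)=o(u)$, $t(uv)=t(v)$), together with a shape functor $\sigma$ from $\Lambda$ to the one-object category with morphisms $\mathbb{Z}_+^r$ (so $\sigma(uv)=\sigma(u)+\sigma(v)$), satisfying the factorisation property: every $w$ with $\sigma(w)=m+n$ is a unique product $w=uv$ with $\sigma(u)=m$, $\sigma(v)=n$, $t(u)=o(v)$. Put $\Lambda_m=\{w\in\Lambda:\sigma(w)=m\}$ and $\Lambda_m(\lambda)=\{w\in\Lambda_m:o(w)=\lambda\}$. $\Lambda$ is row finite if all $\Lambda_m(\lambda)$ are finite and has no sources if all $\Lambda_m(\lambda)$ are nonempty. Path space. $\Lambda^\infty$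 is the set of families $x=(x_{(m,n)})_{m\le n}$ ($m,n\in\mathbb{Z}_+^r$) with $x_{(m,n)}\in\Lambda_{n-m}$ and $x_{(m,n)}=x_{(m,k)}x_{(k,n)}$ for all $m\le k\le n$; $o(x)=o(x_{(0,n)})$; $T^p(x)_{(m,n)}=x_{(m+p,n+p)}$. Aperiodicity condition: for every $a\in\Lambda^0$ there is $x\in\Lambda^\infty$ with $o(x)=a$ such that for no $n\in\mathbb{Z}_+^r$ does $y=T^nx$ have a nonzero period, where $q\in\mathbb{Z}^r$ is a period of $y$ if $y_{(m+q,k+q)}=y_{(m,k)}$ for all $m\le k$ in $\mathbb{Z}_+^r$ with $m+q\ge0$. The algebra. $O_\Lambda$ is the universal $C^*$-algebra generated by operators $s_u$, $u\in\Lambda$, such that: (1) $\{s_a: a\in\Lambda^0\}$ are pairwise orthogonal projections; (2) $s_{uv}=s_us_v$ if $t(u)=o(v)$; (3) $s_u^*s_u=s_{t(u)}$; (4) $s_a=\sum_{\sigma(u)=n,\,o(u)=a}s_us_u^*$ for all $a\in\Lambda^0$, $n\in\mathbb{Z}_+^r$. Under the assumptions made it is unital and nuclear. For $p\in\mathbb{Z}_+^r$ the canonical shift map is the unital completely positive (ucp) map $\Phi^p(Y)=\sum_{w\in\Lambda_p}s_wYs_w^*$. Entropy of actions. For a nuclear unital $C^*$-algebra $A$, a finite set $\Omega\subset A$ and $\varepsilon>0$, $\mathrm{rcp}(\Omega,\varepsilon)$ is the minimum of $\mathrm{rank}\,C$ (the dimension of a maximal abelian subalgebra of $C$) over all finite-dimensional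 $C^*$-algebras $C$ for which there are ucp maps $\phi:C\to A$, $\psi:A\to C$ with $\|\phi\circ\psi(a)-a\|<\varepsilon$ for all $a\in\Omega$. For an action $\alpha$ of $\mathbb{Z}_+^r$ on $A$ by ucp maps put $\Omega^{(n)}=\bigcup_{l\in\mathbb{Z}_+^r,\ l\le\bar n}\alpha^l(\Omega)$ and $$\mathrm{ht}(\alpha)=\sup_{\Omega\subset A\text{ finite},\ \varepsilon>0}\ \limsup_{n\to\infty}\frac1{n^r}\log\mathrm{rcp}(\Omega^{(n)},\varepsilon).$$ *)

(* Defs.v *)
From HB Require Import structures.
From mathcomp Require Import all_boot all_order all_algebra.
From mathcomp Require Import complex.
From mathcomp Require Import all_classical all_reals all_analysis.
Set Implicit Arguments.
Unset Strict Implicit.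
Unset Printing Implicit Defensive.
Import Order.TTheory GRing.Theory Num.Theory.
Import numFieldNormedType.Exports.
Local Open Scope classical_set_scope.
Local Open Scope ring_scope.
Local Open Scope complex_scope.

(** The norm [`|x|] takes its values in R[i], as always for a normed module
    over R[i].  MathComp has no common structure for normed modules and rings
    and none can be declared on top of it: the multiplication is therefore part
    of the mixin and the algebra structure is recovered as an instance below.
    The zero algebra is excluded, as always in [algType]. *)
HB.mixin Record isCStarAlgebra (R : realType) A
    of CompleteNormedModule R[i] A := {
  cs_one : A ;
  cs_mul : A -> A -> A ;
  star : A -> A ;
  cs_mulA : associative cs_mul ;
  cs_mul1x : left_id cs_one cs_mul ;
  cs_mulx1 : right_id cs_one cs_mul ;
  cs_mulDl : left_distributive cs_mul +%R ;
  cs_mulDr : right_distributive cs_mul +%R ;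
  cs_one_neq0 : cs_one != 0 ;
  cs_scaleAl : forall (c : R[i]) (x y : A),
    c *: cs_mul x y = cs_mul (c *: x) y ;
  cs_scaleAr : forall (c : R[i]) (x y : A),
    c *: cs_mul x y = cs_mul x (c *: y) ;
  star_conj_linear : forall (c : R[i]) (x y : A),
    star (c *: x + y) = c^* *: star x + star y ;
  starK : involutive star ;
  starM : forall x y : A, star (cs_mul x y) = cs_mul (star y) (star x) ;
  normM_le : forall x y : A, `|cs_mul x y| <= `|x| * `|y| ;
  cstar_identity : forall x : A, `|cs_mul (star x) x| = `|x| ^+ 2
}.

#[short(type="cstarType")]
HB.structure Definition CStarAlgebra (R : realType) :=
  { A of isCStarAlgebra R A & CompleteNormedModule R[i] A }.

HB.instance Definition _ (R : realType) (A : cstarType R) :=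
  GRing.Zmodule_isNzRing.Build (CStarAlgebra.sort A)
    (@cs_mulA R A) (@cs_mul1x R A) (@cs_mulx1 R A)
    (@cs_mulDl R A) (@cs_mulDr R A) (@cs_one_neq0 R A).
HB.instance Definition _ (R : realType) (A : cstarType R) :=
  GRing.Lmodule_isLalgebra.Build R[i] (CStarAlgebra.sort A) (@cs_scaleAl R A).
HB.instance Definition _ (R : realType) (A : cstarType R) :=
  GRing.Lalgebra_isAlgebra.Build R[i] (CStarAlgebra.sort A) (@cs_scaleAr R A).

#[short(type="finCstarType")]
HB.structure Definition FinCStarAlgebra (R : realType) :=
  { A of CStarAlgebra R A & Vector R[i] A }.

HB.instance Definition _ (R : realType) (C : finCstarType R) :=
  GRing.Algebra.copy (FinCStarAlgebra.sort C)
    (CStarAlgebra.sort (C : cstarType R)).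

(** A *-homomorphism is not required to preserve the unit. *)
Definition star_hom (R : realType) (A B : cstarType R)
    (f : {linear A -> B}) : Prop :=
  (forall x y, f (x * y) = f x * f y) /\ (forall x, f (star x) = star (f x)).

(** Positivity in the C*-algebra of n x n matrices over A. *)
Definition mx_pos (R : realType) (A : cstarType R) (n : nat)
    (X : 'M[A]_n) : Prop :=
  exists Y : 'M[A]_n, X = (map_mx star Y)^T *m Y.

Definition completely_positive (R : realType) (A B : cstarType R)
    (f : A -> B) : Prop :=
  forall (n : nat) (X : 'M[A]_n), mx_pos X -> mx_pos (map_mx f X).

Definition ucp (R : realType) (A B : cstarType R)
    (f : {linear A -> B}) : Prop :=
  f 1 = 1 /\ completely_positive f.

Definition zplus (r : nat) := {ffun 'I_r -> nat}.
HB.instance Definition _ (r : nat) := GRing.Nmodule.on (zplus r).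

Definition zle (r : nat) (m n : zplus r) : Prop := forall i, (m i <= n i)%N.
Definition zsub (r : nat) (n m : zplus r) : zplus r :=
  [ffun i => (n i - m i)%N].
Definition zbar (r n : nat) : zplus r := [ffun=> n].

(** [wmul u v] is the product of the category when [wt u = wo v]; its value
    is unconstrained otherwise.  The words of shape 0 are exactly the
    identities [wid a], by unique factorisation. *)
Record rank_graph (r : nat) := RankGraph {
  vertex : choiceType ;
  word : choiceType ;
  wo : word -> vertex ;
  wt : word -> vertex ;
  wid : vertex -> word ;
  wmul : word -> word -> word ;
  shape : word -> zplus r ;
  wo_id : forall a, wo (wid a) = a ;
  wt_id : forall a, wt (wid a) = a ;
  wo_mul : forall u v, wt u = wo v -> wo (wmul u v) = wo u ;
  wt_mul : forall u v, wt u = wo v -> wt (wmul u v) = wt v ;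
  wmul1w : forall u, wmul (wid (wo u)) u = u ;
  wmulw1 : forall u, wmul u (wid (wt u)) = u ;
  wmulA : forall u v w, wt u = wo v -> wt v = wo w ->
    wmul u (wmul v w) = wmul (wmul u v) w ;
  shape_id : forall a, shape (wid a) = 0 ;
  shape_mul : forall u v, wt u = wo v ->
    shape (wmul u v) = shape u + shape v ;
  factorisation : forall (w : word) (m n : zplus r), shape w = m + n ->
    exists! uv : word * word,
      [/\ shape uv.1 = m, shape uv.2 = n, wt uv.1 = wo uv.2
        & w = wmul uv.1 uv.2]
}.

Section Graph.
Variables (r : nat) (L : rank_graph r).

Definition words (m : zplus r) : set (word L) := [set w | shape w = m].
Definition words_from (m : zplus r) (a : vertex L) : set (word L) :=
  [set w | shape w = m /\ wo w = a].

Definition row_finite : Prop := forall m a, finite_set (words_from m a).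
Definition no_sources : Prop := forall m a, words_from m a !=set0.

(** A family indexed by pairs m <= n is a function of two arguments whose
    values at the other pairs are irrelevant. *)
Definition is_path (x : zplus r -> zplus r -> word L) : Prop :=
  (forall m n, zle m n -> shape (x m n) = zsub n m) /\
  (forall m k n, zle m k -> zle k n ->
     wt (x m k) = wo (x k n) /\ x m n = wmul (x m k) (x k n)).

Definition path_origin (x : zplus r -> zplus r -> word L) : vertex L :=
  wo (x 0 0).

Definition path_shift (p : zplus r) (x : zplus r -> zplus r -> word L) :=
  fun m n => x (m + p) (n + p).

(** [m'] and [k'] stand for m + q and k + q, when these have nonnegative
    coordinates. *)
Definition path_period (y : zplus r -> zplus r -> word L)
    (q : {ffun 'I_r -> int}) : Prop :=
  forall m k m' k' : zplus r, zle m k ->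
    (forall i, (m' i)%:Z = (m i)%:Z + q i) ->
    (forall i, (k' i)%:Z = (k i)%:Z + q i) ->
    y m' k' = y m k.

Definition aperiodic : Prop :=
  forall a : vertex L, exists x, [/\ is_path x, path_origin x = a &
    forall (n : zplus r) (q : {ffun 'I_r -> int}),
      path_period (path_shift n x) q -> q = 0].

End Graph.

Definition graph_family (R : realType) (r : nat) (L : rank_graph r)
    (B : cstarType R) (s : word L -> B) : Prop :=
  [/\ (forall a, star (s (wid a)) = s (wid a) /\
         s (wid a) * s (wid a) = s (wid a)) /\
      (forall a b, a <> b -> s (wid a) * s (wid b) = 0),
      forall u v, wt u = wo v -> s (wmul u v) = s u * s v,
      forall u, star (s u) * s u = s (wid (wt u)) &
      forall (a : vertex L) (n : zplus r),
        s (wid a) = \sum_(u \in words_from n a) s u * star (s u)].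

Definition generates (R : realType) (I : Type) (B : cstarType R)
    (s : I -> B) : Prop :=
  forall D : set B, closed D -> (forall i, D (s i)) ->
    (forall (c : R[i]) x y, D x -> D y -> D (c *: x + y)) ->
    (forall x y, D x -> D y -> D (x * y)) ->
    (forall x, D x -> D (star x)) ->
    D = setT.

(** [(A, s)] is the universal C*-algebra O_L with its generators.  A family in
    a C*-algebra without unit is also a family in the unitization, and by
    [generates] a *-homomorphism into the latter extending the family takes
    its values in the former; it is therefore enough to let [B] range over
    unital C*-algebras.  If L has no vertex there is no such [A], the zero
    algebra being excluded. *)
Definition is_graph_algebra (R : realType) (r : nat) (L : rank_graph r)
    (A : cstarType R) (s : word L -> A) : Prop :=
  [/\ graph_family s, generates s &
      forall (B : cstarType R) (S : word L -> B), graph_family S ->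
        exists f : {linear A -> B}, star_hom f /\ (forall u, f (s u) = S u)].

Definition canonical_shift (R : realType) (r : nat) (L : rank_graph r)
    (A : cstarType R) (s : word L -> A) (p : zplus r) (Y : A) : A :=
  \sum_(w \in words p) s w * Y * star (s w).

Definition abelian_subalgebra (R : realType) (C : finCstarType R)
    (D : {vspace C}) : Prop :=
  [/\ {in D, forall x, star x \in D}, {in D &, forall x y, x * y \in D}
    & {in D &, forall x y, x * y = y * x}].

Definition maximal_abelian (R : realType) (C : finCstarType R)
    (D : {vspace C}) : Prop :=
  abelian_subalgebra D /\
  (forall E : {vspace C}, abelian_subalgebra E -> (D <= E)%VS -> E = D).

(** Well defined: all maximal abelian *-subalgebras of C have the same
    dimension. *)
Definition has_rank (R : realType) (C : finCstarType R) (d : nat) : Prop :=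
  exists D : {vspace C}, maximal_abelian D /\ \dim D = d.

Definition approximable (R : realType) (A : cstarType R) (Omega : set A)
    (eps : R) (C : finCstarType R) : Prop :=
  exists (phi : {linear C -> A}) (psi : {linear A -> C}),
    [/\ ucp phi, ucp psi &
        forall a, Omega a -> `|phi (psi a) - a| < eps%:C].

(** Equal to +oo when there is no approximation at all, which does not happen
    if A is nuclear and Omega is finite. *)
Definition rcp (R : realType) (A : cstarType R) (Omega : set A)
    (eps : R) : \bar R :=
  ereal_inf [set d%:R%:E | d in
    [set d : nat | exists C : finCstarType R,
                     approximable Omega eps C /\ has_rank C d]].

Definition orbit_set (R : realType) (r : nat) (A : cstarType R)
    (alpha : zplus r -> A -> A) (Omega : set A) (n : nat) : set A :=
  \bigcup_(l in [set l | zle l (zbar r n)]) (alpha l @` Omega).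

Definition entropy (R : realType) (r : nat) (A : cstarType R)
    (alpha : zplus r -> A -> A) : \bar R :=
  ereal_sup [set h | exists (Omega : set A) (eps : R),
    [/\ finite_set Omega, 0 < eps &
        h = limn_esup (fun n : nat =>
              ((n%:R ^+ r)^-1%:E * lne (rcp (orbit_set alpha Omega n) eps))%E)]].

(* Main.v *)
(** Let [F] be the box [{0,...,K-1}^r], and let the [s_w], with [w] of shape in
    [m + F], index the rows of the matrices over the complex numbers.  For a
    gauge-invariant positive functional [om] with [om (s_a) = 1] the maps
    [psi X = (om (s_w^* X s_z))_(w,z)] and
    [phi E = |F|^-1 sum_(w,z) E_(w,z) s_w s_z^*] are ucp.  Because only the common
    suffixes of words survive in [s_w^* X s_z], the map [phi psi] multiplies a
    combination [X] of elements [s_u s_v^*] with [u] and [v] of fixed shapes at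
    most [m] by [|{(g,h) in F^2 : g - h = |u| - |v|}| / |F|], a Foelner ratio that
    tends to 1 as [K] grows.  The canonical shifts of index at most [n] preserve
    the degree [|u| - |v|] and raise the shapes by at most [n], so for a fixed [K]
    it suffices that [m] exceeds [n] by a constant.  The rank of the matrix
    algebra is then at most exponential in [n], which is negligible against
    [n ^ r] as [r >= 2].

    Complete positivity needs the order structure of a C*-algebra and of the
    matrices over it (sums of elements [x^* x] are of this form), which is
    developed from square roots; [om] comes from a Hahn-Banach argument followed
    by averaging over finitely many gauge automorphisms. *)

Require Import Defs.
From HB Require Import structures.
From mathcomp Require Import all_boot all_order all_algebra.
From mathcomp Require Import complex.
From mathcomp Require Import cyclic separable cyclotomic.
From mathcomp Require Import all_classical all_reals all_analysis.
From mathcomp Require Import zify ring lra.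

Set Implicit Arguments.
Unset Strict Implicit.
Unset Printing Implicit Defensive.
Import Order.TTheory GRing.Theory Num.Theory.
Import numFieldNormedType.Exports.
Local Open Scope classical_set_scope.
Local Open Scope ring_scope.
Local Open Scope complex_scope.

(** * Norms and limits *)

(** Why the ratio of [phi psi] is exact: a compression [s_w^* X s_z] of degree zero is a scalar
    times the projection at the endpoint of [w], and [om] must read off that scalar wherever words
    end. Hence [om] is normalised at every vertex separately and is in general not a state. A
    surviving pair of shapes then returns the sum of all [r_w X r_z], where [r_w = s_w s_w^*]; the
    range projections of one shape sum to 1, so this is a full copy of [X]. The other pairs give
    compressions of nonzero degree, which [om] kills; the ratio counts the survivors. The degrees
    met are bounded in terms of [K] and of the degree of [X], independently of [n], which is why
    invariance under a finite group of gauge automorphisms is enough. The form of [ucp] shapes the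
    first half: positivity in matrices means being one square, so sums of squares must be gathered
    into a single one. For this the matrices over [A] are made a C*-algebra, acting on the Hilbert
    module of [n]-tuples. In the other direction the entropy is nonnegative because no rank is 0. *)

Section CStarNorm.
Variables (R : realType) (A : cstarType R).
Implicit Types (x y z : A) (c : R[i]) (t : R).

Lemma starD x y : star (x + y) = star x + star y.
Proof. by have := star_conj_linear 1 x y; rewrite conjC1 !scale1r. Qed.

Lemma star0 : star (0 : A) = 0.
Proof. by apply: (addrI (star 0)); rewrite -starD !addr0. Qed.

Lemma starZ c x : star (c *: x) = (Num.conj c) *: star x.
Proof. by have := star_conj_linear c x 0; rewrite star0 !addr0. Qed.

Lemma starN x : star (- x) = - star x.
Proof. by apply: (addrI (star x)); rewrite -starD !subrr star0. Qed.

Lemma starB x y : star (x - y) = star x - star y.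
Proof. by rewrite starD starN. Qed.

Lemma star_mul x y : star (x * y) = star y * star x.
Proof. exact: starM. Qed.

Lemma star1 : star (1 : A) = 1.
Proof. by rewrite -[LHS]mulr1 -{2}[1]starK -star_mul mulr1 starK. Qed.

Lemma star_sum (I : Type) (r : seq I) (P : pred I) (F : I -> A) :
  star (\sum_(i <- r | P i) F i) = \sum_(i <- r | P i) star (F i).
Proof. exact: (big_morph _ starD star0). Qed.

Lemma starZr t x : star (t%:C *: x) = t%:C *: star x.
Proof. by rewrite starZ; congr (_ *: _); exact: conjc_real. Qed.

(** The norm of the structure is a complex number; its real part carries all of it ([nrmE]) and is
    open to real arithmetic. *)
Definition nrm x : R := complex.Re `|x|.

Lemma nrmE x : `|x| = (nrm x)%:C.
Proof. by rewrite /nrm RRe_real// normr_real. Qed.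

Lemma nrm_ge0 x : 0 <= nrm x.
Proof. by rewrite -lecR -nrmE normr_ge0. Qed.
Hint Extern 0 (is_true (_ <= nrm _)) => solve [apply: nrm_ge0] : core.

Lemma nrm0 : nrm 0 = 0.
Proof. by rewrite /nrm normr0. Qed.

Lemma nrm_eq0 x : nrm x = 0 -> x = 0.
Proof. by move=> h; apply/eqP; rewrite -normr_eq0 nrmE h. Qed.

Lemma nrmN x : nrm (- x) = nrm x.
Proof. by rewrite /nrm normrN. Qed.

Lemma nrmBC x y : nrm (x - y) = nrm (y - x).
Proof. by rewrite -nrmN opprB. Qed.

Lemma nrmD x y : nrm (x + y) <= nrm x + nrm y.
Proof. by rewrite -lecR rmorphD /= -!nrmE ler_normD. Qed.

Lemma nrmB x y : nrm (x - y) <= nrm x + nrm y.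
Proof. by rewrite -(nrmN y) nrmD. Qed.

Lemma nrm_sum (I : Type) (r : seq I) (P : pred I) (F : I -> A) :
  nrm (\sum_(i <- r | P i) F i) <= \sum_(i <- r | P i) nrm (F i).
Proof.
elim/big_rec2: _ => [|i a b _ h]; first by rewrite nrm0.
by apply: le_trans (nrmD _ _) _; rewrite lerD2l.
Qed.

Lemma nrmM x y : nrm (x * y) <= nrm x * nrm y.
Proof. by rewrite -lecR rmorphM /= -!nrmE; exact: normM_le. Qed.

Lemma nrmZ c x : nrm (c *: x) = complex.Re `|c| * nrm x.
Proof.
rewrite /nrm normrZ nrmE -{1}(@RRe_real _ `|c|) ?normr_real//.
by rewrite -rmorphM.
Qed.

Lemma nrmZr t x : nrm (t%:C *: x) = `|t| * nrm x.
Proof. by rewrite nrmZ normc_def /= expr0n addr0 sqrtr_sqr. Qed.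

Lemma nrm_cstar x : nrm (star x * x) = nrm x ^+ 2.
Proof.
have h := cstar_identity x; rewrite [X in X = _]nrmE (nrmE x) -rmorphXn /= in h.
by case: h.
Qed.

Lemma nrm_star x : nrm (star x) = nrm x.
Proof.
have le y : nrm y <= nrm (star y).
  have [->|y0] := eqVneq (nrm y) 0; first exact: nrm_ge0.
  have yp : 0 < nrm y by rewrite lt_neqAle eq_sym y0 nrm_ge0.
  by rewrite -(ler_pM2r yp) -expr2 -nrm_cstar nrmM.
by apply/eqP; rewrite eq_le le -{2}(starK x) le.
Qed.

Lemma nrm1 : nrm 1 = 1.
Proof.
have := nrm_cstar 1; rewrite star1 mulr1 expr2 => h.
have n0 : nrm 1 != 0 by apply/negP => /eqP /nrm_eq0 /eqP; rewrite oner_eq0.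
by apply: (mulfI n0); rewrite mulr1 -h.
Qed.

Lemma nrm_sa x : star x = x -> nrm (x * x) = nrm x ^+ 2.
Proof. by move=> h; rewrite -{1}h nrm_cstar. Qed.

Lemma nrm_unitary x : star x * x = 1 -> nrm x = 1.
Proof.
move=> h; apply/eqP.
by rewrite -(@eqrXn2 _ 2) ?nrm_ge0// -nrm_cstar h nrm1 expr1n.
Qed.

Lemma half2 x : 2^-1%:C *: (x + x) = x.
Proof.
have -> : x + x = 2%:C *: x by rewrite rmorph_nat scaler_nat mulr2n.
by rewrite scalerA -rmorphM /= mulVf ?pnatr_eq0// scale1r.
Qed.

Definition lim_to (u : nat -> A) (l : A) : Prop :=
  forall e : R, 0 < e -> exists N, forall n, (N <= n)%N -> nrm (u n - l) < e.

Lemma lim_to_uniq u l l' : lim_to u l -> lim_to u l' -> l = l'.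
Proof.
move=> h h'; apply/eqP; rewrite -subr_eq0; apply/eqP/nrm_eq0/eqP.
rewrite eq_le nrm_ge0 andbT leNgt; apply/negP => p.
have p2 : 0 < nrm (l - l') / 2 by lra.
have [N hN] := h _ p2; have [N' hN'] := h' _ p2.
have := hN (maxn N N') (leq_maxl _ _); have := hN' (maxn N N') (leq_maxr _ _).
have := nrmD (l - u (maxn N N')) (u (maxn N N') - l').
by rewrite addrA subrK (nrmBC l); lra.
Qed.

Lemma lim_to_ext u v l : (forall n, u n = v n) -> lim_to u l -> lim_to v l.
Proof. by move=> h hu e /hu[N hN]; exists N => n /hN; rewrite h. Qed.

Lemma lim_to_shift u l : lim_to u l -> lim_to (fun n => u n.+1) l.
Proof. by move=> hu e /hu[N hN]; exists N => n h; apply/hN/ltnW. Qed.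

Lemma lim_toD u v l m :
  lim_to u l -> lim_to v m -> lim_to (fun n => u n + v n) (l + m).
Proof.
move=> hu hv e e0; have e2 : 0 < e / 2 by lra.
have [N hN] := hu _ e2; have [N' hN'] := hv _ e2.
exists (maxn N N') => n; rewrite geq_max => /andP[/hN a /hN' b].
by rewrite opprD addrACA; have := nrmD (u n - l) (v n - m); lra.
Qed.

Lemma lim_toZr t u l : lim_to u l -> lim_to (fun n => t%:C *: u n) (t%:C *: l).
Proof.
move=> hu e e0; have t0 : 0 < `|t| + 1 by rewrite ltr_wpDl.
have [N hN] := hu _ (divr_gt0 e0 t0); exists N => n /hN h.
rewrite -scalerBr nrmZr; rewrite ltr_pdivlMr// in h.
apply: le_lt_trans h; rewrite mulrC; apply: ler_wpM2l => //.
by rewrite lerDl.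
Qed.

Lemma lim_to_star u l : lim_to u l -> lim_to (fun n => star (u n)) (star l).
Proof.
by move=> hu e /hu[N hN]; exists N => n /hN; rewrite -starB nrm_star.
Qed.

Lemma lim_to_cst l : lim_to (fun=> l) l.
Proof. by move=> e e0; exists 0%N => n _; rewrite subrr nrm0. Qed.

Lemma lim_to_nrm_le u l t : lim_to u l -> (forall n, nrm (u n) <= t) -> nrm l <= t.
Proof.
move=> hu ht; rewrite leNgt; apply/negP => h.
have [|N /(_ N (leqnn N))] := hu (nrm l - t); first by lra.
have := nrmD (u N) (l - u N); rewrite addrC subrK (nrmBC l).
by have := ht N; lra.
Qed.

Lemma lim_toM u v l m t : (forall n, nrm (u n) <= t) ->
  lim_to u l -> lim_to v m -> lim_to (fun n => u n * v n) (l * m).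
Proof.
move=> ht hu hv e e0.
have t0 : 0 <= t by apply: le_trans (ht 0%N); exact: nrm_ge0.
have p1 : 0 < nrm m + 1 by rewrite ltr_wpDl.
have p2 : 0 < t + 1 by rewrite ltr_wpDl.
have e2 : 0 < e / 2 by lra.
have [N hN] := hu _ (divr_gt0 e2 p1); have [N' hN'] := hv _ (divr_gt0 e2 p2).
exists (maxn N N') => n; rewrite geq_max => /andP[/hN a /hN' b].
have -> : u n * v n - l * m = u n * (v n - m) + (u n - l) * m.
  by rewrite mulrBr mulrBl addrA subrK.
have h1 := nrmD (u n * (v n - m)) ((u n - l) * m).
have h2 := nrmM (u n) (v n - m); have h3 := nrmM (u n - l) m.
rewrite ltr_pdivlMr// in a; rewrite ltr_pdivlMr// in b.
have h4 : nrm (u n) * nrm (v n - m) <= t * nrm (v n - m).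
  by apply: ler_wpM2r => //; exact: nrm_ge0.
have := nrm_ge0 (v n - m); have := nrm_ge0 (u n - l); nra.
Qed.

Lemma lim_toMl x u l : lim_to u l -> lim_to (fun n => x * u n) (x * l).
Proof. exact: (@lim_toM (fun=> x) _ _ _ (nrm x) _ (lim_to_cst x)). Qed.

Lemma lim_toMr x u l : lim_to u l -> lim_to (fun n => u n * x) (l * x).
Proof.
move=> h; have := lim_to_star (lim_toMl (star x) (lim_to_star h)).
by rewrite star_mul !starK; apply: lim_to_ext => n; rewrite star_mul !starK.
Qed.

Lemma cauchy_lim u :
  (forall e : R, 0 < e -> exists N, forall n, (N <= n)%N -> nrm (u n - u N) < e) ->
  exists l, lim_to u l.
Proof.
move=> hu.
have cu : cvg (u @ \oo).
  apply: cauchy_cvg; apply/cauchy_ballP => _/posnumP[e].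
  have e0 : 0 < complex.Re e%:num / 2.
    have : 0 < e%:num by [].
    by rewrite ltcE => /andP[_ /=]; lra.
  have [N hN] := hu _ e0.
  have eE : (complex.Re e%:num)%:C = e%:num by rewrite RRe_real// gtr0_real.
  rewrite near_simpl/=; exists (([set n | (N <= n)%N], [set n | (N <= n)%N]))%classic => /=.
    by split; exists N.
  move=> [m n]/= [/hN hm /hN hn]; rewrite -ball_normE /ball_/= nrmE -eE ltcR.
  have := nrmB (u m - u N) (u n - u N); rewrite opprB addrA subrK; lra.
exists (lim (u @ \oo)) => e e0.
have /cvgrPdist_lt /(_ e%:C) h := cu.
have [|N _ hN] := h; first by rewrite ltcR.
by exists N => n /hN /=; rewrite nrmE ltcR nrmBC.
Qed.

End CStarNorm.
#[global] Hint Extern 0 (is_true (_ <= nrm _)) => solve [apply: nrm_ge0] : core.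

(** * Square roots and positivity *)

Section CStarOrder.
Variables (R : realType) (A : cstarType R).
Implicit Types (x y z h k b : A) (t : R).

Lemma commZ t x y : GRing.comm x y -> GRing.comm x (t%:C *: y).
Proof. by move=> h; rewrite /GRing.comm -scalerAr -scalerAl h. Qed.

Lemma lim_to_comm x u l : (forall n, GRing.comm x (u n)) ->
  lim_to u l -> GRing.comm x l.
Proof.
move=> h hu; apply: (@lim_to_uniq _ _ (fun n => x * u n)).
  exact: lim_toMl.
by apply: (@lim_to_ext _ _ (fun n => u n * x)) => [n|]; [rewrite h|exact: lim_toMr].
Qed.

(* The iteration y := (b + y^2)/2 converges to 1 - sqrt (1 - b), dominated by the
   same iteration for the scalar 1; this needs neither spectra nor power series. *)
Fixpoint sqrt_iter b n : A :=
  if n is n'.+1 then 2^-1%:C *: (b + sqrt_iter b n' * sqrt_iter b n') else 0.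

Fixpoint sqrt_dom n : R :=
  if n is n'.+1 then 2^-1 * (1 + sqrt_dom n' * sqrt_dom n') else 0.

Lemma sqrt_dom_bounds n :
  [/\ 0 <= sqrt_dom n, sqrt_dom n <= 1 & sqrt_dom n <= sqrt_dom n.+1].
Proof.
elim: n => [|n [h0 h1 h2]] /=; first by split; lra.
move: h2 => /=; set a := sqrt_dom n in h0 h1 *.
by move=> h2; split; nra.
Qed.

Lemma sqrt_iter_comm b n x : GRing.comm x b -> GRing.comm x (sqrt_iter b n).
Proof.
move=> h; elim: n => [|n ih] /=; first exact: commr0.
by apply: commZ; apply: commrD => //; apply: commrM.
Qed.

Lemma sqrt_iter_star b n : star b = b -> star (sqrt_iter b n) = sqrt_iter b n.
Proof.
move=> h; elim: n => [|n ih] /=; first exact: star0.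
by rewrite starZr starD h star_mul ih.
Qed.

Lemma nrm_half x : nrm (2^-1%:C *: x) = 2^-1 * nrm x.
Proof. by rewrite nrmZr ger0_norm// invr_ge0. Qed.

Lemma sqrt_iter_nrm b n : nrm b <= 1 -> nrm (sqrt_iter b n) <= sqrt_dom n.
Proof.
move=> h; elim: n => [|n ih] /=; first by rewrite nrm0.
rewrite nrm_half; have := nrmD b (sqrt_iter b n * sqrt_iter b n).
have := nrmM (sqrt_iter b n) (sqrt_iter b n).
have := nrm_ge0 (sqrt_iter b n); nra.
Qed.

(** The iterates commute, so each difference is half the product of the previous difference and a
    sum of iterates. The scalar iteration obeys the same identity, and the two are compared factor
    by factor. *)
Lemma sqrt_iter_step b n : nrm b <= 1 ->
  nrm (sqrt_iter b n.+1 - sqrt_iter b n) <= sqrt_dom n.+1 - sqrt_dom n.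
Proof.
move=> h; elim: n => [|n ih].
  by rewrite /= subr0 mulr0 addr0 nrm_half mulr0 addr0 subr0; lra.
have cm : GRing.comm (sqrt_iter b n) (sqrt_iter b n.+1).
  apply: sqrt_iter_comm; apply: commr_sym; exact: sqrt_iter_comm.
have e : sqrt_iter b n.+2 - sqrt_iter b n.+1 =
   2^-1%:C *: ((sqrt_iter b n.+1 - sqrt_iter b n) * (sqrt_iter b n.+1 + sqrt_iter b n)).
  rewrite [sqrt_iter b n.+2]/= {2}[sqrt_iter b n.+1]/= -scalerBr opprD addrACA subrr add0r.
  by rewrite [in RHS]mulrDr [in RHS]mulrBl [in RHS]mulrBl cm addrA subrK.
have e' : sqrt_dom n.+2 - sqrt_dom n.+1 =
   2^-1 * ((sqrt_dom n.+1 - sqrt_dom n) * (sqrt_dom n.+1 + sqrt_dom n)).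
  have E1 : sqrt_dom n.+1 = 2^-1 * (1 + sqrt_dom n * sqrt_dom n) by [].
  have E2 : sqrt_dom n.+2 = 2^-1 * (1 + sqrt_dom n.+1 * sqrt_dom n.+1) by [].
  move: (sqrt_dom n) (sqrt_dom n.+1) (sqrt_dom n.+2) E1 E2 => a b' c E1 E2; lra.
rewrite e e' nrm_half ler_pM2l ?invr_gt0//.
apply: le_trans (nrmM _ _) _; apply: ler_pM => //.
apply: le_trans (nrmD _ _) _; apply: lerD; exact: sqrt_iter_nrm.
Qed.

Lemma sqrt_iter_cauchy b n m : nrm b <= 1 ->
  nrm (sqrt_iter b (n + m) - sqrt_iter b n) <= sqrt_dom (n + m) - sqrt_dom n.
Proof.
move=> h; elim: m => [|m ih]; first by rewrite addn0 !subrr nrm0.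
rewrite addnS; have := sqrt_iter_step (n + m) h.
have := nrmD (sqrt_iter b (n + m).+1 - sqrt_iter b (n + m)) (sqrt_iter b (n + m) - sqrt_iter b n).
rewrite addrA subrK; lra.
Qed.

(** Take [u N] within [e] of the supremum. Only the upper half of the Cauchy estimate is claimed,
    and that is all the domination by [sqrt_dom] uses. *)
Lemma bounded_incr_cauchy (u : nat -> R) (e : R) : (forall n, u n <= 1) ->
  0 < e -> exists N, forall n, (N <= n)%N -> u n - u N < e.
Proof.
move=> h e0.
have hs : has_sup (range u).
  by split; [exists (u 0%N), 0%N|exists 1 => _ [n _ <-]].
have [_ [N _ <-] hN] := sup_adherent e0 hs.
exists N => n _; have : u n <= sup (range u) by apply: sup_upper_bound => //; exists n.
lra.
Qed.

Lemma sqrt_exists b : star b = b -> nrm b <= 1 ->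
  exists s, [/\ star s = s, nrm (1 - s) <= 1, s * s = 1 - b
     & forall x, GRing.comm x b -> GRing.comm x s].
Proof.
move=> bs b1.
have [|y hy] := @cauchy_lim _ _ (sqrt_iter b).
  move=> e e0; have [|N hN] := @bounded_incr_cauchy sqrt_dom e _ e0.
    by move=> n; have [] := sqrt_dom_bounds n.
  exists N => n Nn; apply: le_lt_trans (hN n Nn).
  by rewrite -(subnKC Nn); exact: sqrt_iter_cauchy.
have n1 n : nrm (sqrt_iter b n) <= 1.
  by apply: le_trans (sqrt_iter_nrm n b1) _; have [] := sqrt_dom_bounds n.
have ys : star y = y.
  apply: (lim_to_uniq (lim_to_star hy)).
  by apply: lim_to_ext hy => n; rewrite sqrt_iter_star.
have yE : y = 2^-1%:C *: (b + y * y).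
  apply: (lim_to_uniq (lim_to_shift hy)) => /=.
  apply: lim_toZr; apply: lim_toD; first exact: lim_to_cst.
  exact: (lim_toM n1 hy hy).
exists (1 - y); split.
- by rewrite starB star1 ys.
- by rewrite opprB addrC subrK; exact: lim_to_nrm_le hy n1.
- have : y + y = b + y * y.
    by rewrite {1 2}yE -scalerDr half2.
  rewrite mulrBr mulr1 mulrBl mul1r => e.
  have -> : 1 - y - (y - y * y) = 1 + y * y - (y + y).
    by rewrite opprB opprD addrACA.
  by rewrite e opprD addrACA subrr addr0.
- move=> x xb; apply: commrB; first exact: commr1.
  by apply: lim_to_comm hy => n; exact: sqrt_iter_comm.
Qed.

(** Squares of self-adjoint elements are within reach of the iterated square root, unlike the
    elements [star x * x]; that the two notions agree is the content of [pos_star_mul]. *)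
Definition pos h : Prop := exists2 k, star k = k & h = k * k.

Lemma pos_star h : pos h -> star h = h.
Proof. by move=> [k ks ->]; rewrite star_mul ks. Qed.

Lemma pos0 : pos 0.
Proof. by exists 0; rewrite ?star0 ?mulr0. Qed.

Lemma pos1 : pos 1.
Proof. by exists 1; rewrite ?star1 ?mulr1. Qed.

Lemma posZ t h : 0 <= t -> pos h -> pos (t%:C *: h).
Proof.
move=> t0 [k ks ->]; exists ((Num.sqrt t)%:C *: k); first by rewrite starZr ks.
have -> : t%:C = (Num.sqrt t)%:C * (Num.sqrt t)%:C.
  by rewrite -rmorphM /= -expr2 sqr_sqrtr.
by rewrite -scalerAl -scalerAr scalerA.
Qed.

(** [k + i m] is unitary, hence of norm 1, and [k] is its real part. *)
Lemma cosine_nrm k m : star k = k -> star m = m -> GRing.comm k m ->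
  k * k + m * m = 1 -> nrm k <= 1.
Proof.
move=> ks ms km e; pose u := k + 'i%C *: m.
have us : star u = k - 'i%C *: m.
  rewrite starD ks starZ ms -scaleNr; congr (_ + _ *: _).
  by apply/eqP; rewrite eq_complex /= oppr0 !eqxx.
have uu : star u * u = 1.
  rewrite us mulrBl !mulrDr -!scalerAl -!scalerAr scalerA.
  have -> : 'i%C * 'i%C = -1 :> R[i] by rewrite -expr2 sqr_i.
  by rewrite km scaleN1r opprD opprK addrA addrK.
have kE : k = 2^-1%:C *: (u + star u).
  by rewrite us addrACA subrr addr0 half2.
rewrite kE nrm_half; have := nrmD u (star u).
by rewrite nrm_star (nrm_unitary uu); lra.
Qed.

(** The root [m] of [1 - k * k] is a partner of [k] in [cosine_nrm], so it has norm at most 1, and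
    so has its square. *)
Lemma nrm_1sub_sq k : star k = k -> nrm k <= 1 -> nrm (1 - k * k) <= 1.
Proof.
move=> ks k1.
have [||m [ms _ mm mc]] := @sqrt_exists (k * k).
- by rewrite star_mul ks.
- by rewrite (nrm_sa ks) exprn_ile1.
have km : GRing.comm m k by apply/commr_sym/mc; apply: commrM.
have m1 : nrm m <= 1 by apply: (cosine_nrm ms ks km); rewrite mm subrK.
by rewrite -mm nrm_sa// expr_le1.
Qed.

Lemma pos_of_nrm1 h : star h = h -> nrm (1 - h) <= 1 -> pos h.
Proof.
move=> hs h1; have [|//|s [ss _ e _]] := @sqrt_exists (1 - h).
  by rewrite starB star1 hs.
by exists s => //; rewrite e opprB addrC subrK.
Qed.

Lemma scaleVr t x : 0 < t -> t%:C *: (t^-1%:C *: x) = x.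
Proof. by move=> t0; rewrite scalerA -rmorphM /= divff ?gt_eqF// scale1r. Qed.

(** With the converse [pos_nrm], positivity becomes a norm condition. The condition is additive in
    the pair [(t, h)], which is how sums of positive elements are handled in [posD]. *)
Lemma pos_of_nrm t h : 0 < t -> star h = h -> nrm (t%:C *: 1 - h) <= t -> pos h.
Proof.
move=> t0 hs h1; rewrite -(scaleVr h t0); apply: posZ; first exact: ltW.
apply: pos_of_nrm1; first by rewrite starZr hs.
rewrite -(ler_pM2l t0) mulr1 -{1}(gtr0_norm t0) -nrmZr scalerBr.
by rewrite scaleVr.
Qed.

Lemma pos_nrm t h : 0 < t -> nrm h <= t -> pos h -> nrm (t%:C *: 1 - h) <= t.
Proof.
move=> t0 ht hp.
have [k ks e] : pos (t^-1%:C *: h) by apply: posZ => //; rewrite invr_ge0 ltW.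
have k1 : nrm k <= 1.
  rewrite -(@expr_le1 _ 2)// -nrm_sa// -e nrmZr ger0_norm ?invr_ge0 ?(ltW t0)//.
  by rewrite mulrC ler_pdivrMr// mul1r.
have := nrm_1sub_sq ks k1; rewrite -e -(ler_pM2l t0) mulr1 -{1}(gtr0_norm t0) -nrmZr.
by rewrite scalerBr scaleVr.
Qed.

Lemma posD h k : pos h -> pos k -> pos (h + k).
Proof.
move=> hp kp.
have a0 : 0 < nrm h + 1 by rewrite ltr_wpDl.
have b0 : 0 < nrm k + 1 by rewrite ltr_wpDl.
apply: (@pos_of_nrm (nrm h + 1 + (nrm k + 1))).
- exact: addr_gt0.
- by rewrite starD !pos_star.
rewrite rmorphD /= scalerDl opprD addrACA; apply: le_trans (nrmD _ _) _.
by apply: lerD; apply: pos_nrm => //; rewrite lerDl.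
Qed.

Lemma pos_sum (I : Type) (r : seq I) (P : pred I) (F : I -> A) :
  (forall i, P i -> pos (F i)) -> pos (\sum_(i <- r | P i) F i).
Proof.
by move=> h; elim/big_rec: _ => [|i x Pi hx]; [exact: pos0|apply: posD => //; exact: h].
Qed.

(* Writing (t + y y^* )^N = t^N + y p y^* with p a polynomial in y^* y gives
   ||t + y y^*||^N <= t^N + N C t^(N-1) for N = 2^n, hence ||t + y y^*|| <= t. *)
Lemma neg_swap t y : 0 < t -> nrm (t%:C *: 1 + star y * y) <= t ->
  nrm (t%:C *: 1 + y * star y) <= t.
Proof.
move=> t0; set w := star y * y; set v := y * star y => hw.
have hvs : star (t%:C *: 1 + v) = t%:C *: 1 + v.
  by rewrite starD starZr star1 /v star_mul starK.
have key n : exists2 p, (t%:C *: 1 + v) ^+ n = (t ^+ n)%:C *: 1 + y * p * star y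
      & nrm p <= n%:R * t ^+ n.-1.
  have sw m : (t%:C *: 1 + v) ^+ m * y = y * (t%:C *: 1 + w) ^+ m.
    elim: m => [|m ih]; first by rewrite !expr0 mul1r mulr1.
    have e : (t%:C *: 1 + v) * y = y * (t%:C *: 1 + w).
      by rewrite mulrDr mulrDl -scalerAr -scalerAl mulr1 mul1r mulrA.
    by rewrite exprSr -mulrA e mulrA ih -mulrA -exprSr.
  have wn m : nrm ((t%:C *: 1 + w) ^+ m) <= t ^+ m.
    elim: m => [|m ih]; first by rewrite !expr0 nrm1.
    by rewrite !exprS; apply: le_trans (nrmM _ _) _; apply: ler_pM.
  elim: n => [|n [p e hp]].
    by exists 0; rewrite ?nrm0 ?mul0r// !expr0 mulr0 mul0r addr0 scale1r.
  exists (t%:C *: p + (t%:C *: 1 + w) ^+ n).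
    rewrite exprSr mulrDr {1}e -scalerAr mulr1 scalerDr scalerA -rmorphM /= -exprS.
    rewrite -addrA; congr (_ + _).
    rewrite {2}/v mulrA sw mulrDr mulrDl; congr (_ + _).
    by rewrite -!scalerAr -!scalerAl.
  apply: le_trans (nrmD _ _) _; rewrite nrmZr gtr0_norm//= -natr1 mulrDl mul1r.
  apply: lerD => //.
  case: n hp {e} => [|n] /= hp; first by rewrite !mul0r in hp *; nra.
  by rewrite exprS mulrCA; apply: ler_wpM2l => //; exact: ltW.
have pw n : nrm ((t%:C *: 1 + v) ^+ (2 ^ n)) = nrm (t%:C *: 1 + v) ^+ (2 ^ n).
  elim: n => [|n ih]; first by rewrite expn0 !expr1.
  rewrite expnSr !exprM -ih expr2 nrm_sa//.
  elim: (2 ^ n)%N => [|m im]; first by rewrite expr0 star1.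
  by rewrite exprS star_mul im hvs -exprSr -exprS.
rewrite leNgt; apply/negP => lt.
set a := nrm _ in lt pw.
pose C := nrm y ^+ 2.
have ub n : a ^+ (2 ^ n) <= t ^+ (2 ^ n) + C * (2 ^ n)%:R * t ^+ (2 ^ n).-1.
  have [p e hp] := key (2 ^ n)%N; rewrite -pw e.
  apply: le_trans (nrmD _ _) _; rewrite nrmZr nrm1 mulr1 ger0_norm ?exprn_ge0 ?(ltW t0)//.
  rewrite lerD2l; apply: le_trans (nrmM _ _) _; rewrite nrm_star.
  apply: le_trans (ler_wpM2r (nrm_ge0 y) (nrmM _ _)) _.
  by rewrite mulrAC -expr2 -/C -mulrA; apply: ler_wpM2l => //; rewrite exprn_ge0.
pose d := a / t - 1.
have d0 : 0 < d by rewrite subr_gt0 ltr_pdivlMr// mul1r.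
have ub2 n : (1 + d) ^+ (2 ^ n) <= 1 + C / t * (2 ^ n)%:R.
  have -> : 1 + d = a / t by rewrite /d addrC subrK.
  rewrite expr_div_n ler_pdivrMr ?exprn_gt0//; apply: le_trans (ub n) _.
  rewrite mulrDl mul1r lerD2l.
  have -> : t ^+ (2 ^ n) = t * t ^+ (2 ^ n).-1 by rewrite -exprS prednK// expn_gt0.
  by rewrite [leRHS]mulrA (mulrAC (C / t)) divfK ?gt_eqF.
have bern (m : nat) : 1 + m%:R * d <= (1 + d) ^+ m.
  elim: m => [|m ih]; first by rewrite mul0r addr0 expr0.
  rewrite exprS -natr1; apply: le_trans (ler_wpM2l _ ih); last by lra.
  have : 0 <= m%:R * d * d by rewrite !mulr_ge0 ?ler0n ?(ltW d0).
  lra.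
have C0 : 0 <= C / t by rewrite divr_ge0 ?exprn_ge0// ltW.
have D0 := ltW d0.
(* The bound [ub2] is linear in the exponent. Applied at [n.+1], with Bernoulli's inequality
   squared, it bounds a quadratic in [2 ^ n] by a linear expression, which fails for large [n]. *)
have sq n : (1 + (2 ^ n)%:R * d) ^+ 2 <= 1 + C / t * 2 * (2 ^ n)%:R.
  have := ub2 n.+1; rewrite expnSr exprM natrM (mulrC (2^n)%:R) mulrA; apply: le_trans.
  have p : 0 <= 1 + (2 ^ n)%:R * d by rewrite addr_ge0 ?mulr_ge0 ?ler0n.
  by rewrite lerXn2r ?nnegrE// (le_trans p (bern _)).
pose K := C / t * 2 / (d * d).
have [n hn] : exists n : nat, K < (2 ^ n)%:R.
  have K0 : 0 <= K by apply: divr_ge0; apply: mulr_ge0 => //; exact: ler0n.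
  exists (Num.bound K); apply: lt_le_trans (archi_boundP K0) _.
  by rewrite ler_nat ltnW// ltn_expl.
have := sq n; rewrite ltr_pdivrMr ?mulr_gt0// in hn.
have N0 : 0 < (2 ^ n)%:R :> R by rewrite ltr0n expn_gt0.
rewrite -(ltr_pM2r N0) in hn; have := mulr_gt0 N0 d0; lra.
Qed.

(** The root that [pos] provides may fail to commute with elements commuting with [h]; the root
    obtained by iteration from [h] itself commutes with them, as products of positive elements
    require. *)
Lemma pos_root h : pos h ->
  exists s, [/\ star s = s, s * s = h & forall x, GRing.comm x h -> GRing.comm x s].
Proof.
move=> hp; have t0 : 0 < nrm h + 1 by rewrite ltr_wpDl.
set t := nrm h + 1 in t0.
have h1 : nrm (1 - t^-1%:C *: h) <= 1.
  rewrite -(ler_pM2l t0) mulr1 -{1}(gtr0_norm t0) -nrmZr scalerBr scaleVr//.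
  by apply: pos_nrm => //; rewrite lerDl.
have [|//|s [ss _ e sc]] := @sqrt_exists (1 - t^-1%:C *: h).
  by rewrite starB star1 starZr pos_star.
exists ((Num.sqrt t)%:C *: s); split; first by rewrite starZr ss.
  rewrite -scalerAl -scalerAr scalerA e.
  have -> : (Num.sqrt t)%:C * (Num.sqrt t)%:C = t%:C.
    by rewrite -rmorphM /= -expr2 sqr_sqrtr// ltW.
  by rewrite opprB addrC subrK scaleVr.
move=> x xh; apply/commZ/sc/commrB; [exact: commr1|exact: commZ].
Qed.

Lemma pos_mul h k : pos h -> pos k -> GRing.comm h k -> pos (h * k).
Proof.
move=> /pos_root[s [ss <- sc]] /pos_root[u [us <- uc]] hk.
have su : GRing.comm s u.
  by apply: uc; apply: commr_sym; apply: sc; apply: commr_sym.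
exists (s * u); first by rewrite star_mul ss us su.
by rewrite -!mulrA; congr (_ * _); rewrite !mulrA; congr (_ * _).
Qed.

(** [1 - b * b] is the product of the commuting positive elements [1 + b] and [1 - b]; its root is
    the partner of [b] in [cosine_nrm]. *)
Lemma order_nrm1 b : pos (1 + b) -> pos (1 - b) -> nrm b <= 1.
Proof.
move=> h1 h2.
have bs : star b = b by have /pos_star := h1; rewrite starD star1 => /addrI.
have : pos (1 - b * b).
  have -> : 1 - b * b = (1 + b) * (1 - b).
    by rewrite mulrBr mulr1 mulrDl mul1r opprD addrA addrK.
  apply: pos_mul => //; apply/commrB; first exact: commr1.
  apply: commr_sym; apply: commrD; [exact: commr1|by []].
move=> /pos_root[s [ss e sc]]; apply: (cosine_nrm bs ss); last by rewrite e addrC subrK.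
by apply: sc; apply: commrB; [exact: commr1|exact: commrM].
Qed.

Lemma order_nrm t b : 0 < t -> pos (t%:C *: 1 + b) -> pos (t%:C *: 1 - b) -> nrm b <= t.
Proof.
move=> t0 h1 h2.
have i0 : 0 <= t^-1 by rewrite invr_ge0 ltW.
have e x : t^-1%:C *: (t%:C *: 1 + x) = 1 + t^-1%:C *: x.
  by rewrite scalerDr scalerA -rmorphM /= mulVf ?gt_eqF// scale1r.
have := @order_nrm1 (t^-1%:C *: b); rewrite nrmZr ger0_norm// mulrC ler_pdivrMr// mul1r.
apply; first by rewrite -e; exact: posZ.
by rewrite -scalerN -e; exact: posZ.
Qed.

Lemma pos_antisym h : pos h -> pos (- h) -> h = 0.
Proof.
move=> h1 h2; apply/nrm_eq0/eqP; rewrite eq_le nrm_ge0 andbT leNgt; apply/negP => n0.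
have n2 : 0 < nrm h / 2 by lra.
have /posZ/(_ pos1) p : 0 <= nrm h / 2 by lra.
by have := order_nrm n2 (posD p h1) (posD p h2); lra.
Qed.

(** [a] is the real part of [y] and [b] is minus its imaginary part. The identity lets positivity
    pass from [- (y * star y)] to [star y * y]. *)
Lemma sum_of_squares y : exists a b,
  [/\ star a = a, star b = b & star y * y + y * star y = 2%:C *: (a * a + b * b)].
Proof.
have two : 2%:C = 2 :> R[i] by rewrite rmorph_nat.
have half : 2^-1%:C = 2^-1 :> R[i] by rewrite -two; exact: (fmorphV (real_complex R)).
exists (2^-1%:C *: (y + star y)), (('i%C / 2) *: (y - star y)); split.
- by rewrite starZr starD starK addrC.
- rewrite starZ starB starK -opprB scalerN -scaleNr; congr (_ *: _).
  rewrite rmorphM fmorphV /= rmorph_nat -mulNr; congr (_ / _).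
  by apply/eqP; rewrite eq_complex /= !oppr0 opprK !eqxx.
- rewrite -!scalerAl -!scalerAr !scalerA.
  have -> : 'i%C / 2 * ('i%C / 2) = - (2^-1%:C * 2^-1%:C) :> R[i].
    by rewrite mulrACA -expr2 sqr_i mulN1r half.
  have -> : (y + star y) * (y + star y) = (y * y + star y * star y) + (star y * y + y * star y).
    by rewrite mulrDl !mulrDr [LHS](AC (2*2) ((1*4)*(3*2))).
  have -> : (y - star y) * (y - star y) = (y * y + star y * star y) - (star y * y + y * star y).
    by rewrite mulrBl !mulrBr !opprB opprD [LHS](AC (2*2) ((1*3)*(4*2))).
  rewrite scaleNr -scalerBr scalerA mulrA -rmorphM /= divff ?pnatr_eq0// mul1r.
  set p := y * y + _; set q := star y * y + _.
  by rewrite opprB [X in _ *: X]addrC addrA subrK half2.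
Qed.

(** By [neg_swap] the element [- (y * star y)] is positive as well. Then [star y * y], a sum of
    squares plus this element, is both positive and negative, hence zero. *)
Lemma neg_star_mul y : pos (- (star y * y)) -> y = 0.
Proof.
move=> hp.
have t0 : 0 < nrm (star y * y) + 1 by rewrite ltr_wpDl.
have h1 : nrm ((nrm (star y * y) + 1)%:C *: 1 + star y * y) <= nrm (star y * y) + 1.
  by have := pos_nrm t0 _ hp; rewrite opprK; apply; rewrite nrmN lerDl.
have q : pos (- (y * star y)).
  apply: (pos_of_nrm t0); first by rewrite starN star_mul starK.
  by rewrite opprK; exact: neg_swap.
have [a [b [as_ bs e]]] := sum_of_squares y.
have yy : pos (star y * y).
  have -> : star y * y = 2%:C *: (a * a + b * b) + - (y * star y) by rewrite -e addrK.
  by apply: posD => //; apply: posZ => //; apply: posD; [exists a|exists b].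
by apply/nrm_eq0/eqP; rewrite -sqrf_eq0 -nrm_cstar (pos_antisym yy hp) nrm0.
Qed.

Lemma posZK t h : 0 < t -> pos (t%:C *: h) -> pos h.
Proof.
move=> t0 hp; have : pos (t^-1%:C *: (t%:C *: h)) by apply: posZ => //; rewrite invr_ge0 ltW.
by rewrite scalerA -rmorphM /= mulVf ?gt_eqF// scale1r.
Qed.

(* With p = (|h| - h)/2 one gets (x p)^* (x p) = - p |h| p for h = x^* x, so x p = 0
   and then p^3 = 0. *)
Lemma pos_star_mul x : pos (star x * x).
Proof.
wlog x1 : x / nrm x <= 1.
  move=> H; have n0 : 0 < nrm x + 1 by rewrite ltr_wpDl.
  have i0 : 0 <= (nrm x + 1)^-1 by rewrite invr_ge0 ltW.
  have := H ((nrm x + 1)^-1%:C *: x).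
  rewrite nrmZr ger0_norm// mulrC ler_pdivrMr// mul1r lerDl ler01 => /(_ isT).
  rewrite starZr -scalerAl -scalerAr scalerA -rmorphM /=; apply: posZK.
  by rewrite mulr_gt0 ?invr_gt0.
set h := star x * x.
have hs : star h = h by rewrite /h star_mul starK.
have h1 : nrm h <= 1 by rewrite nrm_cstar expr_le1.
(* [a] is the absolute value of [h], the root of [h * h = 1 - (1 - h * h)]; thus [p = a - h] below
   is twice the negative part of [h]. *)
have [||a [as_ a1 aa ac]] := @sqrt_exists (1 - h * h).
- by rewrite starB star1 star_mul hs.
- exact: nrm_1sub_sq.
rewrite opprB addrC subrK in aa.
have ah : a * h = h * a.
  by apply/commr_sym/ac/commrB; [exact: commr1|exact: commrM].
pose p := a - h.
have ps : star p = p by rewrite starB as_ hs.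
have ap : a * p = p * a by rewrite mulrBr mulrBl ah.
have hp : h * p = - (a * p) by rewrite !mulrBr aa ah opprB.
have apos : pos a by exact: pos_of_nrm1.
have [k [ks kk kc]] := pos_root apos.
have kp : p * k = k * p by apply: kc.
have y0 : x * p = 0.
  apply: neg_star_mul; exists (k * p); first by rewrite star_mul ks ps.
  rewrite star_mul ps -mulrA (mulrA (star x)) -/h hp mulrN opprK.
  have -> : k * p * (k * p) = p * (k * (k * p)) by rewrite [RHS]mulrA kp.
  by rewrite -kk -mulrA.
have hp0 : h * p = 0 by rewrite /h -mulrA y0 mulr0.
have p0 : p * p = 0.
  have ap0 : a * p = 0 by apply/eqP; rewrite -oppr_eq0 -hp hp0.
  by rewrite {1}/p mulrBl hp0 ap0 subrr.
have : p = 0.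
  by apply/nrm_eq0/eqP; rewrite -sqrf_eq0 -(nrm_sa ps) p0 nrm0.
by move/eqP; rewrite subr_eq0 => /eqP <-.
Qed.

End CStarOrder.

(** * Hilbert modules and matrices over a C*-algebra *)

Section Order.
Variables (R : realType) (A : cstarType R).
Implicit Types (x y h : A) (t : R).

Lemma pos_conj h x : pos h -> pos (star x * h * x).
Proof.
move=> [k ks ->].
have -> : star x * (k * k) * x = star (k * x) * (k * x).
  by rewrite star_mul ks !mulrA.
exact: pos_star_mul.
Qed.

Lemma pos_nrm_sub t h : star h = h -> nrm h <= t -> pos (t%:C *: 1 - h).
Proof.
move=> hs ht; have t0 : 0 <= t by exact: le_trans ht.
have [t1|t1] : 0 < t \/ t = 0 by case: ltgtP t0 => //; [left|right].
  apply: (pos_of_nrm t1); first by rewrite starB starZr star1 hs.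
  by rewrite opprB addrC subrK.
have /nrm_eq0 -> : nrm h = 0 by apply/eqP; rewrite eq_le -{1}t1 ht nrm_ge0.
by rewrite t1 scale0r subr0; exact: pos0.
Qed.

Lemma pos_le_trans x y z : pos (y - x) -> pos (z - y) -> pos (z - x).
Proof. by move=> h1 h2; have := posD h2 h1; rewrite addrA subrK. Qed.

Lemma pos_le_nrm x y : pos x -> pos (y - x) -> nrm x <= nrm y.
Proof.
move=> x0 yx.
have ys : star y = y.
  have := pos_star (posD yx x0); by rewrite subrK.
apply/ler_addgt0Pr => e e0.
have p : 0 < nrm y + e by rewrite ltr_wpDl.
apply: (order_nrm p); first by apply: posD => //; apply: posZ (ltW p) (pos1 _).
apply: (pos_le_trans yx); apply: pos_nrm_sub => //.
by rewrite lerDl ltW.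
Qed.

(** On self-adjoint elements the order bounds by multiples of 1 are preserved, so the norm does not
    grow. Splitting into real and imaginary parts costs the factor 2, harmless in the later
    estimates. *)
Lemma positive_unital_nrm (B : cstarType R) (f : A -> B) :
  (forall x y, f (x + y) = f x + f y) ->
  (forall (c : R[i]) x, f (c *: x) = c *: f x) ->
  f 1 = 1 -> (forall x, pos (f (star x * x))) ->
  forall x, nrm (f x) <= 2 * nrm x.
Proof.
move=> fD fZ f1 fp.
have fpos h : pos h -> pos (f h) by move=> [k ks ->]; rewrite -{1}ks.
have fsa h : star h = h -> nrm (f h) <= nrm h.
  move=> hs; apply/ler_addgt0Pr => e e0.
  have p : 0 < nrm h + e by rewrite ltr_wpDl.
  have l : nrm h <= nrm h + e by rewrite lerDl ltW.
  apply: (order_nrm p); rewrite -f1 -fZ.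
    rewrite -fD; apply: fpos; rewrite -[h in _ + h]opprK; apply: pos_nrm_sub.
      by rewrite starN hs.
    by rewrite nrmN.
  have -> : - f h = f (- h) by rewrite -scaleN1r -fZ scaleN1r.
  by rewrite -fD; apply: fpos; exact: pos_nrm_sub.
move=> x.
pose a := 2^-1%:C *: (x + star x); pose b := 2^-1%:C *: (('i%C) *: (star x - x)).
have as_ : star a = a by rewrite starZr starD starK addrC.
have bs : star b = b.
  rewrite starZr starZ starB starK -opprB scalerN -scaleNr; congr (_ *: (_ *: _)).
  by apply/eqP; rewrite eq_complex /= !oppr0 opprK !eqxx.
have an : nrm a <= nrm x.
  by rewrite nrm_half; have := nrmD x (star x); rewrite nrm_star; lra.
have bn : nrm b <= nrm x.
  rewrite nrm_half nrmZ normc_def /= expr0n add0r expr1n sqrtr1 mul1r.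
  by have := nrmB (star x) x; rewrite nrm_star; lra.
have xE : x = a + 'i%C *: b.
  rewrite /a /b (scalerA 'i%C) (mulrC 'i%C) -scalerA -scalerDr scalerA.
  have -> : 'i%C * 'i%C = -1 :> R[i] by rewrite -expr2 sqr_i.
  by rewrite scaleN1r opprB addrACA subrr addr0 half2.
rewrite [in leLHS]xE fD (fZ 'i%C); apply: le_trans (nrmD _ _) _.
have -> : nrm ('i%C *: f b) = nrm (f b).
  by rewrite nrmZ normc_def /= expr0n add0r expr1n sqrtr1 mul1r.
have := fsa _ as_; have := fsa _ bs; lra.
Qed.

End Order.

Section HilbertModule.
Variables (R : realType) (A : cstarType R) (n : nat).
Implicit Types (v w x y : 'I_n -> A) (X Y : 'M[A]_n) (t : R).

(** The [A]-valued inner product of the Hilbert module of [n]-tuples. Matrices act on it, and their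
    operator norm gives a C*-norm without representing [A] on a Hilbert space. *)
Definition ip v w : A := \sum_i star (v i) * w i.
Definition mxv X v : 'I_n -> A := fun i => \sum_j X i j * v j.
Definition mxstar X : 'M[A]_n := (map_mx star X)^T.

Lemma star_ip v w : star (ip v w) = ip w v.
Proof. by rewrite /ip star_sum; apply: eq_bigr => i _; rewrite star_mul starK. Qed.

Lemma ip_pos v : pos (ip v v).
Proof. by apply: pos_sum => i _; exact: pos_star_mul. Qed.

Lemma nrm_coord v i : nrm (v i) ^+ 2 <= nrm (ip v v).
Proof.
rewrite -nrm_cstar; apply: pos_le_nrm; first exact: pos_star_mul.
rewrite /ip (bigD1 i)//= addrAC subrr add0r; apply: pos_sum => j _; exact: pos_star_mul.
Qed.

(** Two positive elements are added: the inner square of the residual [y - x c], where [c = ip x y],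
    and [star c * (1 - ip x x) * c]. The element [ip x x] never has to be inverted. *)
Lemma ip_bessel x y : nrm (ip x x) <= 1 -> pos (ip y y - star (ip x y) * ip x y).
Proof.
move=> x1; set c := ip x y.
have h1 := ip_pos (fun i => y i - x i * c).
have e : ip (fun i => y i - x i * c) (fun i => y i - x i * c) =
   ip y y - star c * c - star c * c + star c * ip x x * c.
  transitivity (\sum_i (star (y i) * y i - star c * (star (x i) * y i)
      - (star (y i) * x i) * c + star c * (star (x i) * x i) * c)).
    apply: eq_bigr => i _; rewrite starB star_mul mulrBr !mulrBl !mulrA opprB addrA.
    by rewrite [LHS]addrAC -[LHS]addrA [LHS]addrC [LHS]addrC addrA.
  have e1 : star c * c = \sum_i star c * (star (x i) * y i) by rewrite -mulr_sumr.
  have e2 : star c * c = \sum_i star (y i) * x i * c by rewrite -mulr_suml star_ip.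
  have e3 : star c * ip x x * c = \sum_i star c * (star (x i) * x i) * c.
    by rewrite -mulr_suml -mulr_sumr.
  by rewrite [in X in _ - X + _]e2 e1 e3 -!sumrB -big_split.
rewrite e in h1.
have h2 : pos (star c * c - star c * ip x x * c).
  have -> : star c * c - star c * ip x x * c = star c * (1%:C *: 1 - ip x x) * c.
    by rewrite scale1r mulrBr mulrBl mulr1.
  apply: pos_conj; apply: pos_nrm_sub => //; exact: star_ip.
have := posD h1 h2; set D := star c * c; set E := star c * ip x x * c.
by rewrite -(addrA _ E) (addrCA E) subrr addr0 subrK.
Qed.

Lemma ip_cauchy_schwarz x y : nrm (ip x x) <= 1 -> nrm (ip x y) ^+ 2 <= nrm (ip y y).
Proof.
move=> x1; rewrite -nrm_cstar; apply: pos_le_nrm; first exact: pos_star_mul.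
exact: ip_bessel.
Qed.

Definition vscale t v : 'I_n -> A := fun i => t%:C *: v i.

Lemma ip_scalel t v w : ip (vscale t v) w = t%:C *: ip v w.
Proof.
by rewrite /ip scaler_sumr; apply: eq_bigr => i _; rewrite starZr scalerAl.
Qed.

Lemma ip_scaler t v w : ip v (vscale t w) = t%:C *: ip v w.
Proof. by rewrite /ip scaler_sumr; apply: eq_bigr => i _; rewrite scalerAr. Qed.

Lemma mxv_scale X t v : mxv X (vscale t v) = vscale t (mxv X v).
Proof.
apply/funext => i; rewrite /mxv /vscale scaler_sumr.
by apply: eq_bigr => j _; rewrite scalerAr.
Qed.

Definition vnrm v : R := Num.sqrt (nrm (ip v v)).

Lemma vnrm_ge0 v : 0 <= vnrm v. Proof. exact: sqrtr_ge0. Qed.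

Lemma vnrm_sqr v : vnrm v ^+ 2 = nrm (ip v v).
Proof. by rewrite sqr_sqrtr. Qed.

Lemma vnrm_le1 v : (nrm (ip v v) <= 1) = (vnrm v <= 1).
Proof. by rewrite -vnrm_sqr expr_le1 ?vnrm_ge0. Qed.

Lemma vnrm_scale t v : vnrm (vscale t v) = `|t| * vnrm v.
Proof.
rewrite /vnrm ip_scalel ip_scaler !nrmZr mulrA -expr2.
by rewrite sqrtrM ?sqrtr_sqr ?normr_id ?sqr_ge0.
Qed.

Lemma vnrm0_eq v : vnrm v = 0 -> v = fun=> 0.
Proof.
move=> h; apply/funext => i; apply/nrm_eq0/eqP; rewrite -sqrf_eq0 eq_le sqr_ge0 andbT.
by rewrite (le_trans (nrm_coord _ _))// -vnrm_sqr h expr0n.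
Qed.

(** Testing against a second vector [w] makes the norm visibly invariant under the adjoint; the
    usual bound on [mxv X v] is recovered in [vnrm_mxv]. *)
Definition opn_set X : set R :=
  [set e | exists w v, [/\ vnrm w <= 1, vnrm v <= 1 & e = nrm (ip w (mxv X v))]].

Definition opn X : R := sup (opn_set X).

Lemma vnrm_zero : vnrm (fun=> 0) = 0.
Proof.
rewrite /vnrm /ip big1 ?nrm0 ?sqrtr0// => i _; exact: mulr0.
Qed.

Lemma opn_has_sup X : has_sup (opn_set X).
Proof.
split.
  by exists (nrm (ip (fun=> 0) (mxv X (fun=> 0)))), (fun=> 0), (fun=> 0);
     rewrite vnrm_zero.
exists (\sum_i \sum_j nrm (X i j)) => _ [w [v [w1 v1 ->]]].
have c1 u i : vnrm u <= 1 -> nrm (u i) <= 1.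
  rewrite -vnrm_le1 => h; rewrite -(@expr_le1 _ 2)//.
  exact: le_trans (nrm_coord _ _) h.
apply: le_trans (nrm_sum _ _ _) _; apply: ler_sum => i _.
apply: le_trans (nrmM _ _) _; rewrite nrm_star -[leRHS]mul1r.
apply: ler_pM => //; first exact: c1.
apply: le_trans (nrm_sum _ _ _) _; apply: ler_sum => j _.
apply: le_trans (nrmM _ _) _; rewrite -[leRHS]mulr1.
by apply: ler_pM => //; exact: c1.
Qed.

Lemma opn_ge X w v : vnrm w <= 1 -> vnrm v <= 1 -> nrm (ip w (mxv X v)) <= opn X.
Proof.
move=> w1 v1; apply: sup_upper_bound; first exact: opn_has_sup.
by exists w, v.
Qed.

Lemma opn_le X t : (forall w v, vnrm w <= 1 -> vnrm v <= 1 -> nrm (ip w (mxv X v)) <= t) ->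
  opn X <= t.
Proof.
move=> h; apply: ge_sup; first by have [] := opn_has_sup X.
by move=> _ [w [v [w1 v1 ->]]]; exact: h.
Qed.

Lemma opn_ge0 X : 0 <= opn X.
Proof.
apply: le_trans (opn_ge X (w := fun=> 0) (v := fun=> 0) _ _) => //.
all: by rewrite vnrm_zero.
Qed.

Lemma vnormalize v : exists2 u, vnrm u <= 1 & v = vscale (vnrm v) u.
Proof.
have [v0|v0] := eqVneq (vnrm v) 0.
  exists (fun=> 0); first by rewrite vnrm_zero.
  by rewrite (vnrm0_eq v0); apply/funext => i; rewrite /vscale scaler0.
have vp : 0 < vnrm v by rewrite lt_neqAle eq_sym v0 vnrm_ge0.
exists (vscale (vnrm v)^-1 v).
  by rewrite vnrm_scale ger0_norm ?invr_ge0 ?vnrm_ge0// mulVf.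
by apply/funext => i; rewrite /vscale scaleVr.
Qed.

Lemma opn_ip X w v : nrm (ip w (mxv X v)) <= opn X * (vnrm w * vnrm v).
Proof.
have [w' w1 wE] := vnormalize w; have [v' v1 vE] := vnormalize v.
rewrite wE vE mxv_scale ip_scalel ip_scaler -wE -vE !nrmZr !ger0_norm ?vnrm_ge0//.
rewrite mulrA mulrC; apply: ler_wpM2r; first by rewrite mulr_ge0 ?vnrm_ge0.
exact: opn_ge.
Qed.

Lemma vnrm_mxv X v : vnrm (mxv X v) <= opn X * vnrm v.
Proof.
have [v0|v0] := eqVneq (vnrm (mxv X v)) 0.
  by rewrite v0 mulr_ge0 ?opn_ge0 ?vnrm_ge0.
have vp : 0 < vnrm (mxv X v) by rewrite lt_neqAle eq_sym v0 vnrm_ge0.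
rewrite -(ler_pM2l vp) -expr2 vnrm_sqr; apply: le_trans (opn_ip _ _ _) _.
by rewrite mulrCA.
Qed.

Lemma mxvD X Y v i : mxv (X + Y) v i = mxv X v i + mxv Y v i.
Proof. by rewrite /mxv -big_split; apply: eq_bigr => j _; rewrite mxE mulrDl. Qed.

Lemma ipDr w v v' : ip w (fun i => v i + v' i) = ip w v + ip w v'.
Proof. by rewrite /ip -big_split; apply: eq_bigr => j _; rewrite mulrDr. Qed.

Lemma opnD X Y : opn (X + Y) <= opn X + opn Y.
Proof.
apply: opn_le => w v w1 v1.
have -> : mxv (X + Y) v = fun i => mxv X v i + mxv Y v i.
  by apply/funext => i; exact: mxvD.
rewrite ipDr; apply: le_trans (nrmD _ _) _.
by apply: lerD; exact: opn_ge.
Qed.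

Lemma mxvM X Y v : mxv (X *m Y) v = mxv X (mxv Y v).
Proof.
apply/funext => i; rewrite /mxv.
under eq_bigr do rewrite mxE mulr_suml.
rewrite exchange_big; apply: eq_bigr => k _; rewrite mulr_sumr.
by apply: eq_bigr => j _; rewrite mulrA.
Qed.

Lemma opnM X Y : opn (X *m Y) <= opn X * opn Y.
Proof.
apply: opn_le => w v w1 v1; rewrite mxvM; apply: le_trans (opn_ip _ _ _) _.
apply: ler_wpM2l; first exact: opn_ge0.
rewrite -[leRHS]mul1r; apply: ler_pM => //; try exact: vnrm_ge0.
apply: le_trans (vnrm_mxv _ _) _; rewrite -[leRHS]mulr1.
by apply: ler_wpM2l => //; exact: opn_ge0.
Qed.

Lemma mxstarK : involutive mxstar.
Proof. by move=> X; apply/matrixP => i j; rewrite !mxE starK. Qed.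

Lemma ip_mxstar X w v : ip w (mxv X v) = ip (mxv (mxstar X) w) v.
Proof.
rewrite /ip /mxv.
under eq_bigr do rewrite mulr_sumr.
rewrite exchange_big; apply: eq_bigr => j _; rewrite star_sum mulr_suml.
by apply: eq_bigr => i _; rewrite !mxE star_mul starK mulrA.
Qed.

Lemma opn_star X : opn (mxstar X) = opn X.
Proof.
have le Y : opn (mxstar Y) <= opn Y.
  apply: opn_le => w v w1 v1; rewrite ip_mxstar mxstarK -nrm_star star_ip.
  exact: opn_ge.
by apply/eqP; rewrite eq_le le -{1}(mxstarK X) le.
Qed.

(** For the lower bound, Cauchy-Schwarz bounds the square of [ip w (X v)] by [ip (X v) (X v)], which
    is [ip v (X^* X v)]. *)
Lemma opn_cstar X : opn (mxstar X *m X) = opn X ^+ 2.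
Proof.
apply/eqP; rewrite eq_le; apply/andP; split.
  by apply: le_trans (opnM _ _) _; rewrite opn_star expr2.
have h w v : vnrm w <= 1 -> vnrm v <= 1 ->
    nrm (ip w (mxv X v)) <= Num.sqrt (opn (mxstar X *m X)).
  move=> w1 v1; rewrite -(@ler_pXn2r _ 2) ?nnegrE ?sqrtr_ge0//.
  rewrite sqr_sqrtr ?opn_ge0//.
  apply: le_trans (ip_cauchy_schwarz _ _) _; first by rewrite vnrm_le1.
  by rewrite -{1}(mxstarK X) -ip_mxstar -mxvM; exact: opn_ge.
rewrite -[leRHS]sqr_sqrtr ?opn_ge0// ler_pXn2r ?nnegrE ?sqrtr_ge0 ?opn_ge0//.
exact: opn_le.
Qed.

Definition vdelta i : 'I_n -> A := fun j => if j == i then 1 else 0.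

Lemma ip_delta i v : ip (vdelta i) v = v i.
Proof.
rewrite /ip (bigD1 i)//= big1 ?addr0 => [|j ji].
  by rewrite /vdelta eqxx star1 mul1r.
by rewrite /vdelta (negbTE ji) star0 mul0r.
Qed.

Lemma mxv_delta X i j : mxv X (vdelta j) i = X i j.
Proof.
rewrite /mxv (bigD1 j)//= big1 ?addr0 => [|k kj].
  by rewrite /vdelta eqxx mulr1.
by rewrite /vdelta (negbTE kj) mulr0.
Qed.

Lemma vnrm_delta i : vnrm (vdelta i) = 1.
Proof. by rewrite /vnrm ip_delta /vdelta eqxx nrm1 sqrtr1. Qed.

Lemma nrm_entry X i j : nrm (X i j) <= opn X.
Proof.
have := opn_ge X (w := vdelta i) (v := vdelta j).
by rewrite ip_delta mxv_delta !vnrm_delta lexx; apply.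
Qed.

Lemma opn_entries X : opn X <= \sum_i \sum_j nrm (X i j).
Proof.
apply: opn_le => w v w1 v1.
have c1 u i : vnrm u <= 1 -> nrm (u i) <= 1.
  rewrite -vnrm_le1 => h; rewrite -(@expr_le1 _ 2)//.
  exact: le_trans (nrm_coord _ _) h.
apply: le_trans (nrm_sum _ _ _) _; apply: ler_sum => i _.
apply: le_trans (nrmM _ _) _; rewrite nrm_star -[leRHS]mul1r.
apply: ler_pM => //; first exact: c1.
apply: le_trans (nrm_sum _ _ _) _; apply: ler_sum => j _.
apply: le_trans (nrmM _ _) _; rewrite -[leRHS]mulr1.
by apply: ler_pM => //; exact: c1.
Qed.

Lemma opn_eq0 X : opn X = 0 -> X = 0.
Proof.
move=> h; apply/matrixP => i j; rewrite mxE; apply/nrm_eq0/eqP.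
by rewrite eq_le nrm_ge0 andbT -h nrm_entry.
Qed.

Lemma opnZ (c : R[i]) X :
  opn (map_mx (fun x : A => c *: x) X) = complex.Re `|c| * opn X.
Proof.
have c0 : 0 <= complex.Re `|c| by rewrite normc_def /= sqrtr_ge0.
have e (d : R[i]) Y w v : ip w (mxv (map_mx (fun x : A => d *: x) Y) v) = d *: ip w (mxv Y v).
  rewrite /ip scaler_sumr; apply: eq_bigr => i _; rewrite scalerAr; congr (_ * _).
  by rewrite /mxv scaler_sumr; apply: eq_bigr => j _; rewrite mxE scalerAl.
have le (d : R[i]) Y : opn (map_mx (fun x : A => d *: x) Y) <= complex.Re `|d| * opn Y.
  apply: opn_le => w v w1 v1; rewrite e nrmZ; apply: ler_wpM2l; last exact: opn_ge.
  by rewrite normc_def /= sqrtr_ge0.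
apply/eqP; rewrite eq_le le andTb.
have [->|cn0] := eqVneq c 0; first by rewrite normr0 mul0r opn_ge0.
have nE (d : R[i]) : `|d| = (complex.Re `|d|)%:C by rewrite RRe_real// normr_real.
have cp : 0 < complex.Re `|c|.
  by rewrite -ltcR -nE normr_gt0.
rewrite -ler_pdivlMl//; have := le c^-1 (map_mx (fun x : A => c *: x) X).
have -> : map_mx (fun x : A => c^-1 *: x) (map_mx (fun x : A => c *: x) X) = X.
  by apply/matrixP => i j; rewrite !mxE scalerA mulVf// scale1r.
suff -> : complex.Re `|c^-1| = (complex.Re `|c|)^-1 by [].
have : (complex.Re `|c^-1|)%:C = ((complex.Re `|c|)^-1)%:C.
  by rewrite -nE normfV {1}nE; rewrite (fmorphV (real_complex R)).
by case.
Qed.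

End HilbertModule.

(** The size is [n.+1] because matrices of size 0 form the zero algebra, which is excluded. The
    alias keeps the operator norm apart from the structures that matrices carry already. *)
Definition cmx (R : realType) (A : cstarType R) (n : nat) : Type := 'M[A]_n.+1.

Lemma sum_div_lt (K : numFieldType) (e : K) (n : nat) : 0 < e ->
  \sum_(i < n) \sum_(j < n) (e / (n * n).+1%:R) < e.
Proof.
move=> e0; rewrite !sumr_const !card_ord -mulrnA -[X in X < _]mulr_natr -mulrA.
by rewrite gtr_pMr// mulrC ltr_pdivrMr ?ltr0n// mul1r ltr_nat.
Qed.

Section MatrixCStar.
Variables (R : realType) (A : cstarType R) (n : nat).

HB.instance Definition _ := GRing.Zmodule.copy (cmx A n) 'M[A]_n.+1.

Definition cmx_scale (c : R[i]) (X : cmx A n) : cmx A n :=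
  map_mx (fun x : A => c *: x) (X : 'M[A]_n.+1).

Fact cmx_scaleA c d X : cmx_scale c (cmx_scale d X) = cmx_scale (c * d) X.
Proof. by apply/matrixP => i j; rewrite !mxE scalerA. Qed.
Fact cmx_scale1 : left_id 1 cmx_scale.
Proof. by move=> X; apply/matrixP => i j; rewrite !mxE scale1r. Qed.
Fact cmx_scaleDr : right_distributive cmx_scale +%R.
Proof. by move=> c X Y; apply/matrixP => i j; rewrite !mxE scalerDr. Qed.
Fact cmx_scaleDl X : {morph cmx_scale^~ X : c d / c + d}.
Proof. by move=> c d; apply/matrixP => i j; rewrite !mxE scalerDl. Qed.

HB.instance Definition _ := GRing.Zmodule_isLmodule.Build R[i] (cmx A n)
  cmx_scaleA cmx_scale1 cmx_scaleDr cmx_scaleDl.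

Definition cmx_norm (X : cmx A n) : R[i] := (opn (X : 'M[A]_n.+1))%:C.

Fact cmx_normD X Y : cmx_norm (X + Y) <= cmx_norm X + cmx_norm Y.
Proof. by rewrite /cmx_norm -rmorphD lecR; exact: opnD. Qed.
Fact cmx_normZ (c : R[i]) X : cmx_norm (c *: X) = `|c| * cmx_norm X.
Proof.
by rewrite /cmx_norm (opnZ c) rmorphM; congr (_ * _); exact: (RRe_real (normr_real c)).
Qed.
Fact cmx_norm_eq0 X : cmx_norm X = 0 -> X = 0.
Proof. by case=> /opn_eq0. Qed.

HB.instance Definition _ := Lmodule_isNormed.Build R[i] (cmx A n)
  cmx_normD cmx_normZ cmx_norm_eq0.

Fact cmx_complete (F : set_system (cmx A n)) :
  ProperFilter F -> cauchy F -> cvg F.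
Proof.
move=> FF Fc.
pose ent i j (X : cmx A n) : A := (X : 'M[A]_n.+1) i j.
have le i j X Y : `|ent i j X - ent i j Y| <= `|X - Y|.
  have -> : ent i j X - ent i j Y = ent i j (X - Y).
    by rewrite /ent !mxE.
  by rewrite nrmE lecR; exact: nrm_entry.
have hc i j : cvg (ent i j @ F).
  apply: cauchy_cvg; apply/cauchy_ballP => e e0.
  have /cauchy_ballP/(_ e e0) := Fc.
  rewrite !near_simpl /=; move=> [[P Q] /= [FP FQ] PQ].
  exists (ent i j @` P, ent i j @` Q) => /=.
    split; [apply: filterS FP|apply: filterS FQ] => X PX /=; by exists X.
  move=> [_ _] /= [[X PX <-] [Y QY <-]].
  have := PQ (X, Y) (conj PX QY); rewrite -!ball_normE /ball_/=.
  exact: le_lt_trans.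
pose L : cmx A n := (\matrix_(i, j) lim (ent i j @ F)) : 'M[A]_n.+1.
apply/cvg_ex; exists L; apply/cvgrPdist_lt => e e0.
have e1 : 0 < e / (n.+1 * n.+1).+1%:R by rewrite divr_gt0// ltr0n.
have h i j : \forall X \near F, `|ent i j L - ent i j X| < e / (n.+1 * n.+1).+1%:R.
  have /cvgrPdist_lt/(_ _ e1) := hc i j.
  by apply: filterS => X; rewrite /ent mxE.
have h2 : \forall X \near F, forall ij : 'I_n.+1 * 'I_n.+1,
   `|ent ij.1 ij.2 L - ent ij.1 ij.2 X| < e / (n.+1 * n.+1).+1%:R.
  by apply: filter_forall => ij; exact: h.
apply: filterS h2 => X hX.
apply: (@le_lt_trans _ _ (\sum_(i < n.+1) \sum_(j < n.+1) (e / (n.+1 * n.+1).+1%:R))).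
  apply: (@le_trans _ _ (\sum_(i < n.+1) \sum_(j < n.+1) nrm (ent i j (L - X)))%:C).
    by rewrite lecR; exact: opn_entries.
  rewrite rmorph_sum; apply: ler_sum => i _; rewrite rmorph_sum; apply: ler_sum => j _.
  have := ltW (hX (i, j)); rewrite -[ent _ _ L - _]/(ent _ _ L + - ent _ _ X) nrmE.
  by congr (_ <= _); congr ((nrm _)%:C); rewrite /ent !mxE.
exact: sum_div_lt.
Qed.

HB.instance Definition _ := Uniform_isComplete.Build (cmx A n) cmx_complete.

Definition cmx_star (X : cmx A n) : cmx A n := mxstar (X : 'M[A]_n.+1).
Definition cmx_mul (X Y : cmx A n) : cmx A n := (X : 'M[A]_n.+1) *m (Y : 'M[A]_n.+1).
Definition cmx_one : cmx A n := 1%:M : 'M[A]_n.+1.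

Fact cmx_mulA : associative cmx_mul. Proof. exact: mulmxA. Qed.
Fact cmx_mul1x : left_id cmx_one cmx_mul. Proof. exact: mul1mx. Qed.
Fact cmx_mulx1 : right_id cmx_one cmx_mul. Proof. exact: mulmx1. Qed.
Fact cmx_mulDl : left_distributive cmx_mul +%R. Proof. exact: mulmxDl. Qed.
Fact cmx_mulDr : right_distributive cmx_mul +%R. Proof. exact: mulmxDr. Qed.
Fact cmx_one_neq0 : cmx_one != 0.
Proof.
apply/eqP => /matrixP/(_ ord0 ord0)/eqP.
by rewrite !mxE eqxx oner_eq0.
Qed.
Fact cmx_scaleAl (c : R[i]) (x y : cmx A n) : c *: cmx_mul x y = cmx_mul (c *: x) y.
Proof.
apply/matrixP => i j; rewrite !mxE scaler_sumr; apply: eq_bigr => k _.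
by rewrite mxE scalerAl.
Qed.
Fact cmx_scaleAr (c : R[i]) (x y : cmx A n) : c *: cmx_mul x y = cmx_mul x (c *: y).
Proof.
apply/matrixP => i j; rewrite !mxE scaler_sumr; apply: eq_bigr => k _.
by rewrite mxE scalerAr.
Qed.
Fact cmx_star_conj_linear (c : R[i]) (x y : cmx A n) :
  cmx_star (c *: x + y) = (Num.conj c) *: cmx_star x + cmx_star y.
Proof. by apply/matrixP => i j; rewrite !mxE starD starZ. Qed.
Fact cmx_starK : involutive cmx_star. Proof. exact: mxstarK. Qed.
Fact cmx_starM (x y : cmx A n) : cmx_star (cmx_mul x y) = cmx_mul (cmx_star y) (cmx_star x).
Proof.
apply/matrixP => i j; rewrite !mxE star_sum; apply: eq_bigr => k _.
by rewrite !mxE star_mul.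
Qed.
Fact cmx_normM_le (x y : cmx A n) : `|cmx_mul x y| <= `|x| * `|y|.
Proof. by have := opnM (x : 'M[A]_n.+1) y; rewrite -lecR rmorphM. Qed.
Fact cmx_cstar_identity (x : cmx A n) : `|cmx_mul (cmx_star x) x| = `|x| ^+ 2.
Proof. by have := opn_cstar (x : 'M[A]_n.+1); move/(congr1 (real_complex R)); rewrite rmorphXn. Qed.

HB.instance Definition _ := isCStarAlgebra.Build R (cmx A n)
  cmx_mulA cmx_mul1x cmx_mulx1 cmx_mulDl cmx_mulDr cmx_one_neq0 cmx_scaleAl cmx_scaleAr
  cmx_star_conj_linear cmx_starK cmx_starM cmx_normM_le cmx_cstar_identity.

End MatrixCStar.

(** This is what the C*-structure on matrices is for: [mx_pos] demands a single square, and in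
    [cmx A n] a sum of squares is positive, hence the square of a self-adjoint matrix. *)
Lemma mx_sum_squares (R : realType) (A : cstarType R) (n : nat) (I : Type) (r : seq I)
    (F : I -> 'M[A]_n) :
  exists Z : 'M[A]_n, \sum_(k <- r) mxstar (F k) *m F k = mxstar Z *m Z.
Proof.
case: n F => [|n] F; first by exists 0; apply/matrixP => -[].
have : pos (\sum_(k <- r) (star (F k : cmx A n) * (F k : cmx A n))).
  apply: pos_sum => k _; exact: pos_star_mul.
move=> [Z Zs ZE]; exists (Z : 'M[A]_n.+1).
have -> : mxstar (Z : 'M[A]_n.+1) = Z by exact: Zs.
exact: ZE.
Qed.

(** * Complex matrices *)

(* The alias hides the ring structure of [R[i]], which would compete with the one
   induced by the C*-structure. *)
Definition cplx (R : realType) : Type := R[i].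

Lemma normc_ge_Im (R : rcfType) (z : R[i]) : `|complex.Im z|%:C <= `|z|.
Proof.
by rewrite normc_def lecR -sqrtr_sqr ler_wsqrtr// lerDr sqr_ge0.
Qed.

Lemma normc_le_ReIm (R : rcfType) (z : R[i]) :
  `|z| <= (`|complex.Re z| + `|complex.Im z|)%:C.
Proof.
rewrite normc_def lecR -[leRHS]ger0_norm ?addr_ge0// -[leRHS]sqrtr_sqr ler_wsqrtr//.
rewrite sqrrD !real_normK ?num_real// lerD2r lerDl -mulr_natl.
by rewrite !mulr_ge0.
Qed.

Section ComplexCStar.
Variable R : realType.

HB.instance Definition _ := GRing.Lmodule.copy (cplx R) (R[i]^o).

Definition cplx_norm (x : cplx R) : R[i] := `|x : R[i]|.
Fact cplx_normD x y : cplx_norm (x + y) <= cplx_norm x + cplx_norm y.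
Proof. exact: ler_normD. Qed.
Fact cplx_normZ (c : R[i]) x : cplx_norm (c *: x) = `|c| * cplx_norm x.
Proof. exact: normrM. Qed.
Fact cplx_norm_eq0 x : cplx_norm x = 0 -> x = 0.
Proof. exact: normr0_eq0. Qed.

HB.instance Definition _ := Lmodule_isNormed.Build R[i] (cplx R)
  cplx_normD cplx_normZ cplx_norm_eq0.

Fact cplx_complete (F : set_system (cplx R)) : ProperFilter F -> cauchy F -> cvg F.
Proof.
move=> FF Fc.
pose re (x : cplx R) : R := complex.Re (x : R[i]).
pose im (x : cplx R) : R := complex.Im (x : R[i]).
have ReD (x y : cplx R) : re x - re y = re (x - y) by case: x y => ? ? [? ?].
have ImD (x y : cplx R) : im x - im y = im (x - y) by case: x y => ? ? [? ?].
have reB (x y : cplx R) : (`|re x - re y|%:C <= `|x - y| :> R[i]).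
  by rewrite ReD; exact: normc_ge_Re.
have imB (x y : cplx R) : (`|im x - im y|%:C <= `|x - y| :> R[i]).
  by rewrite ImD; exact: normc_ge_Im.
have hc (g : cplx R -> R) :
    (forall x y, (`|g x - g y|%:C <= `|x - y| :> R[i])) -> cvg (g @ F).
  move=> gB; apply: cauchy_cvg; apply/cauchy_ballP => e e0.
  have e0' : 0 < e%:C :> R[i] by rewrite ltcR.
  have /cauchy_ballP/(_ _ e0') := Fc.
  rewrite !near_simpl /=; move=> [[P Q] /= [FP FQ] PQ].
  exists (g @` P, g @` Q) => /=.
    split; [apply: filterS FP|apply: filterS FQ] => X PX /=; by exists X.
  move=> [_ _] /= [[X PX <-] [Y QY <-]].
  have := PQ (X, Y) (conj PX QY); rewrite -!ball_normE /ball_/= => h.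
  by rewrite -ltcR; apply: le_lt_trans h; exact: gB.
have hre := hc _ reB; have him := hc _ imB.
pose L : cplx R := Complex (lim (re @ F)) (lim (im @ F)).
apply/cvg_ex; exists L; apply/cvgrPdist_lt => e e0.
have eE : e = (complex.Re e)%:C by rewrite RRe_real// gtr0_real.
have e1 : 0 < complex.Re e / 2 by rewrite divr_gt0// -ltcR -eE.
have /cvgrPdist_lt/(_ _ e1) h1 := hre; have /cvgrPdist_lt/(_ _ e1) h2 := him.
apply: filterS2 h1 h2 => x; rewrite -[lim (re @ F)]/(re L) -[lim (im @ F)]/(im L).
rewrite ReD ImD => h1 h2.
apply: (@le_lt_trans _ _ (`|re (L - x)| + `|im (L - x)|)%:C).
  exact: normc_le_ReIm.
by rewrite eE ltcR; lra.
Qed.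

HB.instance Definition _ := Uniform_isComplete.Build (cplx R) cplx_complete.

Definition cplx_mul (x y : cplx R) : cplx R := (x : R[i]) * (y : R[i]).
Definition cplx_star (x : cplx R) : cplx R := Num.conj (x : R[i]).
Definition cplx_one : cplx R := 1 : R[i].

Fact cplx_mulA : associative cplx_mul. Proof. exact: mulrA. Qed.
Fact cplx_mul1x : left_id cplx_one cplx_mul. Proof. exact: mul1r. Qed.
Fact cplx_mulx1 : right_id cplx_one cplx_mul. Proof. exact: mulr1. Qed.
Fact cplx_mulDl : left_distributive cplx_mul +%R. Proof. exact: mulrDl. Qed.
Fact cplx_mulDr : right_distributive cplx_mul +%R. Proof. exact: mulrDr. Qed.
Fact cplx_one_neq0 : cplx_one != 0. Proof. exact: oner_neq0. Qed.
Fact cplx_scaleAl (c : R[i]) (x y : cplx R) : c *: cplx_mul x y = cplx_mul (c *: x) y.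
Proof. exact: mulrA. Qed.
Fact cplx_scaleAr (c : R[i]) (x y : cplx R) : c *: cplx_mul x y = cplx_mul x (c *: y).
Proof. exact: mulrCA. Qed.
Fact cplx_star_conj_linear (c : R[i]) (x y : cplx R) :
  cplx_star (c *: x + y) = (Num.conj c) *: cplx_star x + cplx_star y.
Proof. by rewrite /cplx_star rmorphD rmorphM. Qed.
Fact cplx_starK : involutive cplx_star. Proof. exact: conjCK. Qed.
Fact cplx_starM (x y : cplx R) :
  cplx_star (cplx_mul x y) = cplx_mul (cplx_star y) (cplx_star x).
Proof. by rewrite /cplx_star rmorphM /= mulrC. Qed.
Fact cplx_normM_le (x y : cplx R) : `|cplx_mul x y| <= `|x| * `|y|.
Proof. by rewrite le_eqVlt; apply/orP; left; apply/eqP; exact: normrM. Qed.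
Fact cplx_cstar_identity (x : cplx R) : `|cplx_mul (cplx_star x) x| = `|x| ^+ 2.
Proof. by rewrite /Num.norm /= /cplx_norm /cplx_mul normrM norm_conjC expr2. Qed.

HB.instance Definition _ := isCStarAlgebra.Build R (cplx R)
  cplx_mulA cplx_mul1x cplx_mulx1 cplx_mulDl cplx_mulDr cplx_one_neq0 cplx_scaleAl
  cplx_scaleAr cplx_star_conj_linear cplx_starK cplx_starM cplx_normM_le cplx_cstar_identity.

End ComplexCStar.

Section ComplexMatrices.
Variables (R : realType) (n : nat).
Local Notation C := (cmx (cplx R) n).

Fact cmx_vect_iso : Vector.axiom (n.+1 * n.+1) C.
Proof.
exists (fun X : C => mxvec (X : 'M[R[i]]_n.+1)).
  move=> a X Y; rewrite -linearP; congr mxvec.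
  by apply/matrixP => i j; rewrite !mxE.
exists (fun v => (vec_mx v : 'M[R[i]]_n.+1) : C) => X; [exact: mxvecK|exact: vec_mxK].
Qed.

HB.instance Definition _ := Lmodule_hasFinDim.Build R[i] C cmx_vect_iso.

Definition cdiag (d : 'rV[R[i]]_n.+1) : C := diag_mx d.

Fact cdiag_linear : linear cdiag.
Proof.
move=> a d e; apply/matrixP => i j; rewrite !mxE.
by rewrite mulrnDl -mulrnAr.
Qed.
HB.instance Definition _ := GRing.isLinear.Build _ _ _ _ cdiag cdiag_linear.

Definition cdiag_space : {vspace C} := limg (linfun cdiag).

Lemma cdiag_spaceP (X : C) :
  reflect (forall i j, i != j -> (X : 'M[R[i]]_n.+1) i j = 0) (X \in cdiag_space).
Proof.
apply: (iffP memv_imgP) => [[d _ ->] i j ij|h].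
  by rewrite lfunE !mxE (negbTE ij).
exists (\row_i (X : 'M[R[i]]_n.+1) i i); first exact: memvf.
rewrite lfunE; apply/matrixP => i j; rewrite !mxE.
by have [->|ij] := eqVneq i j; rewrite ?mulr1n ?mulr0n // h.
Qed.

Lemma cdiag_space_dim : \dim cdiag_space = n.+1.
Proof.
rewrite limg_dim_eq; first by rewrite dimvf dim_matrix; exact: mul1n.
apply/eqP; rewrite -subv0 capvC; apply/subvP => d /memv_capP[h _].
move: h; rewrite memv_ker lfunE memv0 => /eqP/matrixP h.
apply/eqP/rowP => i; have := h i i; rewrite !mxE eqxx mulr1n; exact.
Qed.

(** The diagonal matrices are maximal abelian: commuting with the matrix unit at [(i, i)] forces the
    off-diagonal entries of row [i] to vanish. *)
Lemma cmx_has_rank : has_rank (C : finCstarType R) n.+1.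
Proof.
exists cdiag_space; split; last exact: cdiag_space_dim.
have dM (X Y : C) : X \in cdiag_space -> Y \in cdiag_space ->
    forall i j, ((X * Y : C) : 'M[R[i]]_n.+1) i j =
      if i == j then (X : 'M[R[i]]_n.+1) i i * (Y : 'M[R[i]]_n.+1) i i else 0.
  move=> /cdiag_spaceP hX /cdiag_spaceP hY i j; rewrite [LHS]mxE (bigD1 i)//= big1.
    rewrite addr0; case: eqVneq => [<- //|ij].
    by rewrite hY// [LHS]mulr0.
  by move=> k ki; rewrite hX 1?eq_sym// [LHS]mul0r.
split; first split.
- move=> X /cdiag_spaceP hX; apply/cdiag_spaceP => i j ij.
  by rewrite !mxE hX 1?eq_sym// [LHS]star0.
- move=> X Y hX hY; apply/cdiag_spaceP => i j ij.
  by rewrite dM// (negbTE ij).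
- move=> X Y hX hY; apply/matrixP => i j; rewrite !dM//.
  by case: eqVneq => // _; rewrite mulrC.
move=> E [_ _ Ec] DE; apply/eqP; rewrite eqEsubv DE andbT.
apply/subvP => X XE; apply/cdiag_spaceP => i j ij.
pose P : C := delta_mx i i : 'M[R[i]]_n.+1.
have PD : P \in cdiag_space.
  apply/cdiag_spaceP => k l kl; rewrite mxE.
  case: andP => // -[/eqP ki /eqP li].
  by rewrite ki li eqxx in kl.
have PE : P \in E by apply: (subvP DE).
have := Ec _ _ XE PE => /matrixP/(_ i j).
rewrite [LHS]mxE [RHS]mxE [LHS]big1 => [|k _]; last first.
  by rewrite mxE eq_sym (eq_sym j) (negbTE ij) andbF [LHS]mulr0.
rewrite (bigD1 i)//= big1 => [|k ki]; last by rewrite mxE (negbTE ki) andbF [LHS]mul0r.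
by rewrite mxE !eqxx addr0 => /esym; rewrite [LHS]mul1r.
Qed.

End ComplexMatrices.

(** * Completely positive maps to and from matrices *)

Section PsdFactor.
Local Open Scope sesquilinear_scope.

(** By the spectral theorem [B] is the root of the diagonal part times the unitary; the eigenvalues
    are the values of the form at the rows of that unitary. *)
Lemma psd_mx_factor (C : numClosedFieldType) (n : nat) (G : 'M[C]_n) :
  G ^t* = G -> (forall v : 'rV[C]_n, 0 <= (v *m G *m v ^t*) 0 0) ->
  exists B : 'M[C]_n, G = B ^t* *m B.
Proof.
move=> Gh Gp.
have /orthomx_spectralP GE : G \is normalmx by apply/normalmxP; rewrite Gh.
set P := spectralmx G in GE; set d := spectral_diag G in GE.
have Pu : P \is unitarymx by exact: spectral_unitarymx.
rewrite (invmx_unitary Pu) in GE.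
have dE : P *m G *m P ^t* = diag_mx d.
  by rewrite GE !mulmxA mulmxtVK// (unitarymxP Pu) mul1mx.
have d0 i : 0 <= d 0 i.
  have -> : d 0 i = (row i P *m G *m (row i P) ^t*) 0 0.
    have -> : d 0 i = (diag_mx d) i i by rewrite mxE eqxx mulr1n.
    rewrite -dE -row_mul mxE [RHS]mxE; apply: eq_bigr => k _.
    by rewrite !mxE.
  exact: Gp.
exists (diag_mx (map_mx sqrtC d) *m P).
rewrite trmx_mul map_mxM tr_diag_mx map_diag_mx -mulmxA [X in _ *m X]mulmxA.
rewrite mulmx_diag {1}GE mulmxA; congr (_ *m diag_mx _ *m _).
apply/rowP => i; rewrite !mxE /= (CrealP _) ?ger0_real ?sqrtC_ge0//.
by rewrite -expr2 sqrtCK.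
Qed.

(** The index is any finite type so that it can be a pair: the position of a block and a position
    inside the block. *)
Lemma psd_kernel_factor (C : numClosedFieldType) (T : finType) (g : T -> T -> C) :
  (forall a b, g b a = Num.conj (g a b)) ->
  (forall v : T -> C, 0 <= \sum_a \sum_b v a * g a b * Num.conj (v b)) ->
  exists B : T -> T -> C, forall a b, g a b = \sum_c Num.conj (B c a) * B c b.
Proof.
move=> gh gp.
pose G := \matrix_(i < #|T|, j < #|T|) g (enum_val i) (enum_val j).
have [||B GB] := @psd_mx_factor C #|T| G.
- by apply/matrixP => i j; rewrite !mxE -gh.
- move=> v; have := gp (fun a => v 0 (enum_rank a)); congr (_ <= _).
  rewrite mxE exchange_big (reindex (fun i : 'I_#|T| => enum_val i)) /=; last first.
    by apply/onW_bij/enum_val_bij.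
  apply: eq_bigr => j _; rewrite !mxE mulr_suml.
  rewrite (reindex (fun i : 'I_#|T| => enum_val i)) /=; last first.
    by apply/onW_bij/enum_val_bij.
  by apply: eq_bigr => i _; rewrite !mxE !enum_valK.
exists (fun c a => B (enum_rank c) (enum_rank a)) => a b.
have /matrixP/(_ (enum_rank a) (enum_rank b)) := GB.
rewrite !mxE !enum_rankK => ->.
rewrite [RHS](reindex (fun i : 'I_#|T| => enum_val i)) /=; last first.
  by apply/onW_bij/enum_val_bij.
by apply: eq_bigr => i _; rewrite !mxE !enum_valK.
Qed.

End PsdFactor.

Section Factorization.
Variables (R : realType) (A : cstarType R) (n : nat).
Variables (t : 'I_n.+1 -> A) (m : R) (om : A -> R[i]).
Local Notation C := (cmx (cplx R) n).
Implicit Types (X Y : C) (x y : A).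

Definition cent X i j : R[i] := (X : 'M[cplx R]_n.+1) i j.

Lemma cent_mul X Y i j : cent (X * Y) i j = \sum_k cent X i k * cent Y k j.
Proof. by rewrite /cent [LHS]mxE. Qed.

Lemma cent_star X i j : cent (star X) i j = Num.conj (cent X j i).
Proof. by rewrite /cent !mxE. Qed.

Lemma cent1 i j : cent 1 i j = (i == j)%:R.
Proof. by rewrite /cent [LHS]mxE. Qed.

Lemma cent_sum (I : Type) (r : seq I) (P : pred I) (F : I -> C) i j :
  cent (\sum_(k <- r | P k) F k) i j = \sum_(k <- r | P k) cent (F k) i j.
Proof.
apply: (big_morph (fun X => cent X i j)) => [X Y|]; by rewrite /cent !mxE.
Qed.

(** [synth] and the later [anal] are the maps [phi] and [psi] of the overview, for an abstract
    family [t] and functional [om]; [m] plays the part of the number of shapes in the box. *)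
Definition synth X : A := (m^-1)%:C *: \sum_i \sum_j cent X i j *: (t i * star (t j)).

Fact synth_linear : linear synth.
Proof.
move=> a X Y; rewrite /synth [in RHS]scalerA mulrC -scalerA -scalerDr.
congr (_ *: _); rewrite scaler_sumr -big_split; apply: eq_bigr => i _.
rewrite scaler_sumr -big_split.
apply: eq_bigr => j _; rewrite /= scalerA -scalerDl; congr (_ *: _).
by rewrite /cent !mxE.
Qed.
HB.instance Definition _ := GRing.isLinear.Build _ _ _ _ synth synth_linear.

(** The polarised form, with two different matrices, is what complete positivity calls for: the
    entries of a block matrix [Y^* Y] are sums of products [star X * Y] of distinct blocks. *)
Lemma synth_gram (X Y : C) : 0 < m ->
  synth (star X * Y) = \sum_k star ((Num.sqrt m^-1)%:C *: \sum_j cent X k j *: star (t j))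
    * ((Num.sqrt m^-1)%:C *: \sum_j cent Y k j *: star (t j)).
Proof.
move=> m0; transitivity ((m^-1)%:C *: \sum_k
   (star (\sum_j cent X k j *: star (t j)) * (\sum_j cent Y k j *: star (t j)))); last first.
  rewrite scaler_sumr; apply: eq_bigr => k _.
  rewrite starZr -scalerAl -scalerAr scalerA -rmorphM /= -expr2 sqr_sqrtr//.
  by rewrite invr_ge0 ltW.
congr (_ *: _).
under [RHS]eq_bigr => k _.
  rewrite star_sum mulr_suml.
  under eq_bigr => i _ do rewrite mulr_sumr.
  over.
rewrite [RHS]exchange_big; apply: eq_bigr => i _; rewrite exchange_big.
apply: eq_bigr => j _; rewrite cent_mul scaler_suml; apply: eq_bigr => k _.
by rewrite cent_star starZ starK -scalerAl -scalerAr scalerA.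
Qed.

Lemma synth_ucp : 0 < m -> \sum_i t i * star (t i) = m%:C *: 1 ->
  synth 1 = 1 /\ completely_positive (synth : C -> A).
Proof.
move=> m0 tm; split.
  rewrite /synth.
  under eq_bigr => i _.
    rewrite (bigD1 i)//= big1 => [|j ji]; last by rewrite cent1 eq_sym (negbTE ji) scale0r.
    rewrite cent1 eqxx scale1r addr0; over.
  by rewrite tm scalerA -rmorphM /= mulVf ?gt_eqF// scale1r.
move=> k X [Y XY].
pose c (l : 'I_k) (w : 'I_n.+1) (b : 'I_k) : A :=
  (Num.sqrt m^-1)%:C *: \sum_j cent (Y l b) w j *: star (t j).
(* Only row [lw.1] is nonzero, so the square of [F (l, w)] has the single product
   [star (c l w i) * c l w j] as its entry [(i, j)]. *)
pose F (lw : 'I_k * 'I_n.+1) : 'M[A]_k :=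
  \matrix_(a, b) if a == lw.1 then c lw.1 lw.2 b else 0.
have [Z ZE] := mx_sum_squares (index_enum ('I_k * 'I_n.+1)%type) F.
exists Z; rewrite -[RHS]ZE XY; apply/matrixP => i j; rewrite mxE summxE mxE.
transitivity (\sum_l \sum_w star (c l w i) * c l w j).
  rewrite linear_sum; apply: eq_bigr => l _; rewrite !mxE; exact: synth_gram.
rewrite pair_big; apply: eq_bigr => -[l w] _ /=.
rewrite mxE (bigD1 l)//= big1 => [|a al]; last by rewrite !mxE /= (negbTE al) mulr0.
by rewrite !mxE /= eqxx addr0.
Qed.

Hypothesis omD : forall x y, om (x + y) = om x + om y.
Hypothesis omZ : forall (c : R[i]) x, om (c *: x) = c * om x.

Definition anal x : C := (\matrix_(i, j) om (star (t i) * x * t j) : 'M[R[i]]_n.+1).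

Fact anal_linear : linear anal.
Proof.
move=> a x y; apply/matrixP => i j; rewrite !mxE.
transitivity (a * om (star (t i) * x * t j) + om (star (t i) * y * t j)); last by [].
by rewrite -omZ -omD mulrDr mulrDl -scalerAr -scalerAl.
Qed.
HB.instance Definition _ := GRing.isLinear.Build _ _ _ _ anal anal_linear.

Lemma om0 : om 0 = 0.
Proof. by rewrite -(scale0r (0 : A)) omZ mul0r. Qed.

Lemma om_sum (I : Type) (r : seq I) (P : pred I) (F : I -> A) :
  om (\sum_(i <- r | P i) F i) = \sum_(i <- r | P i) om (F i).
Proof. exact: (big_morph om omD om0). Qed.

Lemma om_sesqui (c d : R[i]) x y :
  om (star (c *: x) * (d *: y)) = Num.conj c * d * om (star x * y).
Proof. by rewrite starZ -scalerAl -scalerAr !omZ mulrA. Qed.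

(** For [X = Y^* Y] the image is a complex kernel [g] on pairs of indices. Its quadratic form is a
    sum of values of [om] at squares, so it factors over the complex numbers, and the factor cut
    into blocks is the required square root. *)
Lemma anal_ucp : (forall x, om (star x) = Num.conj (om x)) ->
  (forall x, 0 <= om (star x * x)) ->
  (forall i j, om (star (t i) * t j) = (i == j)%:R) ->
  anal 1 = 1 /\ completely_positive (anal : A -> C).
Proof.
move=> omS omP omt; split.
  by apply/matrixP => i j; rewrite !mxE mulr1 omt.
move=> k X [Y XY].
pose g (a b : 'I_k * 'I_n.+1) : R[i] := om (star (t a.2) * X a.1 b.1 * t b.2).
have Xs i j : star (X i j) = X j i.
  by rewrite XY !mxE star_sum; apply: eq_bigr => l _; rewrite !mxE star_mul starK.
have [||B gB] := @psd_kernel_factor _ _ g.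
- by move=> a b; rewrite /g -omS !star_mul starK Xs !mulrA.
- move=> v.
  have -> : \sum_a \sum_b v a * g a b * Num.conj (v b) =
     \sum_l om (star (\sum_b Num.conj (v b) *: (Y l b.1 * t b.2)) *
                (\sum_b Num.conj (v b) *: (Y l b.1 * t b.2))).
    under [RHS]eq_bigr => l _.
      rewrite star_sum mulr_suml om_sum.
      under eq_bigr => a _ do rewrite mulr_sumr om_sum.
      over.
    rewrite [RHS]exchange_big; apply: eq_bigr => a _.
    rewrite [RHS]exchange_big; apply: eq_bigr => b _.
    rewrite /g XY !mxE mulr_sumr mulr_suml om_sum mulr_sumr mulr_suml.
    apply: eq_bigr => l _; rewrite !mxE om_sesqui conjCK star_mul.
    by rewrite mulrAC !mulrA.
  by apply: sumr_ge0 => l _; exact: omP.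
exists (\matrix_(l, j) (\matrix_(w, u) B (l, w) (j, u) : C)).
apply/matrixP => i j; rewrite !mxE; apply/matrixP => u v.
rewrite -[RHS]/(cent _ u v) cent_sum.
transitivity (g (i, u) (j, v)); first by rewrite mxE.
transitivity (\sum_l \sum_w Num.conj (B (l, w) (i, u)) * B (l, w) (j, v)).
  by rewrite gB pair_big; apply: eq_bigr => -[].
apply: eq_bigr => l _; rewrite cent_mul; apply: eq_bigr => w _.
by rewrite !mxE cent_star /cent !mxE.
Qed.

End Factorization.

(** * Positive functionals *)

(* Minimal sublinear functionals are linear; this replaces the extension step of the
   Hahn-Banach theorem. *)
Section Sublinear.
Variables (R : realType) (A : cstarType R).
Implicit Types (x y e : A) (t : R) (q f : A -> R).

Definition sublinear q : Prop :=
  [/\ forall x y, q (x + y) <= q x + q y,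
      forall t x, 0 < t -> q (t%:C *: x) <= t * q x &
      forall x, q x <= nrm x].

Lemma sublinear0 q : sublinear q -> q 0 = 0.
Proof.
move=> [qD _ qn]; apply/eqP; rewrite eq_le; apply/andP; split.
  by rewrite -(nrm0 A) qn.
by have := qD 0 0; rewrite addr0; lra.
Qed.

Lemma sublinear_ge q x : sublinear q -> - nrm x <= q x.
Proof.
move=> hq; have q0 := sublinear0 hq; have [qD _ qn] := hq.
have := qD x (- x); rewrite subrr q0; have := qn (- x); rewrite nrmN; lra.
Qed.

(** Stated for sets [P x] so as to serve twice: for [tilt], and for the lower bound of a chain in
    Zorn's lemma. *)
Lemma sublinear_inf (P : A -> set R) :
  (forall x, lbound (P x) (- nrm x)) ->
  (forall x, exists2 c, P x c & c <= nrm x) ->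
  (forall x y a b, P x a -> P y b -> exists2 c, P (x + y) c & c <= a + b) ->
  (forall t x a, 0 < t -> P x a -> exists2 c, P (t%:C *: x) c & c <= t * a) ->
  sublinear (fun x => inf (P x)).
Proof.
move=> Pl Pn PD PZ.
have ne x : P x !=set0 by have [c] := Pn x; exists c.
have le x c : P x c -> inf (P x) <= c by move=> h; apply: ge_inf h; exists (- nrm x).
split.
- move=> x y; rewrite -lerBlDr; apply: lb_le_inf => // a Pa.
  rewrite lerBlDr -lerBlDl; apply: lb_le_inf => // b Pb.
  by rewrite lerBlDl; have [c Pc /(le_trans (le _ _ Pc))] := PD _ _ _ _ Pa Pb.
- move=> t x t0; rewrite mulrC -ler_pdivrMr//; apply: lb_le_inf => // a Pa.
  by rewrite ler_pdivrMr// mulrC; have [c Pc /(le_trans (le _ _ Pc))] := PZ _ _ _ t0 Pa.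
- by move=> x; have [c Pc /(le_trans (le _ _ Pc))] := Pn x.
Qed.

(** The tilt lies below [q] (take [t = 0]), and [t = 1] gives [tilt q y x + q y <= q (x + y)]. So a
    [q] with nothing sublinear strictly below it is superadditive. *)
Definition tilt_set q y x : set R :=
  [set a | exists2 t, 0 <= t & a = q (x + t%:C *: y) - t * q y].
Definition tilt q y x : R := inf (tilt_set q y x).

Lemma sublinearZ q t x : sublinear q -> 0 <= t -> q (t%:C *: x) = t * q x.
Proof.
move=> hq; rewrite le_eqVlt => /predU1P[<-|t0].
  by rewrite scale0r mul0r sublinear0.
have [_ qZ _] := hq; apply/eqP; rewrite eq_le qZ//=.
have ti : 0 < t^-1 by rewrite invr_gt0.
have := qZ t^-1 (t%:C *: x) ti.
by rewrite scalerA -rmorphM /= mulVf ?gt_eqF// scale1r mulrC ler_pdivlMr// mulrC.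
Qed.

Lemma tilt_lbound q y x : sublinear q -> lbound (tilt_set q y x) (- nrm x).
Proof.
move=> hq _ [t t0 ->]; have [qD _ qn] := hq.
have := qD (x + t%:C *: y) (- x); rewrite addrAC subrr add0r sublinearZ//.
by have := qn (- x); rewrite nrmN; lra.
Qed.

Lemma tilt_le q y x t : sublinear q -> 0 <= t -> tilt q y x <= q (x + t%:C *: y) - t * q y.
Proof.
move=> hq t0; apply: ge_inf; last by exists t.
by exists (- nrm x); exact: tilt_lbound.
Qed.

Lemma tilt_sublinear q y : sublinear q -> sublinear (tilt q y).
Proof.
move=> hq; have [qD qZ qn] := hq; apply: sublinear_inf.
- by move=> x; exact: tilt_lbound.
- move=> x; exists (q (x + 0%:C *: y) - 0 * q y); first by exists 0.
  by rewrite scale0r addr0 mul0r subr0.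
- move=> x x' _ _ [s s0 ->] [t t0 ->].
  exists (q (x + x' + (s + t)%:C *: y) - (s + t) * q y).
    by exists (s + t) => //; exact: addr_ge0.
  have := qD (x + s%:C *: y) (x' + t%:C *: y).
  by rewrite addrACA -scalerDl -rmorphD /=; lra.
- move=> t x _ t0 [s s0 ->].
  exists (q (t%:C *: x + (t * s)%:C *: y) - (t * s) * q y).
    by exists (t * s) => //; rewrite mulr_ge0// ltW.
  rewrite rmorphM /= -scalerA -scalerDr.
  by have := qZ t (x + s%:C *: y) t0; lra.
Qed.

Lemma minimal_sublinear_linear q : sublinear q ->
  (forall q', sublinear q' -> (forall x, q' x <= q x) -> q' = q) ->
  (forall x y, q (x + y) = q x + q y) /\ (forall t x, q (t%:C *: x) = t * q x).
Proof.
move=> hq qmin.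
have qD x y : q (x + y) = q x + q y.
  have [qD _ _] := hq; apply/eqP; rewrite eq_le qD /=.
  have qE : tilt q y = q.
    apply: qmin; first exact: tilt_sublinear.
    move=> z; have := tilt_le y z hq (lexx 0).
    by rewrite scale0r addr0 mul0r subr0.
  have := tilt_le y x hq (@ler01 R); rewrite qE scale1r; lra.
split=> // t x; have [t0|t0] := leP 0 t; first exact: sublinearZ.
have : q (t%:C *: x) + q ((- t)%:C *: x) = 0.
  by rewrite -qD -scalerDl -rmorphD /= subrr scale0r sublinear0.
have nt : 0 <= - t by rewrite oppr_ge0 ltW.
by rewrite (sublinearZ x hq nt); lra.
Qed.

(** The condition [q (- e) <= - nrm e] is inherited by smaller functionals, so one that is minimal
    under it is minimal outright, hence linear, and then [q e = - q (- e)]. The tilt of the norm at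
    [e] satisfies the condition. *)
Lemma norming_functional e : exists f : A -> R,
  [/\ forall x y, f (x + y) = f x + f y, forall t x, f (t%:C *: x) = t * f x,
      forall x, f x <= nrm x & nrm e <= f e].
Proof.
pose ok q := sublinear q /\ q (- e) <= - nrm e.
pose T := {q : A -> R | ok q}.
pose le (p q : T) := `[< forall x, sval q x <= sval p x >].
have sub_nrm : sublinear (@nrm R A).
  split=> [x y|t x t0|//]; first exact: nrmD.
  by rewrite nrmZr gtr0_norm.
have ok0 : ok (tilt (@nrm R A) e).
  split; first exact: tilt_sublinear.
  have := tilt_le e (- e) sub_nrm (@ler01 R).
  by rewrite scale1r addNr nrm0 sub0r mul1r.
have [|||S St|[q [hq qe]] qmax] := @Zorn T le.
- by move=> p; apply/asboolP.
- move=> p q s /asboolP h1 /asboolP h2; apply/asboolP => x.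
  exact: le_trans (h2 x) (h1 x).
- move=> [p hp] [q hq] /asboolP h1 /asboolP h2.
  have E : p = q by apply/funext => x; apply/eqP; rewrite eq_le h1 h2.
  by subst q; congr exist; exact: Prop_irrelevance.
- have [[p0 Sp0]|S0] := pselect (exists p, S p); last first.
    by exists (exist _ _ ok0) => s Ss; exfalso; apply: S0; exists s.
  pose P x := [set sval p x | p in S].
  have lb x : lbound (P x) (- nrm x).
    by move=> _ [[p [hp pe]] _ <-]; exact: sublinear_ge.
  have hi : sublinear (fun x => inf (P x)).
    apply: sublinear_inf => //.
    + move=> x; exists (sval p0 x); first by exists p0.
      by have [[_ _ hp] _] := svalP p0; exact: hp.
    + move=> x y _ _ [p Sp <-] [p' Sp' <-].
      have [/asboolP h|/asboolP h] := St p p' Sp Sp'.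
        exists (sval p' (x + y)); first by exists p'.
        have [[pD _ _] _] := svalP p'.
        by apply: le_trans (pD _ _) _; rewrite lerD2r.
      exists (sval p (x + y)); first by exists p.
      have [[pD _ _] _] := svalP p.
      by apply: le_trans (pD _ _) _; rewrite lerD2l.
    + move=> t x _ t0 [p Sp <-]; exists (sval p (t%:C *: x)); first by exists p.
      by have [[_ pZ _] _] := svalP p; exact: pZ.
  have infle x p : S p -> inf (P x) <= sval p x.
    by move=> Sp; apply: ge_inf; [exists (- nrm x)|exists p].
  have hok : ok (fun x => inf (P x)).
    split=> //; apply: le_trans (infle _ _ Sp0) _.
    by have [] := svalP p0.
  exists (exist _ _ hok) => s Ss; apply/asboolP => x; exact: infle.
have [qD qZ] : (forall x y, q (x + y) = q x + q y) /\ (forall t x, q (t%:C *: x) = t * q x).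
  apply: minimal_sublinear_linear => // q' hq' q'q.
  have h' : ok q' by split=> //; exact: le_trans (q'q _) qe.
  have le' : le (exist _ q (conj hq qe)) (exist _ q' h') by exact/asboolP.
  exact: (congr1 sval (qmax _ le')).
exists q; split=> //; first by have [] := hq.
have : q e + q (- e) = 0 by rewrite -qD subrr sublinear0.
lra.
Qed.

End Sublinear.

Section PositiveFunctional.
Variables (R : realType) (A : cstarType R).
Implicit Types (x y e : A) (t : R).

Definition cre x : A := 2^-1%:C *: (x + star x).
Definition cim x : A := 2^-1%:C *: ('i%C *: (star x - x)).

Lemma creD x y : cre (x + y) = cre x + cre y.
Proof. by rewrite /cre starD addrACA scalerDr. Qed.

Lemma cimD x y : cim (x + y) = cim x + cim y.
Proof. by rewrite /cim starD opprD addrACA !scalerDr. Qed.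

Lemma creZ t x : cre (t%:C *: x) = t%:C *: cre x.
Proof. by rewrite /cre starZr -scalerDr scalerA mulrC -scalerA. Qed.

Lemma cimZ t x : cim (t%:C *: x) = t%:C *: cim x.
Proof. by rewrite /cim starZr -scalerBr !scalerA mulrC mulrA. Qed.

Lemma starI x : star ('i%C *: x) = - ('i%C *: star x).
Proof.
rewrite starZ -scaleNr; congr (_ *: _).
by apply/eqP; rewrite eq_complex /= oppr0 !eqxx.
Qed.

Lemma creI x : cre ('i%C *: x) = - cim x.
Proof. by rewrite /cre /cim starI -scalerBr -!scalerN opprB. Qed.

Lemma cimI x : cim ('i%C *: x) = cre x.
Proof.
rewrite /cre /cim starI -opprD -scalerDr scalerN scalerA.
have -> : 'i%C * 'i%C = -1 :> R[i] by rewrite -expr2 sqr_i.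
by rewrite scaleN1r opprK addrC.
Qed.

Lemma positive_functional e : star e = e -> e * e = e -> e != 0 -> exists om : A -> R[i],
  [/\ forall x y, om (x + y) = om x + om y,
      forall (c : R[i]) x, om (c *: x) = c * om x,
      forall x, om (star x) = Num.conj (om x),
      forall x, 0 <= om (star x * x) & 0 < om e].
Proof.
move=> es ee e0; have [f [fD fZ fn fe]] := norming_functional e.
have ne : 0 < nrm e.
  rewrite lt_neqAle nrm_ge0 andbT eq_sym; apply: contra e0 => /eqP h.
  by apply/eqP/nrm_eq0.
have ne1 : nrm e = 1.
  have := nrm_cstar e; rewrite es ee expr2 => h.
  by apply: (mulfI (lt0r_neq0 ne)); rewrite mulr1 -h.
have f0 : f 0 = 0 by have := fZ 0 0; rewrite scale0r mul0r.
have fN x : f (- x) = - f x by have := fD x (- x); rewrite subrr f0; lra.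
(* [2 e - 1] is unitary, so that [2 (f e) - f 1 <= 1]. *)
have f1 : 1 <= f 1.
  have : nrm (e + e - 1) <= 1.
    rewrite (@nrm_unitary _ _ (e + e - 1))// starB starD es star1.
    by rewrite mulrBr mulr1 mulrBl mul1r mulrDl !mulrDr !ee addrK opprB addrC subrK.
  by move=> h; have := le_trans (fn _) h; rewrite !fD fN; lra.
(* From [f (t - h) <= t], where [t] exceeds the norm of [h], follows [f h >= t (f 1 - 1)], and
   [f 1 >= 1]. *)
have fpos h : pos h -> 0 <= f h.
  move=> hp; have t0 : 0 < nrm h + 1 by rewrite ltr_wpDl.
  have l : nrm h <= nrm h + 1 by rewrite lerDl.
  have := le_trans (fn _) (pos_nrm t0 l hp); rewrite fD fN fZ; nra.
(* Complexifying through the real and imaginary parts makes [om] hermitian by construction. *)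
pose om x : R[i] := Complex (f (cre x)) (f (cim x)).
have omD x y : om (x + y) = om x + om y by rewrite /om creD cimD !fD.
have omR t x : om (t%:C *: x) = t%:C * om x.
  by rewrite /om creZ cimZ !fZ; apply/eqP; rewrite eq_complex /= !mul0r subr0 addr0 !eqxx.
have omI x : om ('i%C *: x) = 'i%C * om x.
  by rewrite /om creI cimI fN; apply/eqP; rewrite eq_complex /=; apply/andP; split; apply/eqP; ring.
exists om; split => //.
- move=> c x; by rewrite [c]complexE scalerDl omD omR -scalerA omI omR mulrDl mulrA.
- move=> x; have -> : om (star x) = Complex (f (cre x)) (- f (cim x)).
    by rewrite /om /cre /cim starK (addrC (star x)) -fN -!scalerN opprB.
  by [].
- move=> x; have -> : om (star x * x) = (f (star x * x))%:C.
    by rewrite /om /cre /cim star_mul starK subrr !scaler0 f0 half2.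
  by rewrite ler0c; apply: fpos; exact: pos_star_mul.
- have -> : om e = (f e)%:C.
    by rewrite /om /cre /cim es subrr !scaler0 f0 half2.
  by rewrite ltcR; apply: lt_le_trans ne fe.
Qed.

End PositiveFunctional.

Lemma closed_prim_root (C : numClosedFieldType) (n : nat) : (0 < n)%N ->
  exists z : C, n.-primitive_root z.
Proof.
pose p : {poly C} := 'X^n - 1; have [t Dp] := closed_field_poly_normal p.
move=> n_gt0; rewrite (monicP _) ?monicXnsubC // scale1r in Dp.
have tn1 : all n.-unity_root t by apply/allP=> z; rewrite -root_prod_XsubC -Dp.
have sz_t : (n < (size t).+1)%N.
  by rewrite -(size_prod_XsubC t id) -Dp size_XnsubC.
have [|z] := hasP (has_prim_root n_gt0 tn1 _ sz_t); last by exists z.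
by rewrite -separable_prod_XsubC -Dp separable_Xn_sub_1 // pnatr_eq0 -lt0n.
Qed.

(** A geometric sum over a full period; its ratio is the power of [z] with exponent [a - b],
    different from 1 because this exponent is nonzero and smaller than [n] in absolute value. The
    conjugate stands for the inverse. *)
Lemma sum_character (C : numClosedFieldType) (n : nat) (z : C) (a b : nat) :
  n.-primitive_root z -> (a < b + n)%N -> (b < a + n)%N -> a <> b ->
  \sum_(j < n) (z ^+ j) ^+ a * Num.conj ((z ^+ j) ^+ b) = 0.
Proof.
move=> zn ab ba ne.
have n0 : (0 < n)%N by apply: prim_order_gt0 zn.
have zz : z * Num.conj z = 1.
  rewrite -normCK; have : `|z| ^+ n = 1 by rewrite -normrX (prim_expr_order zn) normr1.
  by move/eqP; rewrite pexpr_eq1// => /eqP ->; rewrite expr1n.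
pose rho := z ^+ a * Num.conj (z ^+ b).
have rhon : rho ^+ n = 1.
  rewrite exprMn -!exprM -rmorphXn -exprM ![(_ * n)%N]mulnC !exprM.
  by rewrite (prim_expr_order zn) !expr1n rmorph1 mulr1.
have rho1 : rho != 1.
  apply/eqP => h.
  have : z ^+ a == z ^+ b.
    have : rho * z ^+ b = z ^+ a.
      by rewrite -mulrA rmorphXn -exprMn (mulrC _ z) zz expr1n mulr1.
    by rewrite h mul1r => ->.
  rewrite (eq_prim_root_expr zn) => /eqP.
  wlog lt : a b ab ba ne {rho rhon h} / (a < b)%N => [H|].
    move=> e; have [l|l|e'] := ltngtP a b; [exact: (H a b)|exact: (H b a) (nesym ne) l (esym e)|].
    exact: ne e'.
  move=> e; have : (n %| b - a)%N by rewrite -eqn_mod_dvd ?(ltnW lt)// e.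
  move=> /dvdn_leq; rewrite subn_gt0 => /(_ lt); rewrite leqNgt ltn_subLR ?(ltnW lt)// addnC.
  by rewrite addnC ba.
have e : \sum_(j < n) (z ^+ j) ^+ a * Num.conj ((z ^+ j) ^+ b) = \sum_(j < n) rho ^+ j.
  apply: eq_bigr => j _; rewrite exprMn -rmorphXn -!exprM.
  by rewrite ![(_ * j)%N]mulnC.
rewrite e; apply: (mulfI (_ : rho - 1 != 0)); first by rewrite subr_eq0.
by rewrite -subrX1 rhon subrr mulr0.
Qed.

(** * Ranks and growth *)

(** The zero subspace is not maximal, being inside the line of scalars. This makes the logarithm of
    [rcp] nonnegative. *)
Lemma has_rank_gt0 (R : realType) (C : finCstarType R) (d : nat) :
  has_rank C d -> (0 < d)%N.
Proof.
move=> [D [[_ Dmax] <-]]; rewrite lt0n dimv_eq0; apply/eqP => D0.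
have e1 : abelian_subalgebra (<[1 : C]>%VS).
  split.
  - move=> x /vlineP[k ->]; apply/vlineP; exists (Num.conj k).
    by rewrite starZ [star _]star1.
  - move=> x y /vlineP[k ->] /vlineP[l ->]; apply/vlineP; exists (k * l).
    by rewrite -scalerAl -scalerAr mulr1 scalerA.
  - move=> x y /vlineP[k ->] /vlineP[l ->].
    by rewrite -!scalerAl -!scalerAr !mulr1 !scalerA mulrC.
have := Dmax _ e1; rewrite D0 sub0v => /(_ isT) e.
have : (1 : C) \in <[1 : C]>%VS by exact: memv_line.
by rewrite e memv0 oner_eq0.
Qed.

Lemma exp_growth_esup (R : realType) (r : nat) (f : nat -> \bar R) (B C : nat) : (2 <= r)%N ->
  (forall n, (1 <= f n)%E) -> (forall n, (f n <= (B ^ n * C)%:R%:E)%E) ->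
  limn_esup (fun n : nat => ((n%:R ^+ r)^-1%:E * lne (f n))%E) = 0%E.
Proof.
move=> r2 f1 fB.
have pos n : 1 <= (B ^ n * C)%:R :> R by rewrite -lee_fin; exact: le_trans (f1 n) (fB n).
have C1 : (0 < C)%N by have := pos 0%N; rewrite expn0 mul1n ler1n.
have B1 : (0 < B)%N by have := pos 1%N; rewrite expn1 ler1n muln_gt0 => /andP[].
have lB : 0 <= ln B%:R :> R by rewrite ln_ge0// ler1n.
have lC : 0 <= ln C%:R :> R by rewrite ln_ge0// ler1n.
(* The factor 2 is there because [harmonic n] is [1 / (n + 1)], while the estimate gives [1 / n]. *)
pose a : R := 2 * (ln B%:R + ln C%:R).
apply: (cvg_limn_einf_sup _).2.
apply: (@squeeze_cvge _ _ _ _ (fun=> 0%E) _ (fun n => (a * harmonic n)%:E)).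
- near=> n.
  have n0 : (0 < n)%N by near: n; exists 1%N.
  have np : 0 < n%:R :> R by rewrite ltr0n.
  have nr : 0 <= (n%:R ^+ r)^-1 :> R by rewrite invr_ge0 exprn_ge0.
  apply/andP; split; first by rewrite mule_ge0 ?lee_fin// lne_ge0.
  have h : (lne (f n) <= (n%:R * ln B%:R + ln C%:R)%:E)%E.
    have -> : n%:R * ln B%:R + ln C%:R = ln (B ^ n * C)%:R :> R.
      rewrite natrM lnM ?posrE ?ltr0n ?expn_gt0 ?B1// natrX lnXn ?ltr0n//.
      by rewrite mulr_natl.
    rewrite -lne_EFin; last by apply: lt_le_trans (pos n); exact: ltr01.
    rewrite lee_lne//; rewrite in_itv/= leey andbT; first exact: le_trans (f1 n).
    by rewrite lee_fin; apply: le_trans (pos n).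
  apply: le_trans (lee_wpmul2l _ h) _; first by rewrite lee_fin.
  rewrite -EFinM lee_fin /harmonic /= /a.
  have n1 : 1 <= n%:R :> R by rewrite ler1n.
  apply: (@le_trans _ _ ((n%:R ^+ 2)^-1 * (n%:R * (ln B%:R + ln C%:R)))).
    apply: ler_pM => //; first by rewrite addr_ge0// mulr_ge0.
      by rewrite lef_pV2 ?posrE ?exprn_gt0//; exact: ler_weXn2l.
    by rewrite mulrDr lerD2l -[leLHS]mul1r ler_wpM2r.
  rewrite mulrA expr2 invfM mulrVK ?unitfE ?gt_eqF// mulrC -mulrA mulrCA.
  apply: ler_wpM2l; first exact: addr_ge0.
  rewrite -[leLHS]div1r ler_pdivrMr// mulrAC ler_pdivlMr ?ltr0n// mul1r -natr1; lra.
- exact: cvg_cst.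
- apply: cvg_EFin; first exact: nearW.
  rewrite -[X in _ --> X](mulr0 a); apply: cvgM; first exact: cvg_cst.
  exact: cvg_harmonic.
Unshelve. all: by end_near.
Qed.

(** * The C*-algebra of a rank-r graph *)

Section ClosedSets.
Variables (R : realType) (A : cstarType R).

Lemma closed_nrm (D : set A) :
  (forall x, (forall e : R, 0 < e -> exists2 y, D y & nrm (x - y) < e) -> D x) ->
  closed D.
Proof.
move=> h x xD; apply: h => e e0.
have e0' : 0 < e%:C :> R[i] by rewrite ltcR.
have [y [Dy]] := xD _ (nbhsx_ballx x _ e0').
by rewrite -ball_normE /ball_/= nrmE ltcR => xy; exists y.
Qed.

End ClosedSets.

(* [shape] alone would be that of [seq]. *)
Local Notation shape := Defs.shape.

Section GraphAlgebra.
Variables (R : realType) (r : nat) (L : rank_graph r) (A : cstarType R) (s : word L -> A).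
Hypotheses (Lrf : row_finite L) (Lfin : finite_set [set: vertex L]).
Hypothesis sfam : graph_family s.
Implicit Types (u v w : word L) (p q m l : zplus r) (X Y : A).

Lemma zaddE p q i : (p + q) i = (p i + q i)%N.
Proof. by rewrite ffunE. Qed.

Lemma words_finite p : finite_set (words (L := L) p).
Proof.
have -> : words (L := L) p = \bigcup_(a in [set: vertex L]) words_from p a.
  by apply/seteqP; split=> [w wp|w [a _ []]//]; exists (wo w).
by apply: bigcup_finite => // a _; exact: Lrf.
Qed.

Definition wseq p : seq (word L) :=
  finmap.enum_fset (fset_set (words (L := L) p)).
Definition vseq : seq (vertex L) := finmap.enum_fset (fset_set [set: vertex L]).

Lemma wseqE p w : (w \in wseq p) = (shape w == p).
Proof.
rewrite /wseq in_fset_set; last exact: words_finite.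
by apply/idP/eqP => [/set_mem|h]; [|exact: mem_set].
Qed.

Lemma wseq_uniq p : uniq (wseq p).
Proof. exact: finmap.fset_uniq. Qed.

Lemma vseq_uniq : uniq vseq.
Proof. exact: finmap.fset_uniq. Qed.

Lemma vseqE a : a \in vseq.
Proof. by rewrite /vseq in_fset_set ?inE. Qed.

Definition vproj (a : vertex L) : A := s (wid a).

Lemma vproj_star a : star (vproj a) = vproj a.
Proof. by have [[h _] _ _ _] := sfam; have [] := h a. Qed.

Lemma vproj_idem a : vproj a * vproj a = vproj a.
Proof. by have [[h _] _ _ _] := sfam; have [] := h a. Qed.

Lemma vproj_orth a b : a != b -> vproj a * vproj b = 0.
Proof. by move/eqP; have [[_ h] _ _ _] := sfam; exact: h. Qed.

Lemma s_mul u v : wt u = wo v -> s (wmul u v) = s u * s v.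
Proof. by have [_ h _ _] := sfam; exact: h. Qed.

Lemma s_star_self u : star (s u) * s u = vproj (wt u).
Proof. by have [_ _ h _] := sfam; exact: h. Qed.

Lemma s_wo u : vproj (wo u) * s u = s u.
Proof. by rewrite /vproj -s_mul ?wt_id// wmul1w. Qed.

Lemma s_wt u : s u * vproj (wt u) = s u.
Proof. by rewrite /vproj -s_mul ?wo_id// wmulw1. Qed.

Lemma s_mul0 u v : wt u != wo v -> s u * s v = 0.
Proof.
by move=> h; rewrite -(s_wt u) -(s_wo v) -mulrA (mulrA (vproj _)) vproj_orth// mul0r mulr0.
Qed.

Lemma vproj_sum a p : vproj a = \sum_(u <- wseq p | wo u == a) s u * star (s u).
Proof.
have [_ _ _ /(_ a p)] := sfam; rewrite -/(vproj a) => ->.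
rewrite (fsbig_finite _ _ (Lrf p a)) -[RHS]big_filter; apply: perm_big.
apply: uniq_perm; rewrite ?filter_uniq ?finmap.fset_uniq ?wseq_uniq// => u.
rewrite mem_filter wseqE in_fset_set; last exact: Lrf.
apply/idP/andP => [/set_mem[<- <-]//|[/eqP h1 /eqP h2]].
exact: mem_set.
Qed.

Definition rproj u : A := s u * star (s u).

Lemma rproj_sum p : \sum_(u <- wseq p) rproj u = \sum_(a <- vseq) vproj a.
Proof.
rewrite [RHS](eq_bigr (fun a => \sum_(u <- wseq p | wo u == a) rproj u)); last first.
  by move=> a _; exact: vproj_sum.
rewrite (exchange_big_dep predT) //=; apply: eq_bigr => u _.
rewrite big_mkcond (bigD1_seq (wo u)) ?vseqE ?vseq_uniq//= eqxx big1 ?addr0// => a.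
by rewrite eq_sym => /negbTE ->.
Qed.

Hypothesis sgen : generates s.

(** The relations do not mention the unit of [A]; it is reached through generation. The elements on
    which [e] acts as a two-sided unit form a closed self-adjoint subalgebra containing the
    generators, hence contain 1. *)
Lemma vproj_sum1 : \sum_(a <- vseq) vproj a = 1.
Proof.
set e := \sum_(a <- vseq) vproj a.
have el u : e * s u = s u.
  rewrite mulr_suml (bigD1_seq (wo u)) ?vseqE ?vseq_uniq//= s_wo big1 ?addr0//.
  by move=> a ha; rewrite -(s_wo u) mulrA vproj_orth// mul0r.
have er u : s u * e = s u.
  rewrite mulr_sumr (bigD1_seq (wt u)) ?vseqE ?vseq_uniq//= s_wt big1 ?addr0//.
  by move=> a ha; rewrite -(s_wt u) -mulrA vproj_orth 1?eq_sym// mulr0.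
have es : star e = e by rewrite star_sum; apply: eq_bigr => a _; exact: vproj_star.
pose D : set A := [set x | e * x = x /\ x * e = x].
have appr (f : A -> A) : (forall x y, f (x - y) = f x - f y) ->
   (forall x, nrm (f x) <= nrm e * nrm x) ->
   forall x, (forall d : R, 0 < d -> exists2 y, f y = y & nrm (x - y) < d) -> f x = x.
  move=> fB fn x h; apply/eqP; rewrite -subr_eq0; apply/eqP/nrm_eq0/eqP.
  rewrite eq_le nrm_ge0 andbT; apply/ler_addgt0Pr => d d0; rewrite add0r.
  have p1 : 0 < nrm e + 1 by rewrite ltr_wpDl.
  have [y fy xy] := h _ (divr_gt0 d0 p1).
  have -> : f x - x = f (x - y) - (x - y) by rewrite fB fy opprB addrA subrK.
  apply: le_trans (nrmB _ _) _; rewrite ltr_pdivlMr// in xy.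
  by apply: le_trans (ltW xy); have := fn (x - y); lra.
have DT : D = setT.
  apply: sgen.
  - apply: closed_nrm => x h; split.
      apply: (appr (fun x => e * x)) => [a b|a|d d0]; first exact: mulrBr.
        exact: nrmM.
      by have [y [y1 _] xy] := h d d0; exists y.
    apply: (appr (fun x => x * e)) => [a b|a|d d0]; first exact: mulrBl.
      by rewrite mulrC nrmM.
    by have [y [_ y1] xy] := h d d0; exists y.
  - by move=> u; split.
  - move=> c x y [x1 x2] [y1 y2]; split.
      by rewrite mulrDr -scalerAr x1 y1.
    by rewrite mulrDl -scalerAl x2 y2.
  - by move=> x y [x1 x2] [y1 y2]; split; [rewrite mulrA x1|rewrite -mulrA y2].
  - by move=> x [x1 x2]; split; rewrite -{1}es -star_mul ?x1 ?x2.
have : D 1 by rewrite DT.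
by move=> [+ _]; rewrite mulr1.
Qed.

Lemma rproj_sum1 p : \sum_(u <- wseq p) rproj u = 1.
Proof. by rewrite rproj_sum vproj_sum1. Qed.

Lemma rproj_star u : star (rproj u) = rproj u.
Proof. by rewrite star_mul starK. Qed.

Lemma rproj_s u : rproj u * s u = s u.
Proof. by rewrite -mulrA s_star_self s_wt. Qed.

Lemma star_s_rproj u : star (s u) * rproj u = star (s u).
Proof. by rewrite -{1}rproj_star -star_mul rproj_s. Qed.

Lemma rproj_idem u : rproj u * rproj u = rproj u.
Proof. by rewrite {2}/rproj mulrA rproj_s. Qed.

(** The range projections of one shape sum to 1. Compressing this sum by [rproj v] and cancelling
    [rproj v] leaves positive elements with sum 0, so each of them is 0. *)
Lemma s_star_orth u v : shape u = shape v -> u != v -> star (s u) * s v = 0.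
Proof.
move=> uv ne; set p := shape v.
have hv : v \in wseq p by rewrite wseqE.
have hu : u \in wseq p by rewrite wseqE uv.
have h : \sum_(x <- wseq p | x != v) rproj v * rproj x * rproj v = 0.
  have : rproj v * (\sum_(x <- wseq p) rproj x) * rproj v = rproj v.
    by rewrite rproj_sum1 mulr1 rproj_idem.
  rewrite mulr_sumr mulr_suml (bigD1_seq v) ?wseq_uniq//= !rproj_idem.
  by move=> h; apply: (addrI (rproj v)); rewrite addr0.
have pp x : rproj v * rproj x * rproj v = star (rproj x * rproj v) * (rproj x * rproj v).
  by rewrite star_mul !rproj_star -[in RHS]mulrA (mulrA (rproj x) (rproj x)) rproj_idem mulrA.
have z : rproj u * rproj v = 0.
  have e0 : rproj v * rproj u * rproj v = 0.
    apply: pos_antisym; first by rewrite pp; exact: pos_star_mul.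
    have -> : - (rproj v * rproj u * rproj v) =
       \sum_(x <- wseq p | (x != v) && (x != u)) rproj v * rproj x * rproj v.
      move: h; rewrite -big_filter (bigD1_seq u) /=; last 2 first.
      - by rewrite mem_filter ne.
      - by rewrite filter_uniq ?wseq_uniq.
      rewrite big_filter_cond => /eqP; rewrite addrC addr_eq0 => /eqP <-.
      by [].
    by apply: pos_sum => x _; rewrite pp; exact: pos_star_mul.
  by apply/nrm_eq0/eqP; rewrite -sqrf_eq0 -nrm_cstar -pp e0 nrm0.
by rewrite -star_s_rproj -(rproj_s v) -mulrA (mulrA (rproj u)) z mul0r mulr0.
Qed.

Lemma word_split w p q : shape w = p + q ->
  exists u v, [/\ shape u = p, shape v = q, wt u = wo v & w = wmul u v].
Proof. by move=> /factorisation[[u v] [/= [h1 h2 h3 h4] _]]; exists u, v. Qed.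

(** Either [v] is the initial segment of [w] of its shape and is stripped off, or the two segments
    are orthogonal. *)
Lemma s_star_mul_longer v w q : shape w = shape v + q ->
  star (s v) * s w = 0 \/
  exists w', [/\ shape w' = q, wt w' = wt w & star (s v) * s w = s w'].
Proof.
move=> /word_split[w1 [w2 [h1 h2 h3 ->]]]; rewrite s_mul// mulrA.
have [->|ne] := eqVneq v w1.
  right; exists w2; rewrite wt_mul// s_star_self h3 s_wo; split=> //.
by left; rewrite s_star_orth// mul0r.
Qed.

Lemma s_mul_case u v : s u * s v = 0 \/
  exists w, [/\ shape w = shape u + shape v, wt w = wt v & s u * s v = s w].
Proof.
have [h|h] := eqVneq (wt u) (wo v); last by left; exact: s_mul0.
by right; exists (wmul u v); rewrite shape_mul// wt_mul// s_mul.
Qed.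

Lemma size_wseqD p q : (size (wseq (p + q)%R) <= size (wseq p) * size (wseq q))%N.
Proof.
rewrite -(size_allpairs (@wmul r L)); apply: uniq_leq_size; first exact: wseq_uniq.
move=> w; rewrite wseqE => /eqP/word_split[u [v [hu hv _ ->]]].
by apply: allpairs_f; rewrite wseqE ?hu ?hv.
Qed.

(* The span of the [s u * star (s v)] with [u], [v] of shapes [p], [q]; its elements
   have degree [p - q] for the gauge action. *)
Inductive hom (p q : zplus r) : A -> Prop :=
| Hom0 : hom p q 0
| HomS c u v X : shape u = p -> shape v = q -> hom p q X ->
    hom p q (c *: (s u * star (s v)) + X).

Lemma hom_gen u v : hom (shape u) (shape v) (s u * star (s v)).
Proof.
rewrite -[X in hom _ _ X]addr0 -[X in hom _ _ (X + _)]scale1r.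
by apply: HomS => //; exact: Hom0.
Qed.

Lemma homD p q X Y : hom p q X -> hom p q Y -> hom p q (X + Y).
Proof.
by elim=> [|c u v Z hu hv _ ih] hY; [rewrite add0r|rewrite -addrA; apply: HomS => //; exact: ih].
Qed.

Lemma homZ p q c X : hom p q X -> hom p q (c *: X).
Proof.
elim=> [|d u v Z hu hv _ ih]; first by rewrite scaler0; exact: Hom0.
by rewrite scalerDr scalerA; exact: HomS.
Qed.

Lemma hom_sum p q (I : Type) (t : seq I) (P : pred I) (F : I -> A) :
  (forall i, P i -> hom p q (F i)) -> hom p q (\sum_(i <- t | P i) F i).
Proof.
by move=> h; elim/big_rec: _ => [|i x Pi hx]; [exact: Hom0|apply: homD => //; exact: h].
Qed.

(* The compression of a homogeneous element by two long words of matching shapes is a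
   scalar: only the common suffix of the words survives. *)
Lemma hom_compress p p' q X w z : hom p p' X -> shape w = p + q -> shape z = p' + q ->
  exists c : R[i], star (s w) * X * s z = c *: vproj (wt w).
Proof.
move=> hX hw hz; elim: hX => [|c u v Y hu hv _ [d ih]].
  by exists 0; rewrite mulr0 mul0r scale0r.
suff [e he] : exists e : R[i], star (s w) * (s u * star (s v)) * s z = e *: vproj (wt w).
  exists (c * e + d); rewrite mulrDr mulrDl ih -scalerAr -scalerAl he scalerA.
  by rewrite scalerDl.
rewrite -hu in hw; rewrite -hv in hz.
have -> : star (s w) * (s u * star (s v)) * s z = star (star (s u) * s w) * (star (s v) * s z).
  by rewrite star_mul starK !mulrA.
have [->|[w' [hw' tw ->]]] := s_star_mul_longer hw.
  by exists 0; rewrite star0 mul0r scale0r.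
have [->|[z' [hz' tz ->]]] := s_star_mul_longer hz.
  by exists 0; rewrite mulr0 scale0r.
have [wz|wz] := eqVneq w' z'.
  by exists 1; rewrite -wz s_star_self tw scale1r.
by exists 0; rewrite s_star_orth ?hw' ?hz'// scale0r.
Qed.

(** * The canonical shifts *)

Local Notation Phi := (canonical_shift s).

Lemma shiftE l X : Phi l X = \sum_(w <- wseq l) s w * X * star (s w).
Proof. by rewrite /canonical_shift (fsbig_finite _ _ (words_finite l)). Qed.

Lemma shiftD l X Y : Phi l (X + Y) = Phi l X + Phi l Y.
Proof.
rewrite !shiftE -big_split; apply: eq_bigr => w _.
by rewrite mulrDr mulrDl.
Qed.

Lemma shiftZ l c X : Phi l (c *: X) = c *: Phi l X.
Proof.
by rewrite !shiftE scaler_sumr; apply: eq_bigr => w _; rewrite -scalerAr -scalerAl.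
Qed.

Lemma shift1 l : Phi l 1 = 1.
Proof.
rewrite shiftE -[RHS](rproj_sum1 l); apply: eq_bigr => w _; by rewrite mulr1.
Qed.

Lemma shift_pos l X : pos (Phi l (star X * X)).
Proof.
rewrite shiftE; apply: pos_sum => w _.
have -> : s w * (star X * X) * star (s w) = star (X * star (s w)) * (X * star (s w)).
  by rewrite star_mul starK !mulrA.
exact: pos_star_mul.
Qed.

Lemma shift_nrm l X : nrm (Phi l X) <= 2 * nrm X.
Proof.
apply: (@positive_unital_nrm R A A (Phi l)); [exact: shiftD|exact: shiftZ|exact: shift1|].
exact: shift_pos.
Qed.

Lemma hom_shift l p q X : hom p q X -> hom (l + p) (l + q) (Phi l X).
Proof.
elim=> [|c u v Y hu hv _ ih].
  rewrite shiftE big1; first exact: Hom0.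
  by move=> w _; rewrite mulr0 mul0r.
rewrite shiftD shiftZ; apply: homD => //; apply: homZ; rewrite shiftE.
rewrite big_seq; apply: hom_sum => w; rewrite wseqE => /eqP hw.
have -> : s w * (s u * star (s v)) * star (s w) = (s w * s u) * star (s w * s v).
  by rewrite star_mul !mulrA.
have [->|[x [hx _ ->]]] := s_mul_case w u; first by rewrite mul0r; exact: Hom0.
have [->|[y [hy _ ->]]] := s_mul_case w v; first by rewrite star0 mulr0; exact: Hom0.
by rewrite -hw -hu -hv -hx -hy; exact: hom_gen.
Qed.

(** * The dense subalgebra spanned by products of words and adjoints *)

Inductive wspan : A -> Prop :=
| Wspan0 : wspan 0
| WspanS c u v X : wspan X -> wspan (c *: (s u * star (s v)) + X).

Lemma wspanD X Y : wspan X -> wspan Y -> wspan (X + Y).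
Proof.
by elim=> [|c u v Z _ ih] hY; [rewrite add0r|rewrite -addrA; apply: WspanS; exact: ih].
Qed.

Lemma wspanZ c X : wspan X -> wspan (c *: X).
Proof.
elim=> [|d u v Z _ ih]; first by rewrite scaler0; exact: Wspan0.
by rewrite scalerDr scalerA; exact: WspanS.
Qed.

Lemma wspan_gen u v : wspan (s u * star (s v)).
Proof.
rewrite -[X in wspan X]addr0 -[X in wspan (X + _)]scale1r.
apply: WspanS; exact: Wspan0.
Qed.

Lemma wspan_sum (I : Type) (t : seq I) (P : pred I) (F : I -> A) :
  (forall i, P i -> wspan (F i)) -> wspan (\sum_(i <- t | P i) F i).
Proof.
by move=> h; elim/big_rec: _ => [|i x Pi hx]; [exact: Wspan0|apply: wspanD => //; exact: h].
Qed.

Lemma wspan_star X : wspan X -> wspan (star X).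
Proof.
elim=> [|c u v Y _ ih]; first by rewrite star0; exact: Wspan0.
by rewrite starD starZ star_mul starK; exact: WspanS.
Qed.

(** Insert 1 as the sum of the range projections of shape [shape v + shape w]: such words are long
    enough to absorb both [v] and [w]. *)
Lemma wspan_mul_gen u v w z : wspan (s u * star (s v) * (s w * star (s z))).
Proof.
have -> : s u * star (s v) * (s w * star (s z)) =
   \sum_(x <- wseq (shape v + shape w))
     (s u * (star (s v) * s x)) * (star (star (s w) * s x) * star (s z)).
  transitivity (s u * star (s v) * 1 * (s w * star (s z))); first by rewrite mulr1.
  rewrite -(rproj_sum1 (shape v + shape w)) mulr_sumr mulr_suml.
  by apply: eq_bigr => x _; rewrite /rproj star_mul starK !mulrA.
rewrite big_seq; apply: wspan_sum => x; rewrite wseqE => /eqP hx.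
have [->|[x' [_ _ ->]]] := s_star_mul_longer hx.
  by rewrite mulr0 mul0r; exact: Wspan0.
rewrite addrC in hx; have [->|[y' [_ _ ->]]] := s_star_mul_longer hx.
  by rewrite star0 mul0r mulr0; exact: Wspan0.
rewrite -star_mul.
have [->|[a [_ _ ->]]] := s_mul_case u x'; first by rewrite mul0r; exact: Wspan0.
have [->|[b [_ _ ->]]] := s_mul_case z y'; first by rewrite star0 mulr0; exact: Wspan0.
exact: wspan_gen.
Qed.

Lemma wspanM X Y : wspan X -> wspan Y -> wspan (X * Y).
Proof.
elim=> [|c u v Z _ ih] hY; first by rewrite mul0r; exact: Wspan0.
rewrite mulrDl -scalerAl; apply: wspanD; last exact: ih.
apply: wspanZ; elim: hY => [|d w z W _ ih']; first by rewrite mulr0; exact: Wspan0.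
rewrite mulrDr -scalerAr; apply: wspanD => //; apply: wspanZ; exact: wspan_mul_gen.
Qed.

Lemma wspan_dense X (e : R) : 0 < e -> exists2 Y, wspan Y & nrm (X - Y) < e.
Proof.
pose D : set A := [set x | forall e : R, 0 < e -> exists2 Y, wspan Y & nrm (x - Y) < e].
suff /(_ X) DX : forall x, D x by exact: DX.
move=> x0; suff -> : D = setT by [].
apply: sgen.
- apply: closed_nrm => x h d d0.
  have d2 : 0 < d / 2 by lra.
  have [y Dy xy] := h _ d2; have [Y hY yY] := Dy _ d2; exists Y => //.
  by have := nrmD (x - y) (y - Y); rewrite addrA subrK; lra.
- move=> u d d0; exists (s u); last by rewrite subrr nrm0.
  have -> : s u = s u * star (s (wid (wt u))) by rewrite [star _]vproj_star s_wt.
  exact: wspan_gen.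
- move=> c x y Dx Dy d d0.
  have c0 : 0 <= complex.Re `|c| by rewrite normc_def /= sqrtr_ge0.
  have c1 : 0 < complex.Re `|c| + 1 by rewrite ltr_wpDl.
  have d2 : 0 < d / 2 by lra.
  have [x' hx' xx'] := Dx _ (divr_gt0 d2 c1); have [y' hy' yy'] := Dy _ d2.
  exists (c *: x' + y'); first by apply: wspanD => //; exact: wspanZ.
  rewrite opprD addrACA -scalerBr; have := nrmD (c *: (x - x')) (y - y').
  by rewrite ltr_pdivlMr// in xx'; rewrite nrmZ; have := nrm_ge0 (x - x'); nra.
- move=> x y Dx Dy d d0.
  have d2 : 0 < d / 2 by lra.
  have y1 : 0 < nrm y + 1 by rewrite ltr_wpDl.
  have [x' hx' xx'] := Dx _ (divr_gt0 d2 y1).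
  have x1 : 0 < nrm x' + 1 by rewrite ltr_wpDl.
  have [y' hy' yy'] := Dy _ (divr_gt0 d2 x1).
  exists (x' * y'); first exact: wspanM.
  have -> : x * y - x' * y' = (x - x') * y + x' * (y - y').
    by rewrite mulrBl mulrBr addrA subrK.
  rewrite ltr_pdivlMr// in xx'; rewrite ltr_pdivlMr// in yy'.
  have := nrmD ((x - x') * y) (x' * (y - y')).
  have := nrmM (x - x') y; have := nrmM x' (y - y').
  by have := nrm_ge0 (x - x'); have := nrm_ge0 (y - y'); lra.
- move=> x Dx d d0; have [Y hY xY] := Dx _ d0; exists (star Y); first exact: wspan_star.
  by rewrite -starB nrm_star.
Qed.

(** * Gauge automorphisms and functionals vanishing on nonzero degrees *)

Section Gauge.
Variable z : 'I_r -> R[i].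
Hypothesis zz : forall i, z i * Num.conj (z i) = 1.

Definition zpow p : R[i] := \prod_i z i ^+ p i.

Lemma zpowD p q : zpow (p + q) = zpow p * zpow q.
Proof.
by rewrite /zpow -big_split; apply: eq_bigr => i _; rewrite zaddE exprD.
Qed.

Lemma zpow0 : zpow 0 = 1.
Proof. by rewrite /zpow big1// => i _; rewrite ffunE expr0. Qed.

Lemma zpow_unit p : zpow p * Num.conj (zpow p) = 1.
Proof.
rewrite rmorph_prod -big_split big1// => i _.
by rewrite /= rmorphXn -exprMn zz expr1n.
Qed.

Lemma gauge_family : graph_family (fun u => zpow (shape u) *: s u).
Proof.
have id a : zpow (shape (wid a)) *: s (wid a) = s (wid a).
  by rewrite shape_id zpow0 scale1r.
split.
- split=> [a|a b ab]; rewrite !id.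
    by rewrite [star _]vproj_star [_ * _]vproj_idem.
  by apply: vproj_orth; apply/eqP.
- move=> u v uv; by rewrite s_mul// shape_mul// zpowD -scalerAl -scalerAr scalerA.
- move=> u; rewrite id starZ -scalerAl -scalerAr scalerA mulrC zpow_unit scale1r.
  exact: s_star_self.
- move=> a n; rewrite id; have [_ _ _ /(_ a n) ->] := sfam.
  apply: eq_fsbigr => u _.
  by rewrite starZ -scalerAl -scalerAr scalerA zpow_unit scale1r.
Qed.

End Gauge.

Hypothesis suniv : forall (B : cstarType R) (S : word L -> B), graph_family S ->
  exists f : {linear A -> B}, star_hom f /\ (forall u, f (s u) = S u).

Definition unimodular (z : 'I_r -> R[i]) := forall i, z i * Num.conj (z i) = 1.

(** Universality applied to the rescaled family gives [g]. The premise on [z] sits under the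
    existential so that [choice] turns [g] into a function of all [z]. *)
Lemma gauge_aut (z : 'I_r -> R[i]) : exists g : A -> A, unimodular z ->
  [/\ forall x y, g (x + y) = g x + g y, forall (c : R[i]) x, g (c *: x) = c *: g x,
      forall x y, g (x * y) = g x * g y, forall x, g (star x) = star (g x) &
      forall p q X, hom p q X -> g X = (zpow z p * Num.conj (zpow z q)) *: X].
Proof.
have [zz|nz] := pselect (unimodular z); last by exists id.
have [f [[fM fS] fs]] := suniv (gauge_family zz).
exists f => _; split => //.
- exact: linearD.
- by move=> c x; rewrite linearZ.
- move=> p q X; elim=> [|c u v Y hu hv _ ih]; first by rewrite linear0 scaler0.
  rewrite linearD linearZ fM fS !fs ih scalerDr !scalerA; congr (_ + _).
  by rewrite /= starZ -scalerAl -scalerAr !scalerA hu hv -[in LHS]mulrA mulrC.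
Qed.

(** No value at 1 is prescribed: the functionals used are normalised at each vertex projection
    instead. *)
Record is_state (om : A -> R[i]) : Prop := IsState {
  stateD : forall x y, om (x + y) = om x + om y;
  stateZ : forall (c : R[i]) x, om (c *: x) = c * om x;
  state_star : forall x, om (star x) = Num.conj (om x);
  state_pos : forall x, 0 <= om (star x * x) }.

Lemma is_state_sum (I : Type) (t : seq I) (F : I -> A -> R[i]) :
  (forall i, is_state (F i)) -> is_state (fun x => \sum_(i <- t) F i x).
Proof.
move=> h; split.
- by move=> x y; rewrite -big_split; apply: eq_bigr => i _; rewrite (stateD (h i)).
- by move=> c x; rewrite mulr_sumr; apply: eq_bigr => i _; rewrite (stateZ (h i)).
- by move=> x; rewrite rmorph_sum; apply: eq_bigr => i _; rewrite (state_star (h i)).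
- by move=> x; apply: sumr_ge0 => i _; exact: state_pos (h i) x.
Qed.

Lemma is_stateZ (om : A -> R[i]) (c : R[i]) : 0 <= c -> is_state om ->
  is_state (fun x => c * om x).
Proof.
move=> c0 h; split.
- by move=> x y; rewrite (stateD h) mulrDr.
- by move=> d x; rewrite (stateZ h) mulrCA.
- move=> x; rewrite (state_star h) rmorphM; congr (_ * _).
  by apply/esym/CrealP/ger0_real.
- by move=> x; apply: mulr_ge0 => //; exact: state_pos h x.
Qed.

(** Each vertex receives its own positive functional, compressed to the corner of that vertex and
    normalised there. Orthogonality of the corners keeps the summands from interfering. *)
Lemma diagonal_state : exists om, is_state om /\
  forall a, vproj a != 0 -> om (vproj a) = 1.
Proof.
have /choice[F hF] : forall a, exists om, is_state om /\ (vproj a != 0 -> 0 < om (vproj a)).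
  move=> a; have [->|a0] := eqVneq (vproj a) 0.
    exists (fun=> 0); split=> //; split=> *; by rewrite ?addr0 ?mulr0 ?rmorph0.
  have [om [h1 h2 h3 h4 h5]] := positive_functional (vproj_star a) (vproj_idem a) a0.
  by exists om; split.
(* If [vproj a = 0] the factor is the inverse of 0, which is 0, and [G a] is the zero functional. *)
pose G a x := (F a (vproj a))^-1 * F a (vproj a * x * vproj a).
have Fp a : 0 <= F a (vproj a).
  by rewrite -vproj_idem -{1}vproj_star; have [h _] := hF a; exact: state_pos h _.
have hG a : is_state (G a).
  apply: is_stateZ; first by rewrite invr_ge0.
  have [h _] := hF a; split.
  - by move=> x y; rewrite mulrDr mulrDl (stateD h).
  - by move=> c x; rewrite -scalerAr -scalerAl (stateZ h).
  - by move=> x; rewrite -(state_star h) !star_mul vproj_star mulrA.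
  - move=> x; have -> : vproj a * (star x * x) * vproj a = star (x * vproj a) * (x * vproj a).
      by rewrite star_mul vproj_star !mulrA.
    exact: state_pos h _.
exists (fun x => \sum_(a <- vseq) G a x); split; first exact: is_state_sum.
move=> a a0; rewrite (bigD1_seq a) ?vseqE ?vseq_uniq//= big1 ?addr0 => [|b ba].
  by rewrite /G !vproj_idem mulVf// gt_eqF//; have [_ h] := hF a; exact: h.
have [h _] := hF b.
by rewrite /G (vproj_orth ba) mul0r -(scale0r (0 : A)) (stateZ h) mul0r mulr0.
Qed.

Lemma hom_vproj a : hom 0 0 (vproj a).
Proof.
have := hom_gen (wid a) (wid a).
by rewrite !shape_id [star _]vproj_star [_ * _]vproj_idem.
Qed.

(* Averaging over the [Q]-th roots of unity kills only the degrees that are nonzero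
   modulo [Q], which is enough for finitely many degrees and avoids integration
   over the torus. *)
Lemma gauge_state (Q : nat) : (0 < Q)%N -> exists om, [/\ is_state om,
  forall a, vproj a != 0 -> om (vproj a) = 1 &
  forall p q X, hom p q X ->
    (exists i, [/\ p i <> q i, (p i < q i + Q)%N & (q i < p i + Q)%N]) -> om X = 0].
Proof.
move=> Q0; have [zeta hz] := closed_prim_root R[i] Q0.
have zz : zeta * Num.conj zeta = 1.
  rewrite -normCK; have : `|zeta| ^+ Q = 1 by rewrite -normrX (prim_expr_order hz) normr1.
  by move/eqP; rewrite pexpr_eq1// => /eqP ->; rewrite expr1n.
have [om1 [h1 d1]] := diagonal_state.
have /choice[g hg] := gauge_aut.
pose zk (k : {ffun 'I_r -> 'I_Q}) i := zeta ^+ k i.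
have zkz k : unimodular (zk k) by move=> i; rewrite rmorphXn -exprMn zz expr1n.
pose N : R[i] := #|{ffun 'I_r -> 'I_Q}|%:R.
have N0 : N != 0.
  by rewrite pnatr_eq0 card_ffun !card_ord expn_eq0 negb_and -lt0n Q0.
have hom_om p q X : hom p q X -> N^-1 * \sum_(k : {ffun 'I_r -> 'I_Q}) om1 (g (zk k) X) =
    N^-1 * (\sum_(k : {ffun 'I_r -> 'I_Q}) zpow (zk k) p * Num.conj (zpow (zk k) q)) * om1 X.
  move=> hX; rewrite -mulrA mulr_suml; congr (_ * _); apply: eq_bigr => k _.
  have [_ _ _ _ gh] := hg (zk k) (zkz k).
  by rewrite (gh _ _ _ hX) (stateZ h1).
exists (fun x => N^-1 * \sum_(k : {ffun 'I_r -> 'I_Q}) om1 (g (zk k) x)); split.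
- apply: is_stateZ; first by rewrite invr_ge0 ler0n.
  apply: is_state_sum => k; have [gD gZ gM gS _] := hg (zk k) (zkz k); split.
  + by move=> x y; rewrite gD (stateD h1).
  + by move=> c x; rewrite gZ (stateZ h1).
  + by move=> x; rewrite gS (state_star h1).
  + by move=> x; rewrite gM gS; exact: state_pos h1 _.
- move=> a a0; rewrite (hom_om _ _ _ (hom_vproj a)) d1// mulr1.
  rewrite (eq_bigr (fun=> 1)) => [|k _]; last by rewrite !zpow0 rmorph1 mulr1.
  by rewrite sumr_const mulVf.
- move=> p q X hX [i [ne pq qp]]; rewrite (hom_om _ _ _ hX).
  rewrite (eq_bigr (fun k : {ffun 'I_r -> 'I_Q} =>
     \prod_j ((zeta ^+ k j) ^+ p j * Num.conj ((zeta ^+ k j) ^+ q j)))); last first.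
    by move=> k _; rewrite big_split /= rmorph_prod.
  rewrite -(bigA_distr_bigA (fun j (t : 'I_Q) =>
     (zeta ^+ t) ^+ p j * Num.conj ((zeta ^+ t) ^+ q j))) /=.
  by rewrite (bigD1 i)//= sum_character// mul0r mulr0 mul0r.
Qed.

(** The insertion of [wspan_mul_gen] again, now recording shapes: stripping [w] from a word of shape
    [shape w + shape z] leaves shape [shape z], and conversely. *)
Lemma star_s_mul_hom w z : hom (shape z) (shape w) (star (s w) * s z).
Proof.
have -> : star (s w) * s z = \sum_(x <- wseq (shape w + shape z))
     (star (s w) * s x) * star (star (s z) * s x).
  transitivity (star (s w) * 1 * s z); first by rewrite mulr1.
  rewrite -(rproj_sum1 (shape w + shape z)) mulr_sumr mulr_suml.
  by apply: eq_bigr => x _; rewrite /rproj star_mul starK !mulrA.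
rewrite big_seq; apply: hom_sum => x; rewrite wseqE => /eqP hx.
have [->|[x' [h1 _ ->]]] := s_star_mul_longer hx; first by rewrite mul0r; exact: Hom0.
rewrite addrC in hx.
have [->|[y' [h2 _ ->]]] := s_star_mul_longer hx; first by rewrite star0 mulr0; exact: Hom0.
by rewrite -h1 -h2; exact: hom_gen.
Qed.

Lemma hom_conj p p' q q' X w z : hom p p' X -> shape w = p + q -> shape z = p' + q' ->
  hom q' q (star (s w) * X * s z).
Proof.
move=> hX hw hz; elim: hX => [|c u v Y hu hv _ ih].
  by rewrite mulr0 mul0r; exact: Hom0.
rewrite mulrDr mulrDl; apply: homD => //; rewrite -scalerAr -scalerAl; apply: homZ.
rewrite -hu in hw; rewrite -hv in hz.
have -> : star (s w) * (s u * star (s v)) * s z = star (star (s u) * s w) * (star (s v) * s z).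
  by rewrite star_mul starK !mulrA.
have [->|[w' [<- _ ->]]] := s_star_mul_longer hw; first by rewrite star0 mul0r; exact: Hom0.
have [->|[z' [<- _ ->]]] := s_star_mul_longer hz; first by rewrite mulr0; exact: Hom0.
exact: star_s_mul_hom.
Qed.

Lemma zaddI p : injective (fun q : zplus r => p + q).
Proof.
move=> q q' /ffunP e; apply/ffunP => i; have /eqP := e i.
by rewrite !zaddE eqn_add2l => /eqP.
Qed.

Lemma zsubE p q i : zsub p q i = (p i - q i)%N.
Proof. exact: ffunE. Qed.

(** * The approximation through matrices attached to a box of shapes *)

Section Window.
Variables (K : nat) (m : zplus r).
Local Notation G := {ffun 'I_r -> 'I_K}.

Definition emb (g : G) : zplus r := [ffun i => val (g i)].

Lemma embE g i : emb g i = g i.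
Proof. by rewrite ffunE. Qed.

Lemma emb_inj : injective emb.
Proof.
by move=> g h /ffunP e; apply/ffunP => i; apply: val_inj; have := e i; rewrite !embE.
Qed.

(* Words ending at a vertex with [vproj a = 0] are dropped: they contribute nothing
   and would prevent the compression from being unital. *)
Definition window : seq (word L) :=
  [seq w <- flatten [seq wseq (m + emb g) | g <- enum {: G}] | vproj (wt w) != 0].

Lemma window_uniq : uniq window.
Proof.
apply: filter_uniq; elim: (enum {: G}) (enum_uniq {: G}) => //= g gs ih /andP[gn gu].
rewrite cat_uniq wseq_uniq ih// andbT; apply/hasPn => w /flatten_mapP[h hgs].
rewrite !wseqE => /eqP ->; by apply: contra gn => /eqP/zaddI/emb_inj <-.
Qed.

Lemma window_mem w : w \in window ->
  (exists g, shape w = m + emb g) /\ vproj (wt w) != 0.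
Proof.
rewrite mem_filter => /andP[h /flatten_mapP[g _]]; rewrite wseqE => /eqP hw.
by split=> //; exists g.
Qed.

Lemma window_sum (F : word L -> A) : (forall w, vproj (wt w) = 0 -> F w = 0) ->
  \sum_(w <- window) F w = \sum_(g : G) \sum_(w <- wseq (m + emb g)) F w.
Proof.
move=> F0; rewrite big_filter big_mkcond big_flatten big_map big_enum /=.
by apply: eq_bigr => g _; apply: eq_bigr => w _; case: eqP => // /F0.
Qed.

Lemma s_eq0 w : vproj (wt w) = 0 -> s w = 0.
Proof. by move=> h; rewrite -s_wt h mulr0. Qed.

Lemma window_rproj : \sum_(w <- window) rproj w = (K%:R ^+ r)%:C *: 1.
Proof.
rewrite window_sum => [|w /s_eq0]; last by rewrite /rproj => ->; rewrite mul0r.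
under eq_bigr => g _ do rewrite rproj_sum1.
rewrite sumr_const card_ffun !card_ord -[LHS]scaler_nat.
by rewrite -natrX rmorph_nat.
Qed.

Lemma window_size : (size window <= \sum_(g : G) size (wseq (m + emb g)%R))%N.
Proof.
rewrite size_filter; apply: leq_trans (count_size _ _) _.
by rewrite size_flatten /seq.shape -map_comp sumnE big_map big_enum.
Qed.

(** The condition [g - h = p - p'] on pairs of box points, written without subtraction. *)
Definition matching (p p' : zplus r) : {set G * G} :=
  [set gh | emb gh.1 + p' == emb gh.2 + p].

(** The first point of a matching pair determines the second. *)
Lemma matching_le p p' : (#|matching p p'| <= K ^ r)%N.
Proof.
have -> : (K ^ r)%N = #|{: G}| by rewrite card_ffun !card_ord.
rewrite -(@card_in_imset _ _ fst (mem (matching p p'))); first exact: max_card.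
move=> [g h] [g' h']; rewrite !inE /= => /eqP e /eqP e' gg; congr pair => //.
rewrite -gg in e'; rewrite e' in e; apply: emb_inj.
apply/ffunP => i; have /ffunP/(_ i) := e; rewrite !zaddE => /eqP.
by rewrite eqn_add2r => /eqP ->.
Qed.

(* The pairs [(j + p, j + p')] are matching. *)
Lemma matching_ge p p' (D : nat) : (forall i, p i <= D)%N -> (forall i, p' i <= D)%N ->
  ((K - D) ^ r <= #|matching p p'|)%N.
Proof.
move=> hp hp'.
have lt (q : zplus r) (hq : forall i, (q i <= D)%N) (j : {ffun 'I_r -> 'I_(K - D)}) i :
    (j i + q i < K)%N.
  have := ltn_ord (j i); rewrite ltn_subRL addnC; apply: leq_ltn_trans.
  by rewrite leq_add2l.
pose f j : G * G := ([ffun i => Ordinal (lt p hp j i)], [ffun i => Ordinal (lt p' hp' j i)]).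
have -> : ((K - D) ^ r)%N = #|{ffun 'I_r -> 'I_(K - D)}| by rewrite card_ffun !card_ord.
have fi : injective f.
  move=> j j' [/ffunP e _]; apply/ffunP => i; apply: val_inj.
  have := congr1 val (e i); rewrite !ffunE /= => /eqP.
  by rewrite eqn_add2r => /eqP.
rewrite -cardsT -(card_imset _ fi); apply/subset_leq_card/fintype.subsetP => _ /imsetP[j _ ->].
rewrite inE /f /=; apply/eqP/ffunP => i; rewrite !zaddE !embE !ffunE /=.
by rewrite -!addnA (addnC (p i)).
Qed.

Variables (Q : nat) (om : A -> R[i]).
Hypothesis K0 : (0 < K)%N.
Hypothesis KQ : (K <= Q)%N.
Hypothesis ost : is_state om.
Hypothesis ov : forall a, vproj a != 0 -> om (vproj a) = 1.
Hypothesis ok : forall p q X, hom p q X ->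
    (exists i, [/\ p i <> q i, (p i < q i + Q)%N & (q i < p i + Q)%N]) -> om X = 0.

(** Words of equal shape are orthogonal already in [A]. For different shapes some coordinate of the
    degree is nonzero and below [K <= Q] in absolute value, so [om] vanishes. *)
Lemma window_orth w z : w \in window -> z \in window ->
  om (star (s w) * s z) = (w == z)%:R.
Proof.
move=> /window_mem[[g hg] wn] /window_mem[[h hh] zn].
have [<-|wz] := eqVneq w z; first by rewrite s_star_self ov.
have [gh|gh] := eqVneq g h.
  by rewrite s_star_orth ?hg ?gh ?hh// -(scale0r (0 : A)) (stateZ ost) mul0r.
apply: ok (star_s_mul_hom w z) _.
have /existsP[i hi] : [exists i, g i != h i].
  rewrite -negb_forall; apply: contra gh => /forallP e.
  by apply/eqP/ffunP => i; exact/eqP.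
exists i; rewrite hg hh !zaddE !embE; split.
- by move/eqP; rewrite eqn_add2l eq_sym; exact/negP.
- by rewrite -addnA ltn_add2l; apply: leq_trans (ltn_ord _) _; apply: leq_trans KQ (leq_addl _ _).
- by rewrite -addnA ltn_add2l; apply: leq_trans (ltn_ord _) _; apply: leq_trans KQ (leq_addl _ _).
Qed.

(** If the shapes match, the compression is [c] times the projection at the end of [w], so [om]
    returns [c], and [c] times [s w * star (s z)] is [rproj w * X * rproj z]. Otherwise the degree
    is nonzero; box points contribute less than [K] to it and [X] at most [Q - K], so it is not a
    multiple of [Q]. *)
Lemma window_term p p' X g h w z : hom p p' X -> zle p m -> zle p' m ->
  (forall i, (p i + K <= p' i + Q)%N) -> (forall i, (p' i + K <= p i + Q)%N) ->
  shape w = m + emb g -> shape z = m + emb h ->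
  om (star (s w) * X * s z) *: (s w * star (s z)) =
  if (g, h) \in matching p p' then rproj w * X * rproj z else 0.
Proof.
move=> hX pm pm' pq pq' hw hz.
have [w0|wn] := eqVneq (vproj (wt w)) 0.
  by rewrite /rproj (s_eq0 w0) !mul0r scaler0 if_same.
have hw' : shape w = p + (zsub m p + emb g).
  by rewrite hw; apply/ffunP => i; rewrite !zaddE zsubE addnA subnKC.
have hz' : shape z = p' + (zsub m p' + emb h).
  by rewrite hz; apply/ffunP => i; rewrite !zaddE zsubE addnA subnKC.
case: ifPn; rewrite inE /= => gh.
  have e : shape z = p' + (zsub m p + emb g).
    rewrite hz'; congr (_ + _); apply/ffunP => i; have /eqP/ffunP/(_ i) := gh.
    rewrite !zaddE !zsubE => e; have := pm i; have := pm' i; lia.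
  have [c ec] := hom_compress hX hw' e.
  rewrite ec (stateZ ost) ov// mulr1.
  have -> : rproj w * X * rproj z = s w * (star (s w) * X * s z) * star (s z).
    by rewrite /rproj !mulrA.
  by rewrite ec -scalerAr -scalerAl s_wt.
rewrite (ok (hom_conj hX hw' hz')) ?scale0r//.
have /existsP[i hi] : [exists i, (emb g i + p' i != emb h i + p i)%N].
  rewrite -negb_forall; apply: contra gh => /forallP e.
  by apply/eqP/ffunP => i; rewrite !zaddE; exact/eqP.
exists i; rewrite !zaddE !zsubE !embE; rewrite !embE in hi.
have := pm i; have := pm' i; have := ltn_ord (g i); have := ltn_ord (h i).
have := pq i; have := pq' i; move/eqP: hi => hi.
move=> h1 h2 h3 h4 h5 h6; split; lia.
Qed.

(** For a matching pair of shapes the range projections on either side of [X] sum to 1, so each such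
    pair contributes exactly [X]. *)
Lemma window_reconstruct p p' X : hom p p' X -> zle p m -> zle p' m ->
  (forall i, (p i + K <= p' i + Q)%N) -> (forall i, (p' i + K <= p i + Q)%N) ->
  \sum_(w <- window) \sum_(z <- window) om (star (s w) * X * s z) *: (s w * star (s z)) =
  #|matching p p'|%:R *: X.
Proof.
move=> hX pm pm' pq pq'.
transitivity (\sum_(g : G) \sum_(h : G) (if (g, h) \in matching p p' then X else 0)).
  rewrite window_sum; last first.
    by move=> w /s_eq0 ->; rewrite big1// => z _; rewrite mul0r scaler0.
  apply: eq_bigr => g _.
  transitivity (\sum_(w <- wseq (m + emb g)) \sum_(h : G) \sum_(z <- wseq (m + emb h))
      om (star (s w) * X * s z) *: (s w * star (s z))).
    apply: eq_bigr => w _; rewrite window_sum// => z /s_eq0 ->.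
    by rewrite star0 !mulr0 scaler0.
  rewrite exchange_big; apply: eq_bigr => h _.
  transitivity (\sum_(w <- wseq (m + emb g)) \sum_(z <- wseq (m + emb h))
     (if (g, h) \in matching p p' then rproj w * X * rproj z else 0)).
    rewrite big_seq [RHS]big_seq; apply: eq_bigr => w; rewrite wseqE => /eqP hw.
    rewrite big_seq [RHS]big_seq; apply: eq_bigr => z; rewrite wseqE => /eqP hz.
    exact: window_term.
  case: ifP => _; last by rewrite big1// => w _; rewrite big1.
  under eq_bigr => w _ do rewrite -mulr_sumr rproj_sum1 mulr1.
  by rewrite -mulr_suml rproj_sum1 mul1r.
rewrite pair_big /= -big_mkcond /= sumr_const scaler_nat; congr (_ *+ _).
by apply: eq_card => -[g h].
Qed.

Lemma window_approx : exists C : finCstarType R, has_rank C (size window) /\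
  exists (phi : {linear C -> A}) (psi : {linear A -> C}),
  [/\ ucp phi, ucp psi &
   forall p p' X, hom p p' X -> zle p m -> zle p' m ->
   (forall i, (p i + K <= p' i + Q)%N) -> (forall i, (p' i + K <= p i + Q)%N) ->
   phi (psi X) = (#|matching p p'|%:R / K%:R ^+ r)%:C *: X].
Proof.
have Kr : 0 < K%:R ^+ r :> R by rewrite exprn_gt0// ltr0n.
(* An empty window would give [K ^ r] times 1 equal to 0. Nonemptiness provides the matrix size
   [n.+1]. *)
case E : window => [|w0 t].
  have := window_rproj; rewrite E big_nil => /esym/eqP.
  rewrite scaler_eq0 oner_eq0 orbF => /eqP[] h.
  by move: Kr; rewrite h ltxx.
set n := size t; have sz : size window = n.+1 by rewrite E.
pose T (i : 'I_n.+1) : A := s (nth w0 window i).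
have bigT (F : word L -> A) :
    \sum_(i < n.+1) F (nth w0 window i) = \sum_(w <- window) F w.
  by rewrite (big_nth w0) big_mkord sz.
have wi (i : 'I_n.+1) : nth w0 window i \in window by rewrite mem_nth// sz.
exists (cmx (cplx R) n : finCstarType R); split; first exact: cmx_has_rank.
exists (synth T (K%:R ^+ r)), (anal T om); split.
- apply: synth_ucp => //; rewrite -window_rproj -bigT; exact: eq_bigr.
- apply: anal_ucp.
  + exact: stateD ost.
  + exact: stateZ ost.
  + exact: state_star ost.
  + exact: state_pos ost.
  + move=> i j; rewrite /T window_orth// nth_uniq ?sz//; exact: window_uniq.
- move=> p p' X hX pm pm' pq pq'.
  have := window_reconstruct hX pm pm' pq pq'.
  rewrite -bigT => e; rewrite /= /synth mulrC rmorphM -scalerA rmorph_nat -e.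
  congr (_ *: _); apply: eq_bigr => i _; rewrite -bigT; apply: eq_bigr => j _.
  by rewrite /cent mxE.
Unshelve.
- exact: stateD ost.
- exact: stateZ ost.
Qed.

End Window.

(** * Estimates uniform in the shift, and growth of the rank *)

Lemma zle_zbar_add l n D : zle l (zbar r n) -> forall i, (l i + D <= zbar r (n + D) i)%N.
Proof. by move=> h i; have := h i; rewrite !ffunE leq_add2r. Qed.

(** What the estimates retain of the composite [phi psi]. The bound 2 is that of
    [positive_unital_nrm]. *)
Definition reconstructs (K Q : nat) m (T : A -> A) : Prop :=
  [/\ forall X Y, T (X + Y) = T X + T Y, forall (c : R[i]) X, T (c *: X) = c *: T X,
      forall X, nrm (T X) <= 2 * nrm X &
      forall p p' X, hom p p' X -> zle p m -> zle p' m ->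
   (forall i, (p i + K <= p' i + Q)%N) -> (forall i, (p' i + K <= p i + Q)%N) ->
   T X = (#|matching K p p'|%:R / K%:R ^+ r)%:C *: X].

(** The order of quantifiers matters: [K0] and [D] are fixed before [l], so a single box serves
    every shift in orbits of all lengths. *)
Definition good X : Prop := forall e : R, 0 < e -> exists K0 D : nat,
  forall (K Q : nat) m T l, (K0 < K)%N -> (K + D <= Q)%N -> (forall i, (l i + D <= m i)%N) ->
    reconstructs K Q m T -> nrm (T (Phi l X) - Phi l X) < e.

Lemma bernoulli_sub (x : R) (n : nat) : 0 <= x <= 1 -> 1 - n%:R * x <= (1 - x) ^+ n.
Proof.
move=> /andP[x0 x1]; elim: n => [|n ih]; first by rewrite mul0r subr0 expr0.
rewrite exprS -natr1; have : 0 <= 1 - x by rewrite subr_ge0.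
move=> h; have := ler_wpM2l h ih; apply: le_trans.
have : 0 <= n%:R * (x * x) by rewrite !mulr_ge0.
lra.
Qed.

(** The ratio lies between the [r]-th power of [1 - D / K] and 1; Bernoulli's inequality makes the
    deviation linear in [1 / K]. *)
Lemma matching_ratio p p' (K D : nat) : (D <= K)%N -> (0 < K)%N ->
  (forall i, p i <= D)%N -> (forall i, p' i <= D)%N ->
  `|#|matching K p p'|%:R / K%:R ^+ r - 1| <= r%:R * (D%:R / K%:R) :> R.
Proof.
move=> DK K0 hp hp'.
have Kp : 0 < K%:R :> R by rewrite ltr0n.
have Kr : 0 < K%:R ^+ r :> R by rewrite exprn_gt0.
have le1 : #|matching K p p'|%:R / K%:R ^+ r <= 1 :> R.
  by rewrite ler_pdivrMr// mul1r -natrX ler_nat matching_le.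
rewrite distrC ger0_norm ?subr_ge0//.
have : 1 - r%:R * (D%:R / K%:R) <= (1 - D%:R / K%:R) ^+ r :> R.
  by apply: bernoulli_sub; rewrite divr_ge0//= ler_pdivrMr// mul1r ler_nat.
have -> : (1 - D%:R / K%:R) ^+ r = ((K - D) ^ r)%:R / K%:R ^+ r :> R.
  by rewrite natrX -expr_div_n natrB// mulrBl divff ?gt_eqF.
have : ((K - D) ^ r)%:R / K%:R ^+ r <= #|matching K p p'|%:R / K%:R ^+ r :> R.
  by rewrite ler_pM2r ?invr_gt0// ler_nat; exact: matching_ge.
lra.
Qed.

Lemma matching_shift K l p p' : matching K (l + p) (l + p') = matching K p p'.
Proof.
apply/setP => gh; rewrite !inE; apply/eqP/eqP => [e|e].
  by apply: (@zaddI l); rewrite addrCA e addrCA.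
by rewrite addrCA e addrCA.
Qed.

Lemma exists_shape_bound p : exists D : nat, forall i, (p i <= D)%N.
Proof. by exists (\max_i p i)%N => i; exact: leq_bigmax. Qed.

Lemma good_wspan X : wspan X -> good X.
Proof.
elim=> [|c u v Y _ ih] e e0.
  exists 0%N, 0%N => K Q m T l _ _ _ [TD TZ _ _].
  have T0 : T 0 = 0 by have := TZ 0 0; rewrite !scale0r.
  have -> : Phi l 0 = 0 by have := shiftZ l 0 0; rewrite !scale0r.
  by rewrite T0 subrr nrm0.
have e2 : 0 < e / 2 by lra.
have [K1 [D1 h1]] := ih _ e2.
have [Du hu] := exists_shape_bound (shape u).
have [Dv hv] := exists_shape_bound (shape v).
pose D0 := maxn Du Dv.
have hu' i : (shape u i <= D0)%N by rewrite leq_max hu.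
have hv' i : (shape v i <= D0)%N by rewrite leq_max hv orbT.
(* [b / K] bounds the error on the new term: [r D0 / K] from [matching_ratio], times the bound
   [2 nrm] of [shift_nrm]. Beyond [K2] this is less than [e / 2]. *)
pose b : R := r%:R * D0%:R * (2 * nrm (c *: (s u * star (s v)))).
have b0 : 0 <= b by rewrite !mulr_ge0.
pose K2 := Num.bound (b / (e / 2)).
exists (maxn (maxn K1 K2) D0), (maxn D1 D0) => K Q m T l.
rewrite 2!gtn_max => /andP[/andP[K1K K2K] D0K] KQ lm hT.
have {}h1 : nrm (T (Phi l Y) - Phi l Y) < e / 2.
  apply: (h1 K Q m) hT => //.
    by apply: leq_trans KQ; rewrite leq_add2l leq_maxl.
  by move=> i; apply: leq_trans (lm i); rewrite leq_add2l leq_maxl.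
have lmD0 i : (l i + D0 <= m i)%N.
  by apply: leq_trans (lm i); rewrite leq_add2l leq_maxr.
have KQ0 : (K + D0 <= Q)%N by apply: leq_trans KQ; rewrite leq_add2l leq_maxr.
set x := c *: (s u * star (s v)) in b b0 K2 K2K *.
have hx : hom (l + shape u) (l + shape v) (Phi l x).
  by apply: hom_shift; apply: homZ; exact: hom_gen.
have [TD TZ _ Th] := hT.
have K0 : (0 < K)%N by apply: leq_ltn_trans D0K.
have Kp : 0 < K%:R :> R by rewrite ltr0n.
have h2 : nrm (T (Phi l x) - Phi l x) < e / 2.
  rewrite (Th _ _ _ hx) => [||||i].
  - have sB (k : R) y : k%:C *: y - y = (k - 1)%:C *: y.
      by rewrite rmorphB scalerBl rmorph1 scale1r.
    rewrite matching_shift sB nrmZr.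
    apply: (@le_lt_trans _ _ (b / K%:R)).
      have := matching_ratio (ltnW D0K) K0 hu' hv'.
      move=> h; apply: le_trans (ler_pM _ _ h (shift_nrm l x)) _ => //.
      by rewrite /b mulrA mulrAC.
    rewrite ltr_pdivrMr// mulrC -ltr_pdivrMr//.
    apply: lt_le_trans (archi_boundP _) _; first by rewrite divr_ge0// ltW.
    by rewrite ler_nat ltnW.
  - by move=> i; rewrite zaddE; apply: leq_trans (lmD0 i); rewrite leq_add2l.
  - by move=> i; rewrite zaddE; apply: leq_trans (lmD0 i); rewrite leq_add2l.
  - move=> i; rewrite !zaddE; have := hu' i; have := KQ0; lia.
  - by rewrite !zaddE; have := hv' i; have := KQ0; lia.
rewrite shiftD TD opprD addrACA.
by have := nrmD (T (Phi l x) - Phi l x) (T (Phi l Y) - Phi l Y); lra.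
Qed.

Lemma good_all X : good X.
Proof.
(* [T] after the shift multiplies norms by at most 4 and the shift by at most 2, so replacing [X] by
   [Y] costs at most 6 times [e / 12]. *)
move=> e e0; have e12 : 0 < e / 12 by lra.
have [Y hY XY] := wspan_dense X e12.
have e2 : 0 < e / 2 by lra.
have [K0 [D h]] := good_wspan hY e2.
exists K0, D => K Q m T l hK hQ hm hT; have {}h := h _ _ _ _ _ hK hQ hm hT.
have [TD TZ Tn _] := hT.
have -> : X = (X - Y) + Y by rewrite subrK.
rewrite shiftD TD opprD addrACA.
have := nrmD (T (Phi l (X - Y)) - Phi l (X - Y)) (T (Phi l Y) - Phi l Y).
have := nrmB (T (Phi l (X - Y))) (Phi l (X - Y)).
have := Tn (Phi l (X - Y)); have := shift_nrm l (X - Y); lra.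
Qed.

Lemma good_finite (S : seq A) (e : R) : 0 < e -> exists K0 D : nat,
  forall (K Q : nat) m T l, (K0 < K)%N -> (K + D <= Q)%N -> (forall i, (l i + D <= m i)%N) ->
    reconstructs K Q m T -> forall X, X \in S -> nrm (T (Phi l X) - Phi l X) < e.
Proof.
move=> e0; elim: S => [|Y S [K1 [D1 h1]]]; first by exists 0%N, 0%N.
have [K2 [D2 h2]] := good_all Y e0.
exists (maxn K1 K2), (maxn D1 D2) => K Q m T l.
rewrite gtn_max => /andP[k1 k2] hQ hm hT X; rewrite inE => /predU1P[->|XS].
  apply: (h2 K Q m) hT => //; first by apply: leq_trans hQ; rewrite leq_add2l leq_maxr.
  by move=> i; apply: leq_trans (hm i); rewrite leq_add2l leq_maxr.
apply: (h1 K Q m) hT _ XS => //; first by apply: leq_trans hQ; rewrite leq_add2l leq_maxl.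
by move=> i; apply: leq_trans (hm i); rewrite leq_add2l leq_maxl.
Qed.

(** Factorisation peels off [n] words of shape [(1, ..., 1)]; what remains does not depend on
    [n]. *)
Lemma window_size_growth K D : exists C : nat, forall n,
  (size (window K (zbar r (n + D))) <= size (wseq (zbar r 1)) ^ n * C)%N.
Proof.
exists (\sum_(g : {ffun 'I_r -> 'I_K}) size (wseq (zbar r D + emb g)%R))%N => n.
apply: leq_trans (window_size _ _) _; rewrite big_distrr /=; apply: leq_sum => g _.
have e k q : (size (wseq (zbar r k + q)%R) <= size (wseq (zbar r 1)) ^ k * size (wseq q))%N.
  elim: k => [|k ih].
    have -> : zbar r 0 + q = q by apply/ffunP => i; rewrite zaddE ffunE.
    by rewrite expn0 mul1n.
  have -> : zbar r k.+1 + q = zbar r 1 + (zbar r k + q).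
    by apply/ffunP => i; rewrite !zaddE !ffunE addnA.
  apply: leq_trans (size_wseqD _ _) _.
  by rewrite expnS -mulnA leq_mul2l ih orbT.
have -> : zbar r (n + D) + emb g = zbar r n + (zbar r D + emb g).
  by apply/ffunP => i; rewrite !zaddE !ffunE addnA.
exact: e.
Qed.

Lemma rcp_shift_growth (Omega : set A) (eps : R) : finite_set Omega -> 0 < eps ->
  exists B C : nat, forall n, (rcp (orbit_set Phi Omega n) eps <= (B ^ n * C)%:R%:E)%E.
Proof.
move=> /finite_seqP[S ->] e0; have [K0 [D h]] := good_finite S e0.
(* Neither [K] nor [Q] depends on [n]; the window grows only through its base point
   [zbar r (n + D)]. *)
pose K := K0.+1; pose Q := (K + D)%N.
have [C hC] := window_size_growth K D.
exists (size (wseq (zbar r 1))), C => n.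
have Q0 : (0 < Q)%N by [].
have [om [ost ov ok]] := gauge_state Q0.
have KQ : (K <= Q)%N by rewrite leq_addr.
have [E [Er [phi [psi [uphi upsi hr]]]]] :=
  @window_approx K (zbar r (n + D)) Q om (ltn0Sn K0) KQ ost ov ok.
apply: (@le_trans _ _ (size (window K (zbar r (n + D))))%:R%:E); last first.
  by rewrite lee_fin ler_nat.
apply: ereal_inf_lbound; exists (size (window K (zbar r (n + D)))) => //.
exists E; split=> //; exists phi, psi; split=> // _ [l /= hl [X XS <-]].
have hT : reconstructs K Q (zbar r (n + D)) (fun x => phi (psi x)).
  split=> //.
  - by move=> X' Y; rewrite !linearD.
  - by move=> c X'; rewrite !linearZ.
  - apply: positive_unital_nrm.
    + by move=> X' Y; rewrite !linearD.
    + by move=> c X'; rewrite !linearZ.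
    + by have [-> _] := upsi; have [-> _] := uphi.
    + move=> x; have [_ cphi] := uphi; have [_ cpsi] := upsi.
      (* Positivity is read off from complete positivity on matrices of size 1. *)
      have : mx_pos (\matrix_(i < 1, j < 1) (star x * x)).
        exists (\matrix_(i < 1, j < 1) x); apply/matrixP => i j.
        by rewrite !mxE big_ord1 !mxE.
      move=> /cpsi/cphi[Z] /matrixP/(_ 0 0); rewrite !mxE big_ord1 !mxE => ->.
      exact: pos_star_mul.
rewrite nrmE ltcR; apply: (h K Q _ _ _ (ltnSn K0) (leqnn _) _ hT) => //.
exact: zle_zbar_add.
Qed.

Lemma entropy_canonical_shift : (2 <= r)%N -> entropy Phi = 0%E.
Proof.
move=> r2.
have h0 (Omega : set A) (eps : R) : finite_set Omega -> 0 < eps ->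
    limn_esup (fun n : nat =>
      ((n%:R ^+ r)^-1%:E * lne (rcp (orbit_set Phi Omega n) eps))%E) = 0%E.
  move=> fO e0; have [B [C hBC]] := rcp_shift_growth fO e0.
  apply: (exp_growth_esup r2) hBC => n.
  apply: le_ereal_inf_tmp => _ [d [E [_ hd]] <-].
  by rewrite lee_fin ler1n; exact: has_rank_gt0 hd.
(* Every choice gives the value 0, and the empty [Omega] shows that there is a choice, so the
   supremum is not that of the empty set. *)
rewrite /entropy (_ : [set h | _] = [set 0%E]) ?ereal_sup1//.
apply/seteqP; split=> [h|h ->] /=; last by exists set0, 1; split=> //; rewrite h0.
by move=> [W [eps [fW e0 ->]]]; exact: h0.
Qed.

End GraphAlgebra.

Theorem theorem3p3 (R : realType) (r : nat) (L : rank_graph r)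
    (A : cstarType R) (s : word L -> A) :
  (2 <= r)%N ->
  row_finite L -> finite_set [set: vertex L]%classic -> no_sources L ->
  aperiodic L ->
  is_graph_algebra s ->
  entropy (canonical_shift s) = 0%E.
Proof.
move=> r2 Lrf Lfin _ _ [sfam sgen suniv].
exact: (entropy_canonical_shift Lrf Lfin sfam sgen suniv r2).
Qed.
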